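(* Let $V\leq\underline{\mathbb{R}}^{n+1,1}$ be a strongly conformal harmonic bundle of $(3,1)$-planes over the Riemann surface $\Sigma$. Let $U\leq V$ be the $\mathcal{D}^{0,1}$-holomorphic, isotropic bundle that coincides with $\mathcal{N}_ZV^\perp$ ($Z$ a nonvanishing local section of $T^{1,0}\Sigma$) off a divisor. (a) If $\operatorname{rank}U=2$, there is a unique real, null line subbundle $f\leq V$ which, where it immerses, is a Willmore, non $S$-Willmore, surface with conformal Gauss map $V$. (b) If $\operatorname{rank}U=1$ and $U\cap\overline{U}=\{0\}$, there are exactly two real, null line subbundles $f,\hat f\leq V$ which, where they immerse, are a dual pair of $S$-Willmore surfaces.
   Context: Setting. $\Sigma$ is a Riemann surface. $\mathbb{R}^{n+1,1}$ carries an inner product $(\,,\,)$ of signature $(n+1,1)$, extended complex-bilinearly to $\mathbb{C}^{n+2}$; $\underline{\mathbb{R}}^{n+1,1}=\Sigma\times\mathbb{R}^{n+1,1}$ and $\underline{\mathbb{C}}^{n+2}=\Sigma\times\mathbb{C}^{n+2}$ are trivial bundles, with trivial flat connection $\mathrm{d}$. $U\leq V$ means that $U$ is a subbundle of $V$. No notational distinction is made between a real bundle and its complexification; in particular $U$ is a subbundle of the complexification of $V$. Everything is smooth. Conformal sphere. With $\mathcal{L}=\{v\in\mathbb{R}^{n+1,1}\setminus\{0\} : (v,v)=0\}$, one has $S^n=\mathbb{P}(\mathcal{L})$, and a map $f:\Sigma\to S^n$ is the same as a real null line subbundle $f\leq\underline{\mathbb{R}}^{n+1,1}$. The phrase ''where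 $f$ immerses'' refers to the open set on which $f:\Sigma\to\mathbb{P}(\mathcal{L})$ is an immersion. For an immersion $f$, let $f^{1,0}=\operatorname{span}\{\sigma,\mathrm{d}_Z\sigma : \sigma\in\Gamma f,\ Z\in T^{1,0}\Sigma\}$; $f$ is a conformal immersion iff $f^{1,0}$ is a rank $2$ isotropic subbundle of $\underline{\mathbb{C}}^{n+2}$. Conformal Gauss map. The conformal Gauss map of a conformal immersion $f$ is the bundle of $(3,1)$-planes $\operatorname{span}\{\sigma,\mathrm{d}_Z\sigma,\mathrm{d}_{\bar Z}\sigma,\mathrm{d}_Z\mathrm{d}_{\bar Z}\sigma : \sigma\in\Gamma f,\ Z\in\Gamma T^{1,0}\Sigma\}\leq\underline{\mathbb{R}}^{n+1,1}$. Bundles of $(3,1)$-planes. A bundle of $(3,1)$-planes is a real rank $4$ subbundle $V\leq\underline{\mathbb{R}}^{n+1,1}$ on whose fibres $(\,,\,)$ has signature $(3,1)$. The decomposition $\underline{\mathbb{R}}^{n+1,1}=V\oplus V^\perp$ induces $\mathrm{d}=\mathcal{D}+\mathcal{N}$, where $\mathcal{D}$ is a metric connection preserving $V$ and $V^\perp$, and $\mathcal{N}$ is a $1$-form with values in skew-endomorphisms that map $V$ to $V^\perp$ and $V^\perp$ to $V$. $V$ is strongly conformal if $(\mathcal{N}^{1,0})^2|_{V^\perp}=0$, i.e. $\mathcal{N}_Z\mathcal{N}_ZV^\perp=0$ for all $Z\in T^{1,0}\Sigma$. The tension field is $\tau_V:=*\mathrm{d}^{\mathcal{D}}*\mathcal{N}$,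 where $\mathrm{d}^{\mathcal{D}}$ is the exterior derivative on bundle-valued forms using $\mathcal{D}$ to differentiate coefficients, $*\mathcal{N}=i(\mathcal{N}^{1,0}-\mathcal{N}^{0,1})$, and $*$ on $2$-forms is the Hodge star of any fixed metric in the conformal class of $\Sigma$. $V$ is harmonic if $\tau_V=0$. The bundle $U$. $\underline{\mathbb{C}}^{n+2}$ has the Koszul--Malgrange holomorphic structure with $\bar\partial$-operator $\mathcal{D}^{0,1}$. When $V$ is harmonic, $\mathcal{N}^{1,0}$ is a holomorphic $1$-form for this structure, so $\mathcal{N}_Z|_{V^\perp}$ has constant rank off a divisor and there is a $\mathcal{D}^{0,1}$-holomorphic subbundle $U$ coinciding with $\mathcal{N}_ZV^\perp$ off that divisor; $U$ is isotropic when $V$ is strongly conformal. Willmore surfaces. A conformal immersion is Willmore if its conformal Gauss map is harmonic. Willmore surfaces $f\neq\hat f$ with the same conformal Gauss map are a dual pair (in (b) this common conformal Gauss map is $V$). A Willmore surface $f$ with conformal Gauss map $V$ is $S$-Willmore (Ejiri) if, for local nonvanishing $\sigma\in\Gamma f$ and local holomorphic coordinate $z$, with $\kappa$ the $V^\perp$-component of $\sigma_{zz}$, the sections $\kappa$ and $\mathcal{D}_{\partial_{\bar z}}\kappa$ of the complexification of $V^\perp$ are linearly dependent at every point.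
   Formalization: In (b) V is assumed orientable (else the two null lines may be interchanged globally); since nowhere-immersing subbundles qualify vacuously, uniqueness is asserted where a subbundle immerses, and everywhere if its sections' first derivatives lie in V. *)

(* Defs.v *)
From HB Require Import structures.
From mathcomp Require Import all_boot all_order all_algebra.
From mathcomp Require Import ring complex.
From mathcomp Require Import all_classical all_reals all_analysis.
Import Order.TTheory GRing.Theory Num.Theory.
Import numFieldNormedType.Exports.

Set Implicit Arguments.
Unset Strict Implicit.
Unset Printing Implicit Defensive.

Local Open Scope classical_set_scope.
Local Open Scope complex_scope.
Local Open Scope ring_scope.

(* R * R is identified with the complex plane by (x, y) |-> x + i y. *)
Definition e1 (R : realType) : R * R := (1, 0).
Definition e2 (R : realType) : R * R := (0, 1).

Fixpoint Ck (R : realType) (k : nat) (D : set (R * R)) (g : R * R -> R) : Prop :=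
  if k is k'.+1 then
    [/\ forall x, D x -> derivable g x (e1 R) /\ derivable g x (e2 R),
        Ck k' D (fun x => 'D_(e1 R) g x)
      & Ck k' D (fun x => 'D_(e2 R) g x)]
  else forall x, D x -> {for x, continuous g}.

Definition smooth_plane (R : realType) (D : set (R * R)) (g : R * R -> R) :=
  forall k, Ck k D g.

(* Only the values of [cmap] on [cdom], and of [cinv] on the image of [cdom],
   are meaningful. *)
Record chart (R : realType) (T : topologicalType) := Chart {
  cdom : set T;
  cmap : T -> R * R;
  cinv : R * R -> T;
  cdom_open : open cdom;
  cimg_open : open (cmap @` cdom);
  cmapK : {in cdom, cancel cmap cinv};
  cmap_continuous : forall p, cdom p -> {for p, continuous cmap};
  cinv_continuous :
    forall x, (cmap @` cdom) x -> {for x, continuous cinv} }.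

(* Holomorphy: smoothness together with the Cauchy-Riemann equations. *)
Definition holomorphic_on (R : realType) (D : set (R * R))
    (t : R * R -> R * R) : Prop :=
  [/\ smooth_plane D (fun x => (t x).1), smooth_plane D (fun x => (t x).2)
    & forall x, D x ->
        'D_(e1 R) (fun y => (t y).1) x = 'D_(e2 R) (fun y => (t y).2) x /\
        'D_(e2 R) (fun y => (t y).1) x = - 'D_(e1 R) (fun y => (t y).2) x].

(* Second countability is automatic (Rado) and is not required. *)
Record riemann_surface (R : realType) := RiemannSurface {
  rs_carrier :> topologicalType;
  atlas : set (chart R rs_carrier);
  rs_hausdorff : hausdorff_space rs_carrier;
  rs_connected : connected [set: rs_carrier];
  rs_nonempty : [set: rs_carrier] !=set0;
  atlas_cover : forall p, exists2 c, atlas c & cdom c p;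
  atlas_holomorphic : forall c c', atlas c -> atlas c' ->
    holomorphic_on (cmap c @` (cdom c `&` cdom c')) (cmap c' \o cinv c) }.

Definition mink (K : nzRingType) (k : nat) (i : 'I_k.+1) : K :=
  if i == ord_max then -1 else 1.

(* On K = R[i] this is the complex-bilinear (not Hermitian) extension. *)
Definition ip (K : fieldType) (k : nat) (v w : 'rV[K]_k.+1) : K :=
  \sum_i mink K i * v 0 i * w 0 i.

Definition perp (K : fieldType) (k : nat) (E : {vspace 'rV[K]_k.+1}) :
    {vspace 'rV[K]_k.+1} :=
  lker (linfun (fun w : 'rV[K]_k.+1 =>
                  \row_(i < \dim E) ip (tnth (vbasis E) i) w)).

Lemma mem_perp (K : fieldType) (k : nat) (E : {vspace 'rV[K]_k.+1}) w :
  w \in perp E <-> (forall v, v \in E -> ip v w = 0).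
Proof.
pose g := fun w : 'rV[K]_k.+1 => \row_(i < \dim E) ip (tnth (vbasis E) i) w.
have gl : linear g.
  move=> a u v; apply/rowP=> i; rewrite !mxE /ip mulr_sumr -big_split /=.
  by apply: eq_bigr => j _; rewrite !mxE; ring.
pose gL : {linear 'rV[K]_k.+1 -> 'rV[K]_(\dim E)} := HB.pack g (GRing.isLinear.Build K _ _ *:%R g gl).
have E1 : linfun g = linfun gL by [].
rewrite /perp -/g memv_ker E1 lfunE /=; split.
  move/eqP=> h v /coord_vbasis ->.
  rewrite /ip.
  transitivity (\sum_(i < \dim E) coord (vbasis E) i v * ip (tnth (vbasis E) i) w).
    under [RHS]eq_bigr do rewrite /ip mulr_sumr.
    rewrite exchange_big /=; apply: eq_bigr => j _.
    rewrite summxE mulr_sumr mulr_suml; apply: eq_bigr => i _.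
    by rewrite !mxE (tnth_nth 0) mulrCA !mulrA.
  apply: big1 => i _; move/rowP: h => /(_ i); rewrite !mxE => ->; exact: mulr0.
move=> h; apply/eqP/rowP=> i; rewrite !mxE; apply: h.
by apply: vbasis_mem; apply: mem_tnth.
Qed.

Definition isotropic (K : fieldType) (k : nat) (E : {vspace 'rV[K]_k.+1}) :=
  forall v w, v \in E -> w \in E -> ip v w = 0.

Definition rows (K : fieldType) (r m : nat) (F : 'M[K]_(r, m)) :
    seq 'rV[K]_m := [seq row i F | i : 'I_r].

Definition signature31 (R : realType) (n : nat) (E : {vspace 'rV[R]_n.+2}) :=
  exists F : 'M[R]_(4, n.+2),
    basis_of E (rows F) /\
    forall i j, ip (row i F) (row j F) = if i == j then mink R i else 0.

Section Complexification.
Context {R : realType} {m : nat}.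

Definition cvec (v : 'rV[R]_m) : 'rV[R[i]]_m := map_mx (real_complex R) v.

Definition cplx (E : {vspace 'rV[R]_m}) : {vspace 'rV[R[i]]_m} :=
  <<map cvec (vbasis E)>>%VS.

Definition conjv (E : {vspace 'rV[R[i]]_m}) : {vspace 'rV[R[i]]_m} :=
  <<map (map_mx (@conjc R)) (vbasis E)>>%VS.

End Complexification.

Section Surface.
Context {R : realType} {S : riemann_surface R}.
Implicit Types (c : chart R S) (W O : set S) (p q : S).

Definition smooth_fun W (g : S -> R) : Prop :=
  forall c, atlas c ->
    smooth_plane (cmap c @` (W `&` cdom c)) (g \o cinv c).

Definition rsmooth (r m : nat) W (F : S -> 'M[R]_(r, m)) : Prop :=
  forall i j, smooth_fun W (fun p => F p i j).

Definition csmooth (r m : nat) W (F : S -> 'M[R[i]]_(r, m)) : Prop :=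
  forall i j, smooth_fun W (fun p => complex.Re (F p i j)) /\
              smooth_fun W (fun p => complex.Im (F p i j)).

(* Derivative along the coordinate direction e in the chart c. *)
Definition pder c (e : R * R) (g : S -> R) p : R :=
  'D_e (g \o cinv c) (cmap c p).

Definition rder (m : nat) c (e : R * R) (s : S -> 'rV[R]_m) p : 'rV[R]_m :=
  \row_j pder c e (fun q => s q 0 j) p.

Definition cder (m : nat) c (e : R * R) (s : S -> 'rV[R[i]]_m) p :
    'rV[R[i]]_m :=
  \row_j (pder c e (fun q => complex.Re (s q 0 j)) p
          +i* pder c e (fun q => complex.Im (s q 0 j)) p).

(* The derivatives along d/dz and d/dzbar, for z = x + i y the coordinate of
   the chart c.  Every section of T^{1,0} over the chart is a multiple of
   d/dz. *)
Definition dz (m : nat) c (s : S -> 'rV[R[i]]_m) p : 'rV[R[i]]_m :=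
  2^-1 *: (cder c (e1 R) s p - (0 +i* 1) *: cder c (e2 R) s p).

Definition dzbar (m : nat) c (s : S -> 'rV[R[i]]_m) p : 'rV[R[i]]_m :=
  2^-1 *: (cder c (e1 R) s p + (0 +i* 1) *: cder c (e2 R) s p).

Definition frame (K : fieldType) (r m : nat) O (F : S -> 'M[K]_(r, m))
    (E : S -> {vspace 'rV[K]_m}) : Prop :=
  forall q, O q -> basis_of (E q) (rows (F q)).

Definition rsubbundle (m r : nat) (E : S -> {vspace 'rV[R]_m}) : Prop :=
  forall p, exists O, exists F : S -> 'M[R]_(r, m),
    [/\ open O, O p, rsmooth O F & frame O F E].

Definition csubbundle (m r : nat) (E : S -> {vspace 'rV[R[i]]_m}) : Prop :=
  forall p, exists O, exists F : S -> 'M[R[i]]_(r, m),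
    [/\ open O, O p, csmooth O F & frame O F E].

(* Fibrewise choice of a basis E_p which is, near each point, in the same
   orientation class as a smooth local frame. *)
Definition orientable (m r : nat) (V : S -> {vspace 'rV[R]_m}) : Prop :=
  exists E : S -> 'M[R]_(r, m), forall p,
    exists O, exists F : S -> 'M[R]_(r, m),
      [/\ open O, O p, rsmooth O F, frame O F V
        & forall q, O q -> exists2 A : 'M[R]_r, 0 < \det A & E q = A *m F q].

Section Harmonic.
Context {n : nat}.
Local Notation rvec := 'rV[R]_n.+2.
Local Notation cvect := 'rV[R[i]]_n.+2.
Implicit Types (V : S -> {vspace rvec}) (f g : S -> {vspace rvec}).
Implicit Types (U : S -> {vspace cvect}).

Definition bundle31 V : Prop :=
  rsubbundle 4 V /\ forall p, signature31 (V p).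

Definition Vperp V p : {vspace cvect} := perp (cplx (V p)).

Definition tang V p (v : cvect) : cvect :=
  daddv_pi (cplx (V p)) (Vperp V p) v.

Definition nrml V p (v : cvect) : cvect :=
  daddv_pi (Vperp V p) (cplx (V p)) v.

(* In the following d is [dz c] or [dzbar c], and stands for differentiation
   along d/dz or d/dzbar.  By definition d = cD V d + cN V d. *)
Definition cD V (d : (S -> cvect) -> S -> cvect) (s : S -> cvect) p : cvect :=
  tang V p (d (fun q => tang V q (s q)) p) +
  nrml V p (d (fun q => nrml V q (s q)) p).

Definition cN V (d : (S -> cvect) -> S -> cvect) (s : S -> cvect) p : cvect :=
  nrml V p (d (fun q => tang V q (s q)) p) +
  tang V p (d (fun q => nrml V q (s q)) p).

(* cN is tensorial: its value at p as an endomorphism of the fibre is computed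
   on constant sections. *)
Definition Nend V (d : (S -> cvect) -> S -> cvect) p (v : cvect) : cvect :=
  cN V d (fun=> v) p.

Definition strongly_conformal V : Prop :=
  forall c p v, atlas c -> cdom c p -> v \in Vperp V p ->
    Nend V (dz c) p (Nend V (dz c) p v) = 0.

(* The connection induced by cD on sections A of the endomorphism bundle. *)
Definition cDend V (d : (S -> cvect) -> S -> cvect) (A : S -> cvect -> cvect)
    p (v : cvect) : cvect :=
  cD V d (fun q => A q v) p - A p (cD V d (fun=> v) p).

(* An endomorphism-valued 1-form, in a chart, is the pair (A, B) of its
   coefficients: A dz + B dzbar. *)
Definition form1 : Type :=
  ((S -> cvect -> cvect) * (S -> cvect -> cvect))%type.

Definition Nform V c : form1 := (Nend V (dz c), Nend V (dzbar c)).

Definition star1 (w : form1) : form1 :=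
  (fun p v => (0 +i* 1) *: w.1 p v, fun p v => - ((0 +i* 1) *: w.2 p v)).

(* Coefficient of dz /\ dzbar in the exterior derivative d^D w. *)
Definition extD V c (w : form1) p (v : cvect) : cvect :=
  cDend V (dz c) w.2 p v - cDend V (dzbar c) w.1 p v.

(* Hodge star with respect to the flat metric |dz|^2 of the chart, for which
   *(dz /\ dzbar) = -2i; for another metric of the conformal class, the
   tension is multiplied by a positive function. *)
Definition tension V c p (v : cvect) : cvect :=
  (0 +i* - 2) *: extD V c (star1 (Nform V c)) p v.

Definition harmonic_bundle W V : Prop :=
  forall c p, atlas c -> W p -> cdom c p -> forall v, tension V c p v = 0.

Definition holomorphic_subbundle V U : Prop :=
  forall O (u : S -> cvect) c p,
    open O -> csmooth O u -> (forall q, O q -> u q \in U q) ->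
    atlas c -> O p -> cdom c p -> cD V (dzbar c) u p \in U p.

(* A set without limit points is the support of a divisor. *)
Definition coincides_off_divisor V U : Prop :=
  exists2 Delta : set S, limit_point Delta = set0 &
    forall c p, atlas c -> cdom c p -> ~ Delta p -> forall u,
      u \in U p <-> exists2 v, v \in Vperp V p & u = Nend V (dz c) p v.

Definition is_bundle_U V U (r : nat) : Prop :=
  [/\ csubbundle r U, (forall p, (U p <= cplx (V p))%VS),
      holomorphic_subbundle V U, (forall p, isotropic (U p))
    & coincides_off_divisor V U].

Definition null_line_subbundle V f : Prop :=
  [/\ rsubbundle 1 f, (forall p, isotropic (f p))
    & forall p, (f p <= V p)%VS].

Definition local_section f O (s : S -> rvec) : Prop :=
  [/\ open O, rsmooth O s & forall q, O q -> s q \in f q /\ s q != 0].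

Definition csec (s : S -> rvec) : S -> cvect := fun q => cvec (s q).

(* Injectivity of the differential T_p S -> Hom(f, R^{n+1,1} / f). *)
Definition immersed_at f p : Prop :=
  forall c O s, atlas c -> cdom c p -> O p -> local_section f O s ->
    free [:: s p; rder c (e1 R) s p; rder c (e2 R) s p].

Definition immersed_locus f : set S := [set p | immersed_at f p].

Definition f10 c (s : S -> rvec) p : {vspace cvect} :=
  <<[:: csec s p; dz c (csec s) p]>>%VS.

Definition conformal_immersion W f : Prop :=
  W `<=` immersed_locus f /\
  forall c p O s, atlas c -> W p -> cdom c p -> O p -> local_section f O s ->
    \dim (f10 c s p) = 2%N /\ isotropic (f10 c s p).

Definition gauss_span c (s : S -> rvec) p : {vspace cvect} :=
  <<[:: csec s p; dz c (csec s) p; dzbar c (csec s) p;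
        dz c (dzbar c (csec s)) p]>>%VS.

Definition conformal_gauss_map W f V : Prop :=
  forall c p O s, atlas c -> W p -> cdom c p -> O p -> local_section f O s ->
    gauss_span c s p = cplx (V p).

Definition willmore W f V : Prop :=
  [/\ conformal_immersion W f, conformal_gauss_map W f V & harmonic_bundle W V].

Definition kappa V c (s : S -> rvec) p : cvect :=
  nrml V p (dz c (dz c (csec s)) p).

Definition s_willmore W f V : Prop :=
  willmore W f V /\
  forall c p O s, atlas c -> W p -> cdom c p -> O p -> local_section f O s ->
    ~~ free [:: kappa V c s p; cD V (dzbar c) (kappa V c s) p].

Definition dual_pair W f g V : Prop :=
  [/\ willmore W f V, willmore W g V & exists2 p, W p & f p <> g p].

(* The phrase "where f immerses": nothing is claimed if f immerses nowhere,
   for instance if f is constant. *)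
Definition where_immerses f (P : set S -> Prop) : Prop :=
  immersed_locus f !=set0 -> P (immersed_locus f).

(* V contains the first derivatives of the sections of f at every point,
   including the points where f does not immerse.  If f has conformal Gauss
   map V on a dense subset then this holds by continuity. *)
Definition envelops V f : Prop :=
  forall c p O s, atlas c -> cdom c p -> O p -> local_section f O s ->
    rder c (e1 R) s p \in V p /\ rder c (e2 R) s p \in V p.

End Harmonic.
End Surface.

(* Main.v *)
Require Import Defs.
From mathcomp Require Import all_boot all_order all_algebra.
From mathcomp Require Import perm ring lra zify complex.
From mathcomp Require Import all_classical all_reals all_analysis.

(** Let P be the projection of the trivial bundle onto V along its orthogonal.
    Everything about V can be read off this smooth family of matrices: the
    second fundamental form in the direction d/dz is N_z = P_z (1 - 2P), and
    D = d - N.  Equality of mixed derivatives gives the Codazzi equation, and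
    with it harmonicity becomes D_zbar N_z = 0 ([harmonic_holomorphic]).  As N_z
    is skew and U is the image of the orthogonal of V off the divisor, the
    kernel of N_z in V is there the orthogonal of U ([ker_NmxP]).  The complement
    of the divisor being dense, sections of V orthogonal to U are killed by N_z
    everywhere, and sections of V killed by N_z are orthogonal to U everywhere
    ([orthU_Nmx], [Nmx_orthU]).

    The candidates are therefore the real null lines f of V orthogonal to U.
    Let s be a section of such a line, and let u in U be off this line.  Then
    s_z and s_zbar lie in V, since N kills s.  Holomorphy of U makes s_zbar
    orthogonal to U, and it is orthogonal to s, so it lies in the isotropic
    plane of s and u, which is its own orthogonal in the four-dimensional V
    ([iso_plane]).  Hence N_z s_zbar = 0, so that s_zzbar lies in V as well, and
    (s_zbar, s_zbar) = 0, so that f is conformal.  Where f immerses,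
    (s_zzbar, s) = - (s_z, s_zbar) does not vanish, and s, s_z, s_zbar, s_zzbar
    span V: the Gauss map of f is V, and f is Willmore ([envelope_willmore]).
    Moreover kappa = N_z s_z and, by harmonicity, D_zbar kappa = N_z s_zzbar
    ([kappa_csec]).  Conversely, a line whose Gauss map is V has its first
    derivatives in V, so N_z kills it and it is orthogonal to U
    ([immersed_orthU], [envelops_orthU]).

    If U has rank 2, it is its own orthogonal in V, and f consists of its real
    points.  Write Fu = A + i B for a frame of U.  Since U is isotropic, the
    Gram matrix of the rows of A and B has the shape [[P, Q], [-Q, P]], whose
    determinant |det (P + i Q)|^2 is nonnegative, while a basis of a
    (3,1)-space has negative Gram determinant.  So these rows are dependent and
    U contains a nonzero real vector; two real vectors of U are orthogonal null vectors
    of a Lorentzian space, hence proportional ([plane_mx_corank1]).  A linear relation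
    between kappa and D_zbar kappa off the divisor would put a combination of
    s_z and s_zzbar in U, where pairing with s and s_zbar makes it trivial: f is
    not S-Willmore ([realU_not_swillmore]).

    If U is spanned by u = a + i b and no nonzero multiple of u is real, then
    a and b span a definite plane and its orthogonal in V is a Lorentzian
    plane, with exactly two null lines.  To define them as smooth bundles, they
    are separated by the orientation of V: for a null vector v of that plane,
    h (v, w) times the volume density equals vol (a, b, v, w) for all w, up to a
    sign which depends only on the line of v ([null_on_line]).  Each sign gives
    a linear equation for v of corank one ([line_mx_corank1]), whose kernel is
    smooth ([rsubbundle_kernel]) and independent of the choices of a frame and
    of u ([on_line_gen_frame], [on_line_gen_scale]).  Here a suitable combination of s_z
    and s_zzbar is orthogonal to the single vector u, hence killed by N_z, which
    makes kappa and D_zbar kappa dependent ([nullU_swillmore]).  A bundle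
    enveloping V is one of the two lines at each point, and the same one at all
    points because the surface is connected ([two_lines_global]). *)

Import Order.TTheory GRing.Theory Num.Theory.
Import numFieldNormedType.Exports.

Set Implicit Arguments.
Unset Strict Implicit.
Unset Printing Implicit Defensive.

Local Open Scope classical_set_scope.
Local Open Scope complex_scope.
Local Open Scope ring_scope.

(** * Calculus in the plane *)

Section PlaneCalculus.
Context {R : realType}.
Implicit Types (D : set (R * R)) (f g G : R * R -> R) (x y v : R * R).

Lemma is_derive_line G x v t : derivable G (t *: v + x) v ->
  is_derive t 1 (fun s : R => G (s *: v + x)) ('D_v G (t *: v + x)).
Proof.
have E : (fun h : R => h^-1 *: (((fun s : R => G (s *: v + x)) \o shift t) (h *: 1) -
     G (t *: v + x))) =
  (fun h => h^-1 *: ((G \o shift (t *: v + x)) (h *: v) - G (t *: v + x))).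
  by apply/funext => h /=; rewrite [h *: 1]mulr1 scalerDl addrA.
by move=> dG; split; rewrite /derivable /derive /= E.
Qed.

Lemma is_derive_of_line G x v l :
  is_derive (0 : R) (1 : R) (fun h : R => G (h *: v + x)) l -> is_derive x v G l.
Proof.
have E : (fun h : R => h^-1 *: (((fun s : R => G (s *: v + x)) \o shift 0) (h *: 1) -
     G (0 *: v + x))) =
  (fun h => h^-1 *: ((G \o shift x) (h *: v) - G x)).
  by apply/funext => h /=; rewrite [h *: 1]mulr1 addr0 scale0r add0r.
by case; rewrite /derivable /derive /= E => dG dE; split.
Qed.

Lemma line_mvt G x v (h : R) :
  (forall t : R, `|t| <= `|h| -> derivable G (t *: v + x) v) ->
  exists2 t : R, `|t| <= `|h| &
    G (h *: v + x) - G x = h * 'D_v G (t *: v + x).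
Proof.
move=> dG.
pose f (s : R) := G (s *: v + x).
have df (s : R) : `|s| <= `|h| -> is_derive s (1 : R) f ('D_v G (s *: v + x)).
  by move=> sh; apply/is_derive_line/dG.
have cf (i : interval R) : (forall s, s \in i -> `|s| <= `|h|) -> {within [set` i], continuous f}.
  move=> ih; apply: derivable_within_continuous => s /ih /df; by case.
case: (ltrgt0P h) => [h0|h0|->].
- case: (@MVT _ f (fun s => 'D_v G (s *: v + x)) 0 h h0).
  + move=> s; rewrite in_itv /= => /andP[s0 sh]; apply: df.
    by rewrite !gtr0_norm // ltW.
  + apply: cf => s; rewrite in_itv /= => /andP[s0 sh].
    by rewrite ger0_norm // gtr0_norm.
  move=> t; rewrite in_itv /= => /andP[t0 th].
  rewrite {1 2}/f scale0r add0r subr0 mulrC => E; exists t => //.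
  by rewrite !gtr0_norm // ltW.
- case: (@MVT _ f (fun s => 'D_v G (s *: v + x)) h 0 h0).
  + move=> s; rewrite in_itv /= => /andP[s0 sh]; apply: df.
    by rewrite !ltr0_norm // lerN2 ltW.
  + apply: cf => s; rewrite in_itv /= => /andP[s0 sh].
    by rewrite ler0_norm // ltr0_norm // lerN2.
  move=> t; rewrite in_itv /= => /andP[t0 th].
  rewrite {1 2}/f scale0r add0r sub0r mulrC => E; exists t => //.
    by rewrite !ltr0_norm // lerN2 ltW.
  by rewrite -opprB E mulNr opprK.
- by exists 0; rewrite ?normr0 ?scale0r ?add0r ?subrr ?mul0r.
Qed.

Lemma ball_planeP x (e : R) y : ball x e y <-> `|x.1 - y.1| < e /\ `|x.2 - y.2| < e.
Proof. by []. Qed.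

Lemma open_ballP D x : open D -> D x -> exists2 e : R, 0 < e & ball x e `<=` D.
Proof. by move=> oD Dx; have /nbhs_ballP[e /= e0 De] := open_nbhs_nbhs (conj oD Dx); exists e. Qed.

Lemma e1E (t a b : R) : t *: e1 R + (a, b) = (a + t, b).
Proof. by congr (_, _); rewrite /= ?[_ *: 1]mulr1 ?[_ *: 0]mulr0 ?add0r // addrC. Qed.

Lemma e2E (t a b : R) : t *: e2 R + (a, b) = (a, b + t).
Proof. by congr (_, _); rewrite /= ?[_ *: 1]mulr1 ?[_ *: 0]mulr0 ?add0r // addrC. Qed.

(** Going from y to z along one axis and then along the other, the mean value
    theorem applies on each leg; the points it gives lie as close to y as z. *)
Lemma increment_c1 D G y : open D -> Ck 1 D G -> D y ->
  \forall z \near y, exists xi : (R * R) * (R * R),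
    [/\ `|y - xi.1| <= `|y - z|, `|y - xi.2| <= `|y - z| &
     G z - G y = (z.1 - y.1) * 'D_(e1 R) G xi.1 + (z.2 - y.2) * 'D_(e2 R) G xi.2].
Proof.
move=> oD [dG _ _] Dy.
have [e e0 De] := open_ballP oD Dy.
near=> z.
have /ball_planeP[z1 z2] : ball y e z by near: z; exact: nbhsx_ballx.
have Db a b : `|a - y.1| < e -> `|b - y.2| < e -> D (a, b).
  by move=> ae be; apply: De; apply/ball_planeP => /=; rewrite !(distrC y.1, distrC y.2).
have e20 : `|y.2 - y.2| < e by rewrite subrr normr0.
case: (@line_mvt G (y.1, z.2) (e1 R) (z.1 - y.1)).
  move=> t th; rewrite e1E; apply: (dG _ _).1; apply: Db.
    by rewrite addrAC subrr add0r (le_lt_trans th) // distrC.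
  by rewrite distrC.
  move=> t th; rewrite !e1E [y.1 + (z.1 - _)]addrC subrK => E1.
case: (@line_mvt G y (e2 R) (z.2 - y.2)).
  move=> s sh; rewrite (surjective_pairing y) e2E; apply: (dG _ _).2; apply: Db => /=.
    by rewrite subrr normr0.
  by rewrite addrAC subrr add0r (le_lt_trans sh) // distrC.
move=> s sh; rewrite (surjective_pairing y) !e2E /= [y.2 + (z.2 - _)]addrC subrK => E2.
exists ((y.1 + t, z.2), (y.1, y.2 + s)); split => /=.
- rewrite !prod_normE /= (_ : y.1 - (y.1 + t) = - t); last by rewrite opprD addrA subrr sub0r.
  by rewrite normrN ge_max !le_max lexx orbT andbT (distrC y.1 z.1) th.
- rewrite !prod_normE /= (_ : y.2 - (y.2 + s) = - s); last by rewrite opprD addrA subrr sub0r.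
  by rewrite normrN subrr normr0 ge_max !le_max normr_ge0 (distrC y.2 z.2) sh orbT.
- rewrite -E1 -E2 -!surjective_pairing; ring.
Unshelve. all: by end_near. Qed.

Lemma derivable_continuous0 (W : normedModType R) (t : R * R -> W) x v : derivable t x v ->
  (t \o shift x) (h *: v) @[h --> (0 : R)] --> t x.
Proof.
move=> dt.
have /differentiable_continuous : differentiable (fun h : R => t (h *: v + x)) 0.
  exact/derivable1_diffP/(derivable1P _ _ _).1.
by rewrite /prop_for /continuous_at /= scale0r add0r.
Qed.

(** By [increment_c1] the difference quotient is a sum of products of a
    difference quotient of a component of t and of a partial derivative of G at
    a point tending to t x. *)
Lemma chain_rule D G (t : R * R -> R * R) x v : open D -> Ck 1 D G -> D (t x) ->
  derivable (fun y => (t y).1) x v -> derivable (fun y => (t y).2) x v ->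
  is_derive x v (G \o t)
    ('D_v (fun y => (t y).1) x * 'D_(e1 R) G (t x) +
     'D_v (fun y => (t y).2) x * 'D_(e2 R) G (t x)).
Proof.
move=> oD CG Dt d1 d2.
have := increment_c1 oD CG Dt.
pose Q (z : R * R) (w : (R * R) * (R * R)) : Prop :=
  [/\ `|t x - w.1| <= `|t x - z|, `|t x - w.2| <= `|t x - z| &
     G z - G (t x) = (z.1 - (t x).1) * 'D_(e1 R) G w.1 + (z.2 - (t x).2) * 'D_(e2 R) G w.2].
have /choice[xi xiP] : forall z, exists w', (exists w, Q z w) -> Q z w'.
  move=> z.
  have [[w wP]|nw] := pselect (exists w, Q z w); first by exists w.
  by exists ((0, 0), (0, 0)).
move=> near_incr.
have tc : (t \o shift x) (h *: v) @[h --> (0 : R)] --> t x.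
  have c1 := derivable_continuous0 d1; have c2 := derivable_continuous0 d2.
  rewrite (surjective_pairing (t x)) (_ : (fun h : R => _) =
    fun h => ((t (h *: v + x)).1, (t (h *: v + x)).2)); first exact: cvg_pair c1 c2.
  by apply/funext => h; rewrite /= -surjective_pairing.
have near_h : \forall h \near (0 : R), Q (t (h *: v + x)) (xi (t (h *: v + x))).
  have := tc _ near_incr. apply: (@filterS _ (nbhs (0 : R))) => h; exact: xiP.
have xc (P : (R * R) * (R * R) -> R * R) :
  (\forall h \near (0 : R), `|t x - P (xi (t (h *: v + x)))| <= `|t x - t (h *: v + x)|) ->
  P (xi (t (h *: v + x))) @[h --> (0 : R)] --> t x.
  move=> hP; apply/cvgrPdist_lt => e e0; near=> h.
  apply: le_lt_trans (_ : `|t x - t (h *: v + x)| < e); first by near: h.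
  near: h; move/cvgrPdist_lt: tc; exact.
case: CG => _ CG1 CG2.
have lim0 : (fun h : R => h^-1 *: (((G \o t) \o shift x) (h *: v) - (G \o t) x)) @ 0^' -->
  ('D_v (fun y => (t y).1) x * 'D_(e1 R) G (t x) +
     'D_v (fun y => (t y).2) x * 'D_(e2 R) G (t x)).
  pose q1 (h : R) := h^-1 *: ((t (h *: v + x)).1 - (t x).1).
  pose q2 (h : R) := h^-1 *: ((t (h *: v + x)).2 - (t x).2).
  apply: cvg_trans (_ : q1 h * 'D_(e1 R) G (xi (t (h *: v + x))).1 +
    q2 h * 'D_(e2 R) G (xi (t (h *: v + x))).2 @[h --> 0^'] --> _).
    apply: near_eq_cvg; apply: cvg_within; near=> h.
    have [_ _ E] : Q (t (h *: v + x)) (xi (t (h *: v + x))) by near: h.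
    by rewrite /= E scalerDr /q1 /q2 -!scalerAl.
  apply: cvgD; apply: cvgM.
  - exact: d1.
  - apply: (@cvg_comp _ _ _ _ ('D_(e1 R) G)) (CG1 _ Dt).
    apply: cvg_within_filter; apply: (xc fst).
    by apply: filterS near_h => h [].
  - exact: d2.
  - apply: (@cvg_comp _ _ _ _ ('D_(e2 R) G)) (CG2 _ Dt).
    apply: cvg_within_filter; apply: (xc snd).
    by apply: filterS near_h => h [].
split; first by apply/cvg_ex; eexists; exact: lim0.
exact: (cvg_lim (@norm_hausdorff _ _) lim0).
Unshelve. all: by end_near. Qed.

Lemma is_derive_translate G w x v : derivable G (w + x) v ->
  is_derive x v (fun y => G (w + y)) ('D_v G (w + x)).
Proof.
have E : (fun h : R => h^-1 *: (((fun y => G (w + y)) \o shift x) (h *: v) - G (w + x))) =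
  (fun h => h^-1 *: ((G \o shift (w + x)) (h *: v) - G (w + x))).
  by apply/funext => h /=; rewrite addrCA.
by move=> dG; split; rewrite /derivable /derive /= E.
Qed.

(** Apply the mean value theorem along e to the increment of G along e', and
    then along e' to the derivative of G along e. *)
Lemma box_mvt D G e e' x w (h : R) : w = h *: e' + (h *: e + x) ->
  (forall y, D y -> derivable G y e) -> (forall y, D y -> derivable ('D_e G) y e') ->
  (forall t s : R, `|t| <= `|h| -> `|s| <= `|h| -> D (s *: e' + (t *: e + x))) ->
  exists2 y, D y & G w - G (h *: e + x) - (G (h *: e' + x) - G x) = h * (h * 'D_e' ('D_e G) y).
Proof.
move=> -> dG ddG boxD; pose K (y : R * R) := G (h *: e' + y) - G y.
have in0 t : `|t| <= `|h| -> D (t *: e + x).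
  by move=> th; have := boxD t 0 th; rewrite scale0r add0r normr0 normr_ge0; apply.
have dK (t : R) : `|t| <= `|h| -> is_derive (t *: e + x) e K
    ('D_e G (h *: e' + (t *: e + x)) - 'D_e G (t *: e + x)).
  move=> th; apply: is_deriveB; last by apply: derivableP; exact: dG (in0 t th).
  by apply: is_derive_translate; apply: dG; exact: boxD.
have [t th E1] := @line_mvt K x e h (fun t th => ex_derive (is_derive := dK t th)).
have [|s sh E2] := @line_mvt ('D_e G) (t *: e + x) e' h.
  by move=> s sh; apply: ddG; exact: boxD.
exists (s *: e' + (t *: e + x)); first exact: boxD.
by rewrite -E2 -(derive_val (is_derive := dK _ th)) -E1.
Qed.

Lemma continuous_dist G x (e : R) : {for x, continuous G} -> 0 < e ->
  nbhs x [set y | `|G x - G y| < e].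
Proof. by move=> cG e0; move/cvgrPdist_lt: cG => /(_ e e0). Qed.

Lemma close_to_common (a b c e : R) : `|a - c| < e / 2 -> `|b - c| < e / 2 -> `|a - b| <= e.
Proof.
move=> ac bc; rewrite (_ : a - b = (a - c) - (b - c)); last by ring.
by rewrite (le_trans (ler_normB _ _)) // [e]splitr ltW // ltrD.
Qed.

(** The second difference of G over a small square is symmetric in the two
    axes and, by [box_mvt], is h^2 times either mixed derivative at some nearby
    point; both mixed derivatives are continuous. *)
Lemma schwarz D G x : open D -> Ck 2 D G -> D x ->
  'D_(e1 R) ('D_(e2 R) G) x = 'D_(e2 R) ('D_(e1 R) G) x.
Proof.
move=> oD [dG [d1 _ c12] [d2 c21 _]] Dx.
apply/eqP; rewrite -subr_eq0 -normr_le0; apply/ler_addgt0Pr => e e0; rewrite add0r.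
have e20 : 0 < e / 2 by rewrite divr_gt0.
pose B : set (R * R) := [set y | [/\ D y, `|'D_(e2 R) ('D_(e1 R) G) x - 'D_(e2 R) ('D_(e1 R) G) y|
  < e / 2
  & `|'D_(e1 R) ('D_(e2 R) G) x - 'D_(e1 R) ('D_(e2 R) G) y| < e / 2]].
have : nbhs x B.
  have nD : nbhs x D by exact: open_nbhs_nbhs.
  have n12 := filterI (continuous_dist (c12 x Dx) e20) (continuous_dist (c21 x Dx) e20).
  by apply: (filterS _ (filterI nD (n12 _))) => y [Dy [h1 h2]]; exact: And3 Dy h1 h2.
move=> /nbhs_ballP[d /= d0 dP]; pose h := d / 2.
have h0 : 0 < h by rewrite divr_gt0.
have hd : `|h| < d by rewrite gtr0_norm // ltr_pdivrMr // ltr_pMr // ltrDl.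
have inball (t s : R) : `|t| <= `|h| -> `|s| <= `|h| -> ball x d (s *: e2 R + (t *: e1 R + x)).
  move=> th sh; rewrite [X in _ + (_ + X)]surjective_pairing e1E e2E; apply/ball_planeP => /=.
  by rewrite !opprD !addrA !subrr !sub0r !normrN; split; apply: le_lt_trans hd.
have swap (t s : R) : s *: e2 R + (t *: e1 R + x) = t *: e1 R + (s *: e2 R + x) by exact: addrCA.
have inball' (t s : R) : `|t| <= `|h| -> `|s| <= `|h| -> ball x d (s *: e1 R + (t *: e2 R + x)).
  by move=> th sh; rewrite -swap; exact: inball.
pose w := h *: e2 R + (h *: e1 R + x).
have b1 y : B y -> derivable G y (e1 R).
  by case=> Dy _ _; exact: (dG y Dy).1.
have b2 y : B y -> derivable G y (e2 R).
  by case=> Dy _ _; exact: (dG y Dy).2.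
have b12 y : B y -> derivable ('D_(e1 R) G) y (e2 R).
  by case=> Dy _ _; exact: (d1 y Dy).2.
have b21 y : B y -> derivable ('D_(e2 R) G) y (e1 R).
  by case=> Dy _ _; exact: (d2 y Dy).1.
have [y [_ Y _] E1] := box_mvt (erefl w) b1 b12 (fun t s th sh => dP _ (inball t s th sh)).
have [y' [_ _ Z] E2] := box_mvt (swap h h) b2 b21 (fun t s th sh => dP _ (inball' t s th sh)).
have E : 'D_(e2 R) ('D_(e1 R) G) y = 'D_(e1 R) ('D_(e2 R) G) y'.
  apply: (mulfI (lt0r_neq0 h0)); apply: (mulfI (lt0r_neq0 h0)).
  have sub_swap (a b c d' : R) : a - b - (c - d') = a - c - (b - d') by ring.
  exact: (etrans (esym E1) (etrans (sub_swap _ _ _ _) E2)).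
rewrite E in Y; exact: close_to_common Z Y.
Qed.

Definition axis (e : R * R) := e = e1 R \/ e = e2 R.

Lemma axis_e1 : axis (e1 R). Proof. by left. Qed.
Lemma axis_e2 : axis (e2 R). Proof. by right. Qed.

(** [Ck] records continuity only for the derivatives of top order.  Recording
    it at every order makes each class contain the next, so that closure under
    products and inverses can be proved by induction, and the two axes are
    treated together; for smooth functions both
    notions agree ([smooth_planeP]). *)
Fixpoint Ckc k D G : Prop :=
  (forall x, D x -> {for x, continuous G}) /\
  if k is k'.+1 then
    forall e, axis e -> (forall x, D x -> derivable G x e) /\ Ckc k' D ('D_e G)
  else True.

Lemma Ckc_Ck k D G : Ckc k D G -> Ck k D G.
Proof.
elim: k G => [|k IH] G [cG H]; first exact: cG.
have [d1 H1] := H _ axis_e1; have [d2 H2] := H _ axis_e2.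
split; [|exact: IH H1|exact: IH H2] => x Dx.
by split; [exact: d1|exact: d2].
Qed.

Lemma Ckc_S k D G : Ckc k.+1 D G -> Ckc k D G.
Proof.
elim: k G => [|k IH] G [cG H]; split=> // e he; have [d C] := H e he.
by split; [exact: d|exact: IH C].
Qed.

Lemma smooth_derive D G e : axis e -> smooth_plane D G -> smooth_plane D ('D_e G).
Proof. by case=> -> sG k; have [_ H1 H2] := sG k.+1; [exact: H1|exact: H2]. Qed.

Lemma smooth_planeP D G : smooth_plane D G <-> forall k, Ckc k D G.
Proof.
split; last by move=> H k; exact: Ckc_Ck.
move=> sG k; elim: k G sG => [|k IH] G sG; (split; first exact: (sG 0%N)) => // e he.
split; last exact: IH (smooth_derive he sG).
by case: (sG 1%N) => dG _ _ x /dG[d1 d2]; case: he => ->; [exact: d1|exact: d2].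
Qed.

Lemma derive_ext D f g x v : open D -> D x -> (forall x, D x -> f x = g x) ->
  'D_v f x = 'D_v g x.
Proof.
by move=> oD Dx fg; apply: near_eq_derive; near=> y; apply: fg; near: y; exact: open_nbhs_nbhs.
Unshelve. all: by end_near. Qed.

Lemma Ckc_ext k D f g : open D -> (forall x, D x -> f x = g x) -> Ckc k D f -> Ckc k D g.
Proof.
move=> oD; elim: k f g => [|k IH] f g fg [cf Hf].
all: split=> [x Dx|]; first (rewrite /prop_for /continuous_at -fg //;
  apply: cvg_trans (cf x Dx); apply: near_eq_cvg;
  by apply: filterS (open_nbhs_nbhs (conj oD Dx)) => y Dy; rewrite fg).
- by [].
move=> e he; have [df Cf] := Hf e he; split.
  move=> x Dx; apply: near_eq_derivable (df x Dx).
  by apply: filterS (open_nbhs_nbhs (conj oD Dx)) => y; exact: fg.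
by apply: IH Cf => x Dx; exact: derive_ext oD Dx fg.
Qed.

Lemma Ckc_sub k D D' f : D' `<=` D -> Ckc k D f -> Ckc k D' f.
Proof.
move=> sD; elim: k f => [|k IH] f [cf Hf]; (split; first by move=> x /sD; exact: cf) => //.
move=> e he; have [df Cf] := Hf e he; split; last exact: IH Cf.
by move=> x /sD; exact: df.
Qed.

Lemma Ckc_cst k D (a : R) : Ckc k D (fun=> a).
Proof.
elim: k a => [|k IH] a; (split; first by move=> x _; exact: cvg_cst) => // e he.
split; first by move=> x _; exact: derivable_cst.
by rewrite (_ : 'D_e _ = fun=> 0) //; apply/funext => y; exact: derive_cst.
Qed.

Lemma CkcD k D f g : open D -> Ckc k D f -> Ckc k D g -> Ckc k D (fun x => f x + g x).
Proof.
move=> oD; elim: k f g => [|k IH] f g [cf Hf] [cg Hg];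
  (split; first by move=> x Dx; apply: cvgD; [exact: cf|exact: cg]) => // e he.
have [df Cf] := Hf e he; have [dg Cg] := Hg e he; split.
  by move=> x Dx; exact: derivableD (df x Dx) (dg x Dx).
apply: Ckc_ext (IH _ _ Cf Cg) => // x Dx.
exact: esym (deriveD (df x Dx) (dg x Dx)).
Qed.

Lemma CkcM k D f g : open D -> Ckc k D f -> Ckc k D g -> Ckc k D (fun x => f x * g x).
Proof.
move=> oD; elim: k f g => [|k IH] f g Hf Hg; have [cf Hf1] := Hf; have [cg Hg1] := Hg;
  (split; first by move=> x Dx; apply: cvgM; [exact: cf|exact: cg]) => // e he.
have [df Cf] := Hf1 e he; have [dg Cg] := Hg1 e he; split.
  by move=> x Dx; exact: derivableM (df x Dx) (dg x Dx).
apply: Ckc_ext (CkcD oD (IH _ _ (Ckc_S Hf) Cg) (IH _ _ (Ckc_S Hg) Cf)) => // x Dx.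
exact: esym (deriveM (df x Dx) (dg x Dx)).
Qed.

Lemma CkcV k D f : open D -> (forall x, D x -> f x != 0) -> Ckc k D f ->
  Ckc k D (fun x => (f x)^-1).
Proof.
move=> oD f0; elim: k => [|k IH] Hf; have [cf Hf1] := Hf;
  (split; first by move=> x Dx; apply: cvgV; [exact: f0|exact: cf]) => // e he.
have [df Cf] := Hf1 e he; have CV := IH (Ckc_S Hf); split.
  by move=> x Dx; exact: derivableV (f0 x Dx) (df x Dx).
apply: Ckc_ext (CkcM oD (Ckc_cst _ _ (-1)) (CkcM oD (CkcM oD CV CV) Cf)) => // x Dx.
by rewrite (deriveV (f0 x Dx) (df x Dx)) mulN1r expr2 invfM scaleNr.
Qed.

Lemma is_derive_sqrt_comp G x v : 0 < G x -> derivable G x v ->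
  is_derive x v (fun y => Num.sqrt (G y)) ((2 * Num.sqrt (G x))^-1 * 'D_v G x).
Proof.
move=> G0 dG.
have dl : is_derive (0 : R) (1 : R) (fun h : R => G (h *: v + x)) ('D_v G x).
  by have := @is_derive_line G x v 0; rewrite scale0r add0r; apply.
have ds : is_derive (G ((0 : R) *: v + x)) (1 : R) Num.sqrt (2 * Num.sqrt (G x))^-1.
  by rewrite scale0r add0r; exact: is_derive1_sqrt.
by apply: is_derive_of_line; apply: is_derive1_comp.
Qed.

Lemma Ckc_sqrt k D f : open D -> (forall x, D x -> 0 < f x) -> Ckc k D f ->
  Ckc k D (fun x => Num.sqrt (f x)).
Proof.
move=> oD f0.
have sn0 x : D x -> 2 * Num.sqrt (f x) != 0.
  by move=> Dx; rewrite mulf_neq0 // gt_eqF // sqrtr_gt0 f0.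
elim: k => [|k IH] Hf; have [cf Hf1] := Hf; (split; first
  by move=> x Dx; apply: continuous_comp; [exact: cf|exact: sqrt_continuous]) => // e he.
have [df Cf] := Hf1 e he.
have ds x : D x -> is_derive x e (fun y => Num.sqrt (f y)) ((2 * Num.sqrt (f x))^-1 * 'D_e f x).
  by move=> Dx; apply: is_derive_sqrt_comp; [exact: f0|exact: df].
split; first by move=> x /ds[].
have CV := CkcV oD sn0 (CkcM oD (Ckc_cst _ _ 2) (IH (Ckc_S Hf))).
apply: Ckc_ext (CkcM oD CV Cf) => // x Dx.
by rewrite (derive_val (is_derive := ds _ Dx)).
Qed.

Lemma Ckc_local k D f : (forall x, D x -> exists2 D' : set (R * R), D' x & Ckc k D' f) ->
  Ckc k D f.
Proof.
elim: k f => [|k IH] f H; (split; first by move=> x /H[D' D'x [c _]]; exact: c) => // e he.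
split; first by move=> x /H[D' D'x [_ /(_ e he)[d _]]]; exact: d.
by apply: IH => x /H[D' D'x [_ /(_ e he)[_ C]]]; exists D'.
Qed.

End PlaneCalculus.

(** * Smooth functions near a point of a Riemann surface *)

Section RealGerms.
Context {R : realType} {S : riemann_surface R}.
Implicit Types (c : chart R S) (C : set (chart R S)) (W : set S) (p q : S).
Implicit Types (f g : S -> R).

Lemma cinvK c q : cdom c q -> cinv c (cmap c q) = q.
Proof. by move=> cq; rewrite (cmapK (mem_set cq)). Qed.

Lemma open_chart_image c W : open W -> open (cmap c @` (W `&` cdom c)).
Proof.
move=> oW; rewrite openE => x /= [q [Wq cq] <-{x}].
have cx : (cmap c @` cdom c) (cmap c q) by exists q.
have Wx : nbhs (cmap c q) (cinv c @^-1` W).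
  by apply: (cinv_continuous cx); rewrite cinvK //; exact: open_nbhs_nbhs.
have Ix : nbhs (cmap c q) (cmap c @` cdom c) by apply: open_nbhs_nbhs; split=> //; exact: cimg_open.
apply: filterS2 Wx Ix => y Wy [r cr ry]; exists r => //; split=> //.
by rewrite -(cinvK cr) ry.
Qed.

(** The set C of charts is a parameter because two choices are needed: the
    whole atlas, which is the smoothness of bundles, and a single chart, for
    which smoothness passes to the partial derivatives in that chart. *)
Definition germ C p g : Prop := exists W, [/\ open W, W p &
  forall c, C c -> smooth_plane (cmap c @` (W `&` cdom c)) (g \o cinv c)].

Lemma smooth_fun_germ W p g : open W -> W p -> smooth_fun W g -> germ (@atlas _ S) p g.
Proof. by move=> oW Wp sg; exists W. Qed.

Lemma germ_sub C C' p g : C' `<=` C -> germ C p g -> germ C' p g.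
Proof. by move=> sC [W [oW Wp sW]]; exists W; split=> // c /sC; exact: sW. Qed.

Lemma smooth_shrink c W W' g : W' `<=` W -> smooth_plane (cmap c @` (W `&` cdom c)) (g \o cinv c) ->
  smooth_plane (cmap c @` (W' `&` cdom c)) (g \o cinv c).
Proof.
move=> sW /smooth_planeP sg; apply/smooth_planeP => k; apply: Ckc_sub (sg k).
by move=> x [q [W'q cq] <-]; exists q => //; split=> //; exact: sW.
Qed.

Lemma germ_near C p g : germ C p g -> \forall q \near p, germ C q g.
Proof.
by move=> [W [oW Wp sW]]; apply: (@filterS _ (nbhs p) _ W) (open_nbhs_nbhs (conj oW Wp)) => q Wq;
  exists W.
Qed.

Lemma nbhs_open p (P : set S) : nbhs p P -> exists W, [/\ open W, W p & W `<=` P].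
Proof. by rewrite nbhsE => -[W [oW Wp] WP]; exists W. Qed.

Lemma germ_ext C p f g : (\forall q \near p, f q = g q) -> germ C p f -> germ C p g.
Proof.
move=> /nbhs_open[W' [oW' W'p fg]] [W [oW Wp sW]].
exists (W `&` W'); split; [exact: openI|by []|] => c /sW sc.
have := @smooth_shrink c _ (W `&` W') _ (@subIsetl _ _ _) sc.
move=> /smooth_planeP sf; apply/smooth_planeP => k; apply: Ckc_ext (sf k).
  by apply: open_chart_image; exact: openI.
by move=> x [q [[Wq W'q] cq] <-] /=; rewrite cinvK // fg.
Qed.

Lemma germ_cst C p a : germ C p (fun=> a).
Proof. by exists setT; split; [exact: openT|by []|] => c _; apply/smooth_planeP => k; exact:
  Ckc_cst. Qed.

Lemma germ_lift2 (F : R -> R -> R) C p f g :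
  (forall k (D : set (R * R)) (f g : R * R -> R), open D -> Ckc k D f -> Ckc k D g ->
    Ckc k D (fun x => F (f x) (g x))) ->
  germ C p f -> germ C p g -> germ C p (fun q => F (f q) (g q)).
Proof.
move=> HF [W [oW Wp sW]] [W' [oW' W'p sW']].
exists (W `&` W'); split; [exact: openI|by []|] => c Cc; apply/smooth_planeP => k.
have oD : open (cmap c @` ((W `&` W') `&` cdom c)) by apply: open_chart_image; exact: openI.
have /smooth_planeP h1 := @smooth_shrink c _ (W `&` W') _ (@subIsetl _ _ _) (sW _ Cc).
have /smooth_planeP h2 := @smooth_shrink c _ (W `&` W') _ (@subIsetr _ _ _) (sW' _ Cc).
by have := HF k _ _ _ oD (h1 k) (h2 k).
Qed.

Lemma germD C p f g : germ C p f -> germ C p g -> germ C p (fun q => f q + g q).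
Proof. by apply: germ_lift2 => k D f' g' oD; exact: CkcD. Qed.

Lemma germM C p f g : germ C p f -> germ C p g -> germ C p (fun q => f q * g q).
Proof. by apply: germ_lift2 => k D f' g' oD; exact: CkcM. Qed.

Lemma germN C p f : germ C p f -> germ C p (fun q => - f q).
Proof.
move=> sf; apply: germ_ext (germM (germ_cst C p (-1)) sf).
by near=> q; rewrite mulN1r.
Unshelve. all: by end_near. Qed.

Lemma germB C p f g : germ C p f -> germ C p g -> germ C p (fun q => f q - g q).
Proof. by move=> sf /germN sg; exact: germD. Qed.

Lemma germ_continuous C p f c : C c -> cdom c p -> germ C p f -> {for p, continuous f}.
Proof.
move=> Cc cp [W [oW Wp sW]].
have Wx : (cmap c @` (W `&` cdom c)) (cmap c p) by exists p.
have fc := sW c Cc 0%N _ Wx.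
have {}fc : (f \o cinv c) @ (cmap c p) --> f p.
  by rewrite -[X in _ --> f X](cinvK cp); exact: fc.
have : (f \o cinv c) \o cmap c @ p --> f p by apply: cvg_comp fc; exact: cmap_continuous.
apply: cvg_trans; apply: near_eq_cvg; near=> q; rewrite /= cinvK //.
by near: q; apply: open_nbhs_nbhs; split=> //; exact: cdom_open.
Unshelve. all: by end_near. Qed.

Lemma near_neq0 C p f c : C c -> cdom c p -> germ C p f -> f p != 0 -> \forall q \near p, f q != 0.
Proof.
move=> Cc cp sf f0; have fc := germ_continuous Cc cp sf.
have : nbhs (f p) [set x : R | x != 0].
  apply: open_nbhs_nbhs; split=> //; exact: open_neq.
exact: fc.
Qed.

Lemma germV C p f c : C c -> cdom c p -> germ C p f -> f p != 0 -> germ C p (fun q => (f q)^-1).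
Proof.
move=> Cc cp sf f0; have /nbhs_open[W' [oW' W'p W'0]] := near_neq0 Cc cp sf f0.
case: sf => W [oW Wp sW].
exists (W `&` W'); split; [exact: openI|by []|] => c' Cc'; apply/smooth_planeP => k.
have oD : open (cmap c' @` ((W `&` W') `&` cdom c')) by apply: open_chart_image; exact: openI.
have /smooth_planeP h1 := @smooth_shrink c' _ (W `&` W') _ (@subIsetl _ _ _) (sW _ Cc').
apply: CkcV oD _ (h1 k) => x [q [[Wq W'q] cq] <-] /=.
by rewrite cinvK //; exact: W'0.
Qed.

Lemma germ_sqrt C p f c : C c -> cdom c p -> germ C p f -> 0 < f p ->
  germ C p (fun q => Num.sqrt (f q)).
Proof.
move=> Cc cp sf f0; have fc := germ_continuous Cc cp sf.
have : nbhs (f p) [set x : R | 0 < x].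
  apply: open_nbhs_nbhs; split=> //; exact: open_gt.
move/fc => /nbhs_open[W' [oW' W'p W'0]].
case: sf => W [oW Wp sW].
exists (W `&` W'); split; [exact: openI|by []|] => c' Cc'; apply/smooth_planeP => k.
have oD : open (cmap c' @` ((W `&` W') `&` cdom c')) by apply: open_chart_image; exact: openI.
have /smooth_planeP h1 := @smooth_shrink c' _ (W `&` W') _ (@subIsetl _ _ _) (sW _ Cc').
apply: Ckc_sqrt oD _ (h1 k) => x [q [[Wq W'q] cq] <-] /=.
by rewrite cinvK //; exact: W'0.
Qed.

Lemma germ_local W g : (forall q, W q -> germ (@atlas _ S) q g) -> smooth_fun W g.
Proof.
move=> H c ac; apply/smooth_planeP => k; apply: Ckc_local => _ [q [Wq cq] <-].
have [W' [oW' W'q sW']] := H q Wq.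
exists (cmap c @` (W' `&` cdom c)); first by exists q.
by have /smooth_planeP := sW' c ac; apply.
Qed.

Lemma near_chart c p (P : set S) : cdom c p -> nbhs p P -> nbhs (cmap c p) (cinv c @^-1` P).
Proof.
move=> cp nP; have cx : (cmap c @` cdom c) (cmap c p) by exists p.
by apply: (cinv_continuous cx); rewrite cinvK.
Qed.

Lemma pder_near c e p f g : cdom c p -> (\forall q \near p, f q = g q) ->
  pder c e f p = pder c e g p.
Proof. by move=> cp fg; apply: near_eq_derive; have := near_chart cp fg. Qed.

Lemma germ_derivable c p f : cdom c p -> germ [set c] p f ->
  derivable (f \o cinv c) (cmap c p) (e1 R) /\ derivable (f \o cinv c) (cmap c p) (e2 R).
Proof.
move=> cp [W [oW Wp sW]]; have [d _ _] := sW c erefl 1%N.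
by apply: d; exists p.
Qed.

Lemma germ_derivable_axis c p f e : axis e -> cdom c p -> germ [set c] p f ->
  derivable (f \o cinv c) (cmap c p) e.
Proof. by move=> [->|->] cp sf; have [] := germ_derivable cp sf. Qed.

Lemma germ_pder c p e f : axis e -> cdom c p -> germ [set c] p f -> germ [set c] p (pder c e f).
Proof.
move=> he cp [W [oW Wp sW]]; exists W; split=> // _ ->.
have /smooth_planeP s := smooth_derive he (sW c erefl).
apply/smooth_planeP => k; apply: Ckc_ext (s k); first exact: open_chart_image.
by move=> x [q [Wq cq] <-]; rewrite /pder /= cinvK.
Qed.

Lemma pder_cst c e a p : pder c e (fun=> a) p = 0.
Proof. exact: derive_cst. Qed.

Lemma pderD c e f g p : axis e -> cdom c p -> germ [set c] p f -> germ [set c] p g ->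
  pder c e (fun q => f q + g q) p = pder c e f p + pder c e g p.
Proof.
move=> he cp sf sg; rewrite /pder.
have df := germ_derivable_axis he cp sf; have dg := germ_derivable_axis he cp sg.
exact: (deriveD df dg).
Qed.

Lemma pderM c e f g p : axis e -> cdom c p -> germ [set c] p f -> germ [set c] p g ->
  pder c e (fun q => f q * g q) p = f p * pder c e g p + g p * pder c e f p.
Proof.
move=> he cp sf sg; rewrite /pder.
have df := germ_derivable_axis he cp sf; have dg := germ_derivable_axis he cp sg.
by have := deriveM df dg; rewrite /= cinvK.
Qed.

Lemma pder_comm c p f : cdom c p -> germ [set c] p f ->
  pder c (e1 R) (pder c (e2 R) f) p = pder c (e2 R) (pder c (e1 R) f) p.
Proof.
move=> cp [W [oW Wp sW]].
have oD := @open_chart_image c _ oW.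
have Dp : (cmap c @` (W `&` cdom c)) (cmap c p) by exists p.
have E e e' : pder c e (pder c e' f) p = 'D_e ('D_e' (f \o cinv c)) (cmap c p).
  apply: derive_ext oD Dp _ => x [q [Wq cq] <-].
  by rewrite /pder /= cinvK.
by rewrite !E; apply: schwarz oD (sW c erefl 2%N) Dp.
Qed.

End RealGerms.

Opaque pder.

(** * Complex valued functions and Wirtinger derivatives *)

Section ComplexGerms.
Context {R : realType} {S : riemann_surface R}.
Implicit Types (c : chart R S) (C : set (chart R S)) (W : set S) (p q : S).
Implicit Types (f g : S -> R[i]).

Definition cgerm C p f := germ C p (fun q => complex.Re (f q)) /\ germ C p
  (fun q => complex.Im (f q)).

Lemma cgerm_sub C C' p f : C' `<=` C -> cgerm C p f -> cgerm C' p f.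
Proof. by move=> sC [r i]; split; [exact: germ_sub sC r|exact: germ_sub sC i]. Qed.

Lemma cgerm_near C p f : cgerm C p f -> \forall q \near p, cgerm C q f.
Proof. by move=> [/germ_near r /germ_near i]; apply: filterS2 r i => q ? ?; split. Qed.

Lemma cgerm_ext C p f g : (\forall q \near p, f q = g q) -> cgerm C p f -> cgerm C p g.
Proof.
move=> fg [r i]; split; [apply: germ_ext r|apply: germ_ext i];
by apply: filterS fg => q ->.
Qed.

Lemma cgerm_cst C p a : cgerm C p (fun=> a).
Proof. by split; exact: germ_cst. Qed.

Lemma cgermD C p f g : cgerm C p f -> cgerm C p g -> cgerm C p (fun q => f q + g q).
Proof.
move=> [rf i_f] [rg i_g]; split.
  by apply: germ_ext (germD rf rg); apply: nearW => q; rewrite raddfD.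
by apply: germ_ext (germD i_f i_g); apply: nearW => q; rewrite raddfD.
Qed.

Lemma ReM (a b : R[i]) : complex.Re (a * b) = complex.Re a * complex.Re b - complex.Im a *
  complex.Im b.
Proof. by case: a b => [a1 a2] [b1 b2]. Qed.

Lemma ImM (a b : R[i]) : complex.Im (a * b) = complex.Re a * complex.Im b + complex.Im a *
  complex.Re b.
Proof. by case: a b => [a1 a2] [b1 b2]. Qed.

Lemma cgermM C p f g : cgerm C p f -> cgerm C p g -> cgerm C p (fun q => f q * g q).
Proof.
move=> [rf i_f] [rg i_g]; split.
  by apply: germ_ext (germB (germM rf rg) (germM i_f i_g)); apply: nearW => q; rewrite ReM.
by apply: germ_ext (germD (germM rf i_g) (germM i_f rg)); apply: nearW => q; rewrite ImM.
Qed.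

Lemma cgermN C p f : cgerm C p f -> cgerm C p (fun q => - f q).
Proof.
move=> sf; apply: cgerm_ext (cgermM (cgerm_cst C p (-1)) sf); apply: nearW => q; exact: mulN1r.
Qed.

Lemma cgerm_conj C p f : cgerm C p f -> cgerm C p (fun q => conjc (f q)).
Proof.
move=> [rf i_f]; split; first by apply: germ_ext rf; apply: nearW => q; case: (f q).
by apply: germ_ext (germN i_f); apply: nearW => q; case: (f q).
Qed.

Lemma cgerm_real C p (f : S -> R) : germ C p f -> cgerm C p (fun q => (f q)%:C).
Proof. by move=> sf; split; [exact: sf|exact: germ_cst]. Qed.

Lemma cgerm_sum C p (I : Type) (r : seq I) (P : pred I) (F : I -> S -> R[i]) :
  (forall i, P i -> cgerm C p (F i)) -> cgerm C p (fun q => \sum_(i <- r | P i) F i q).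
Proof.
move=> sF; elim: r => [|i r IH].
  by apply: cgerm_ext (cgerm_cst C p 0); apply: nearW => q; rewrite big_nil.
case: (boolP (P i)) => tangmx.
  by apply: cgerm_ext (cgermD (sF _ tangmx) IH); apply: nearW => q; rewrite big_cons tangmx.
by apply: cgerm_ext IH; apply: nearW => q; rewrite big_cons (negbTE tangmx).
Qed.

Lemma cgerm_prod C p (I : Type) (r : seq I) (P : pred I) (F : I -> S -> R[i]) :
  (forall i, P i -> cgerm C p (F i)) -> cgerm C p (fun q => \prod_(i <- r | P i) F i q).
Proof.
move=> sF; elim: r => [|i r IH].
  by apply: cgerm_ext (cgerm_cst C p 1); apply: nearW => q; rewrite big_nil.
case: (boolP (P i)) => tangmx.
  by apply: cgerm_ext (cgermM (sF _ tangmx) IH); apply: nearW => q; rewrite big_cons tangmx.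
by apply: cgerm_ext IH; apply: nearW => q; rewrite big_cons (negbTE tangmx).
Qed.

Lemma complex_neq0 (z : R[i]) : (z != 0) = (complex.Re z ^+ 2 + complex.Im z ^+ 2 != 0).
Proof.
case: z => a b; rewrite eq_complex /= paddr_eq0 ?sqr_ge0 // !expf_eq0 /=.
by [].
Qed.

Lemma cgerm_near_neq0 C p f c : C c -> cdom c p -> cgerm C p f -> f p != 0 -> \forall q \near p,
  f q != 0.
Proof.
move=> Cc cp [rf i_f]; rewrite complex_neq0 => f0.
have s2 := germD (germM rf rf) (germM i_f i_f).
have := near_neq0 Cc cp s2; rewrite -!expr2 => /(_ f0).
by apply: filterS => q; rewrite -!expr2 -complex_neq0.
Qed.

Lemma cgermV C p f c : C c -> cdom c p -> cgerm C p f -> f p != 0 -> cgerm C p (fun q => (f q)^-1).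
Proof.
move=> Cc cp sf f0; have nf0 := cgerm_near_neq0 Cc cp sf f0.
have [rf i_f] := sf.
have s2 := germV Cc cp (germD (germM rf rf) (germM i_f i_f)).
rewrite -!expr2 -complex_neq0 in s2.
apply: cgerm_ext (cgermM (cgerm_conj sf) (cgerm_real (s2 f0))).
apply: nearW => q; case: (f q) => a b; rewrite /= -!expr2.
apply/eqP; rewrite eq_complex /=; apply/andP; split; apply/eqP; ring.
Qed.

(** This extends to the points of a divisor the identities proved off it. *)
Lemma cgerm_dense C p f c : C c -> cdom c p -> cgerm C p f ->
  (forall W, open W -> W p -> exists2 q, W q & f q = 0) -> f p = 0.
Proof.
move=> Cc cp sf H; apply/eqP/negPn/negP => f0.
have /nbhs_open[W [oW Wp W0]] := cgerm_near_neq0 Cc cp sf f0.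
by have [q /W0 /eqP] := H W oW Wp.
Qed.

Definition cpd c e f p : R[i] :=
  pder c e (fun q => complex.Re (f q)) p +i* pder c e (fun q => complex.Im (f q)) p.

Lemma cpd_near c e p f g : cdom c p -> (\forall q \near p, f q = g q) -> cpd c e f p = cpd c e g p.
Proof.
by move=> cp fg; congr (_ +i* _); apply: pder_near => //; apply: filterS fg => q ->.
Qed.

Lemma cpd_cst c e a p : cpd c e (fun=> a) p = 0.
Proof. by rewrite /cpd !pder_cst. Qed.

Lemma pder_fun c e (f g : S -> R) p : f =1 g -> pder c e f p = pder c e g p.
Proof. by move=> /funext ->. Qed.

Lemma cpdD c e f g p : axis e -> cdom c p -> cgerm [set c] p f -> cgerm [set c] p g ->
  cpd c e (fun q => f q + g q) p = cpd c e f p + cpd c e g p.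
Proof.
move=> he cp [rf i_f] [rg i_g]; congr (_ +i* _).
  by rewrite -(pderD he cp rf rg); apply: pder_fun => q; exact: raddfD.
by rewrite -(pderD he cp i_f i_g); apply: pder_fun => q; exact: raddfD.
Qed.

Lemma pderN c e (f : S -> R) p : axis e -> cdom c p -> germ [set c] p f ->
  pder c e (fun q => - f q) p = - pder c e f p.
Proof.
move=> he cp sf; rewrite -[LHS]addr0 -[X in _ + X](subrr (pder c e f p)) addrA.
rewrite -pderD //; last exact: germN.
rewrite [X in pder _ _ X](_ : _ = fun=> 0) ?pder_cst ?sub0r //.
by apply/funext => q; rewrite addNr.
Qed.

Lemma cpdM c e f g p : axis e -> cdom c p -> cgerm [set c] p f -> cgerm [set c] p g ->
  cpd c e (fun q => f q * g q) p = cpd c e f p * g p + f p * cpd c e g p.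
Proof.
move=> he cp [rf i_f] [rg i_g].
rewrite /cpd.
rewrite [X in X +i* _](_ : _ = pder c e (fun q => complex.Re (f q) * complex.Re (g q) + -
  (complex.Im (f q) * complex.Im (g q))) p); last first.
  by apply: pder_fun => q; exact: ReM.
rewrite [X in _ +i* X](_ : _ = pder c e (fun q => complex.Re (f q) * complex.Im (g q) + complex.Im
  (f q) * complex.Re (g q)) p); last first.
  by apply: pder_fun => q; exact: ImM.
have rr := germM rf rg; have ii := germM i_f i_g; have ri := germM rf i_g; have ir := germM i_f rg.
rewrite (pderD he cp rr (germN ii)) (pderN he cp ii) (pderD he cp ri ir) !pderM //.
case: (f p) (g p) => [a b] [a' b'] /=.
apply/eqP; rewrite eq_complex /=; apply/andP; split; apply/eqP; ring.
Qed.

Lemma cgerm_cpd c p e f : axis e -> cdom c p -> cgerm [set c] p f -> cgerm [set c] p (cpd c e f).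
Proof. by move=> he cp [rf i_f]; split; apply: germ_pder. Qed.

Lemma cpd_comm c p f : cdom c p -> cgerm [set c] p f ->
  cpd c (e1 R) (cpd c (e2 R) f) p = cpd c (e2 R) (cpd c (e1 R) f) p.
Proof. by move=> cp [rf i_f]; exact:
  (f_equal2 (@Complex R) (pder_comm cp rf) (pder_comm cp i_f)). Qed.

Lemma cpd_conj c e f p : axis e -> cdom c p -> cgerm [set c] p f ->
  cpd c e (fun q => conjc (f q)) p = conjc (cpd c e f p).
Proof.
move=> he cp [rf i_f]; rewrite /cpd /=; congr (_ +i* _).
  by apply: pder_fun => q; case: (f q).
by rewrite -(pderN he cp i_f); apply: pder_fun => q; case: (f q).
Qed.

(** The derivative along d/dz for k = -i and along d/dzbar for k = i.  Keeping
    k as a parameter proves the calculus rules for both at once, and complex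
    conjugation exchanges k with its conjugate. *)
Definition wirt c (k : R[i]) f p : R[i] := 2^-1 * (cpd c (e1 R) f p + k * cpd c (e2 R) f p).

Lemma wirt_near c k p f g : cdom c p -> (\forall q \near p, f q = g q) ->
  wirt c k f p = wirt c k g p.
Proof. by move=> cp fg; rewrite /wirt (cpd_near _ cp fg) (cpd_near (e2 R) cp fg). Qed.

Lemma wirt_cst c k a p : wirt c k (fun=> a) p = 0.
Proof. by rewrite /wirt !cpd_cst; ring. Qed.

Lemma wirtD c k f g p : cdom c p -> cgerm [set c] p f -> cgerm [set c] p g ->
  wirt c k (fun q => f q + g q) p = wirt c k f p + wirt c k g p.
Proof.
move=> cp sf sg; rewrite /wirt (cpdD axis_e1 cp sf sg) (cpdD axis_e2 cp sf sg).
by move: (cpd _ _ f p) (cpd _ _ g p) (cpd _ _ f p) (cpd _ _ g p) => *; ring.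
Qed.

Lemma wirtM c k f g p : cdom c p -> cgerm [set c] p f -> cgerm [set c] p g ->
  wirt c k (fun q => f q * g q) p = wirt c k f p * g p + f p * wirt c k g p.
Proof.
by move=> cp sf sg; rewrite /wirt (cpdM axis_e1 cp sf sg) (cpdM axis_e2 cp sf sg); ring.
Qed.

Lemma wirtZ c k a f p : cdom c p -> cgerm [set c] p f ->
  wirt c k (fun q => a * f q) p = a * wirt c k f p.
Proof.
by move=> cp sf; rewrite (wirtM _ cp (cgerm_cst _ _ _) sf) wirt_cst mul0r add0r.
Qed.

Lemma wirt_sum c k p (I : Type) (r : seq I) (F : I -> S -> R[i]) : cdom c p ->
  (forall i, cgerm [set c] p (F i)) ->
  wirt c k (fun q => \sum_(i <- r) F i q) p = \sum_(i <- r) wirt c k (F i) p.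
Proof.
move=> cp sF.
have wirt_ext (f g : S -> R[i]) : f =1 g -> wirt c k f p = wirt c k g p by move=> /funext ->.
elim: r => [|i r IH].
  rewrite [RHS]big_nil -[RHS](wirt_cst c k 0 p).
  by apply: wirt_ext => q; rewrite big_nil.
rewrite [RHS]big_cons -IH -(wirtD _ cp (sF i) (cgerm_sum _ (fun i _ => sF i))).
by apply: wirt_ext => q; rewrite big_cons.
Qed.

Lemma cgerm_wirt c k p f : cdom c p -> cgerm [set c] p f -> cgerm [set c] p (wirt c k f).
Proof.
move=> cp sf; apply: cgermM; first exact: cgerm_cst.
apply: cgermD; first exact: (cgerm_cpd axis_e1 cp sf).
by apply: cgermM; [exact: cgerm_cst|exact: (cgerm_cpd axis_e2 cp sf)].
Qed.

Lemma cpd_wirt c e k p f : axis e -> cdom c p -> cgerm [set c] p f ->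
  cpd c e (wirt c k f) p = 2^-1 * (cpd c e (cpd c (e1 R) f) p + k * cpd c e (cpd c (e2 R) f) p).
Proof.
move=> he cp sf; rewrite /wirt.
have s1 := cgerm_cpd axis_e1 cp sf; have s2 := cgerm_cpd axis_e2 cp sf.
have ks2 := cgermM (cgerm_cst [set c] p k) s2.
rewrite (cpdM he cp (cgerm_cst [set c] p 2^-1) (cgermD s1 ks2)).
by rewrite (cpdD he cp s1 ks2) (cpdM he cp (cgerm_cst [set c] p k) s2) !cpd_cst !mul0r !add0r.
Qed.

Lemma wirtinger_swap (k l A B D : R[i]) :
  2^-1 * (2^-1 * (A + l * B) + k * (2^-1 * (B + l * D))) =
  2^-1 * (2^-1 * (A + k * B) + l * (2^-1 * (B + k * D))).
Proof. by ring. Qed.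

Lemma wirt_comm c k l p f : cdom c p -> cgerm [set c] p f ->
  wirt c k (wirt c l f) p = wirt c l (wirt c k f) p.
Proof.
move=> cp sf; rewrite [LHS]/wirt [RHS]/wirt.
rewrite (cpd_wirt l axis_e1 cp sf) (cpd_wirt k axis_e1 cp sf) (cpd_wirt l axis_e2 cp sf)
  (cpd_wirt k axis_e2 cp sf).
by rewrite (cpd_comm cp sf); exact: wirtinger_swap.
Qed.

Lemma wirt_conj c k f p : cdom c p -> cgerm [set c] p f ->
  wirt c k (fun q => conjc (f q)) p = conjc (wirt c (conjc k) f p).
Proof.
move=> cp sf; rewrite /wirt (cpd_conj axis_e1 cp sf) (cpd_conj axis_e2 cp sf).
by rewrite rmorphM rmorphD rmorphM fmorphV rmorph_nat; congr (_ * (_ + _ * _)); rewrite [RHS]conjcK.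
Qed.

End ComplexGerms.

(** * Smooth families of matrices *)

Section MatrixGerms.
Context {R : realType} {S : riemann_surface R}.
Implicit Types (c : chart R S) (C : set (chart R S)) (W : set S) (p q : S).

Definition mxgerm C p a b (F : S -> 'M[R[i]]_(a, b)) := forall i j, cgerm C p (fun q => F q i j).

Lemma mxgerm_sub C C' p a b (F : S -> 'M[R[i]]_(a, b)) : C' `<=` C -> mxgerm C p F -> mxgerm C' p F.
Proof. by move=> sC sF i j; apply: cgerm_sub sC _. Qed.

Lemma near_forall (I : finType) p (P : I -> S -> Prop) :
  (forall i, \forall q \near p, P i q) -> \forall q \near p, forall i, P i q.
Proof. by move=> H; exact: filter_forall. Qed.

Lemma mxgerm_near C p a b (F : S -> 'M[R[i]]_(a, b)) : mxgerm C p F -> \forall q \near p,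
  mxgerm C q F.
Proof.
move=> sF; do 2! (apply: near_forall => ?); exact: cgerm_near.
Qed.

Lemma mxgerm_ext C p a b (F G : S -> 'M[R[i]]_(a, b)) :
  (\forall q \near p, F q = G q) -> mxgerm C p F -> mxgerm C p G.
Proof. by move=> FG sF i j; apply: cgerm_ext (sF i j); apply: filterS FG => q ->. Qed.

Lemma mxgerm_cst C p a b (A : 'M[R[i]]_(a, b)) : mxgerm C p (fun=> A).
Proof. by move=> i j; exact: cgerm_cst. Qed.

Lemma mxgermD C p a b (F G : S -> 'M[R[i]]_(a, b)) :
  mxgerm C p F -> mxgerm C p G -> mxgerm C p (fun q => F q + G q).
Proof.
by move=> sF sG i j; apply: cgerm_ext (cgermD (sF i j) (sG i j)); apply: nearW => q; rewrite mxE.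
Qed.

Lemma mxgermM C p a b d (F : S -> 'M[R[i]]_(a, b)) (G : S -> 'M[R[i]]_(b, d)) :
  mxgerm C p F -> mxgerm C p G -> mxgerm C p (fun q => F q *m G q).
Proof.
move=> sF sG i j; apply: cgerm_ext
  (cgerm_sum (index_enum _) (fun k (_ : true) => cgermM (sF i k) (sG k j))).
by apply: nearW => q; rewrite mxE.
Qed.

Lemma mxgermZ C p a b (f : S -> R[i]) (F : S -> 'M[R[i]]_(a, b)) :
  cgerm C p f -> mxgerm C p F -> mxgerm C p (fun q => f q *: F q).
Proof.
by move=> sf sF i j; apply: cgerm_ext (cgermM sf (sF i j)); apply: nearW => q; rewrite mxE.
Qed.

Lemma mxgermN C p a b (F : S -> 'M[R[i]]_(a, b)) : mxgerm C p F -> mxgerm C p (fun q => - F q).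
Proof. by move=> sF i j; apply: cgerm_ext (cgermN (sF i j)); apply: nearW => q; rewrite mxE. Qed.

Lemma mxgermB C p a b (F G : S -> 'M[R[i]]_(a, b)) :
  mxgerm C p F -> mxgerm C p G -> mxgerm C p (fun q => F q - G q).
Proof. by move=> sF /mxgermN sG; exact: mxgermD. Qed.

Lemma mxgerm_tr C p a b (F : S -> 'M[R[i]]_(a, b)) : mxgerm C p F -> mxgerm C p (fun q => (F q)^T).
Proof. by move=> sF i j; apply: cgerm_ext (sF j i); apply: nearW => q; rewrite mxE. Qed.

Lemma cgerm_det C p n (F : S -> 'M[R[i]]_n) : mxgerm C p F -> cgerm C p (fun q => \det (F q)).
Proof.
move=> sF; rewrite /determinant; apply: cgerm_sum => s _; apply: cgermM; first exact: cgerm_cst.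
by apply: cgerm_prod => i _; exact: sF.
Qed.

Lemma mxgerm_adj C p n (F : S -> 'M[R[i]]_n) : mxgerm C p F -> mxgerm C p (fun q => \adj (F q)).
Proof.
move=> sF i j; apply: cgerm_ext
  (_ : cgerm C p (fun q => (-1) ^+ (j + i) * \det (row' j (col' i (F q))))).
  by apply: nearW => q; rewrite mxE.
apply: cgermM; first exact: cgerm_cst.
apply: cgerm_det => k l; apply: cgerm_ext (sF (lift j k) (lift i l)).
by apply: nearW => q; rewrite !mxE.
Qed.

Lemma near_unitmx C p c n (F : S -> 'M[R[i]]_n) : C c -> cdom c p -> mxgerm C p F ->
  F p \in unitmx -> \forall q \near p, F q \in unitmx.
Proof.
move=> Cc cp sF; rewrite unitmxE unitfE => d0.
by apply: filterS (cgerm_near_neq0 Cc cp (cgerm_det sF) d0) => q; rewrite unitmxE unitfE.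
Qed.

Lemma mxgerm_inv C p c n (F : S -> 'M[R[i]]_n) : C c -> cdom c p -> mxgerm C p F ->
  F p \in unitmx -> mxgerm C p (fun q => invmx (F q)).
Proof.
move=> Cc cp sF Fu; have Fu' := near_unitmx Cc cp sF Fu.
apply: mxgerm_ext (mxgermZ (cgermV Cc cp (cgerm_det sF) _) (mxgerm_adj sF)); last first.
  by move: Fu; rewrite unitmxE unitfE.
by apply: filterS Fu' => q Fq; rewrite /invmx Fq.
Qed.

Definition dmx c k a b (F : S -> 'M[R[i]]_(a, b)) p : 'M[R[i]]_(a, b) :=
  \matrix_(i, j) wirt c k (fun q => F q i j) p.

Lemma dzE m c (s : S -> 'rV[R[i]]_m) p : dz c s p = dmx c (0 -i* 1) s p.
Proof.
apply/rowP => j; rewrite !mxE /wirt /cpd; congr (_ * (_ + _)).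
rewrite -mulNr; congr (_ * _); apply/eqP; rewrite eq_complex /=.
by rewrite oppr0 !eqxx.
Qed.

Lemma dzbarE m c (s : S -> 'rV[R[i]]_m) p : dzbar c s p = dmx c (0 +i* 1) s p.
Proof. by apply/rowP => j; rewrite !mxE /wirt /cpd; congr (_ * (_ + _)). Qed.

Lemma dmx_near c k p a b (F G : S -> 'M[R[i]]_(a, b)) : cdom c p ->
  (\forall q \near p, F q = G q) -> dmx c k F p = dmx c k G p.
Proof.
by move=> cp FG; apply/matrixP => i j; rewrite !mxE; apply: wirt_near => //; apply: filterS FG =>
  q ->.
Qed.

Lemma dmx_cst c k p a b (A : 'M[R[i]]_(a, b)) : dmx c k (fun=> A) p = 0.
Proof. by apply/matrixP => i j; rewrite !mxE wirt_cst. Qed.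

Lemma wirt_fun c k p (f g : S -> R[i]) : f =1 g -> wirt c k f p = wirt c k g p.
Proof. by move=> /funext ->. Qed.

Lemma dmxD c k p a b (F G : S -> 'M[R[i]]_(a, b)) : cdom c p ->
  mxgerm [set c] p F -> mxgerm [set c] p G ->
  dmx c k (fun q => F q + G q) p = dmx c k F p + dmx c k G p.
Proof.
move=> cp sF sG; apply/matrixP => i j; rewrite !mxE -(wirtD _ cp (sF i j) (sG i j)).
by apply: wirt_fun => q; rewrite mxE.
Qed.

Lemma dmxM c k p a b d (F : S -> 'M[R[i]]_(a, b)) (G : S -> 'M[R[i]]_(b, d)) : cdom c p ->
  mxgerm [set c] p F -> mxgerm [set c] p G ->
  dmx c k (fun q => F q *m G q) p = dmx c k F p *m G p + F p *m dmx c k G p.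
Proof.
move=> cp sF sG; apply/matrixP => i j; rewrite !mxE -big_split /=.
transitivity (wirt c k (fun q => \sum_l F q i l * G q l j) p).
  by apply: wirt_fun => q; rewrite mxE.
rewrite (wirt_sum _ (index_enum _) cp (fun l => cgermM (sF i l) (sG l j))).
by apply: eq_bigr => l _; rewrite !mxE (wirtM _ cp (sF i l) (sG l j)).
Qed.

Lemma dmxMl c k p a b d (A : 'M[R[i]]_(a, b)) (G : S -> 'M[R[i]]_(b, d)) : cdom c p ->
  mxgerm [set c] p G ->
  dmx c k (fun q => A *m G q) p = A *m dmx c k G p.
Proof. by move=> cp sG; rewrite (dmxM _ cp (mxgerm_cst _ _ _) sG) dmx_cst mul0mx add0r. Qed.

Lemma dmxMr c k p a b d (F : S -> 'M[R[i]]_(a, b)) (A : 'M[R[i]]_(b, d)) : cdom c p ->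
  mxgerm [set c] p F ->
  dmx c k (fun q => F q *m A) p = dmx c k F p *m A.
Proof. by move=> cp sF; rewrite (dmxM _ cp sF (mxgerm_cst _ _ _)) dmx_cst mulmx0 addr0. Qed.

Lemma dmxN c k p a b (F : S -> 'M[R[i]]_(a, b)) : cdom c p ->
  mxgerm [set c] p F -> dmx c k (fun q => - F q) p = - dmx c k F p.
Proof.
move=> cp sF; apply: (addrI (dmx c k F p)); rewrite -(dmxD _ cp sF (mxgermN sF)) subrr.
by rewrite -[RHS](dmx_cst c k p 0); apply: dmx_near => //; apply: nearW => q; rewrite subrr.
Qed.

Lemma dmxB c k p a b (F G : S -> 'M[R[i]]_(a, b)) : cdom c p ->
  mxgerm [set c] p F -> mxgerm [set c] p G ->
  dmx c k (fun q => F q - G q) p = dmx c k F p - dmx c k G p.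
Proof. by move=> cp sF sG; rewrite (dmxD _ cp sF (mxgermN sG)) (dmxN _ cp sG). Qed.

Lemma dmx_tr c k p a b (F : S -> 'M[R[i]]_(a, b)) : dmx c k (fun q => (F q)^T) p = (dmx c k F p)^T.
Proof. by apply/matrixP => i j; rewrite !mxE; apply: wirt_fun => q; rewrite mxE. Qed.

Lemma mxgerm_dmx c k p a b (F : S -> 'M[R[i]]_(a, b)) : cdom c p ->
  mxgerm [set c] p F -> mxgerm [set c] p (dmx c k F).
Proof.
move=> cp sF i j; apply: cgerm_ext (cgerm_wirt k cp (sF i j)).
by apply: nearW => q; rewrite mxE.
Qed.

Lemma dmx_comm c k l p a b (F : S -> 'M[R[i]]_(a, b)) : cdom c p -> mxgerm [set c] p F ->
  dmx c k (dmx c l F) p = dmx c l (dmx c k F) p.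
Proof.
move=> cp sF; apply/matrixP => i j; rewrite !mxE.
transitivity (wirt c k (wirt c l (fun q => F q i j)) p).
  by apply: wirt_fun => q; rewrite mxE.
rewrite (wirt_comm k l cp (sF i j)).
by apply: wirt_fun => q; rewrite mxE.
Qed.

Lemma dmx_conj c k p a b (F : S -> 'M[R[i]]_(a, b)) : cdom c p -> mxgerm [set c] p F ->
  dmx c k (fun q => map_mx (@conjc R) (F q)) p = map_mx (@conjc R) (dmx c (conjc k) F p).
Proof.
move=> cp sF; apply/matrixP => i j; rewrite !mxE -(wirt_conj k cp (sF i j)).
by apply: wirt_fun => q; rewrite mxE.
Qed.

Lemma mxgerm_dense C p c a b (F : S -> 'M[R[i]]_(a, b)) : C c -> cdom c p -> mxgerm C p F ->
  (forall W, open W -> W p -> exists2 q, W q & F q = 0) -> F p = 0.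
Proof.
move=> Cc cp sF H; apply/matrixP => i j; rewrite mxE.
apply: cgerm_dense Cc cp (sF i j) _ => W oW /(H W oW)[q Wq Fq].
by exists q => //; rewrite Fq mxE.
Qed.

End MatrixGerms.

(** * Vector spaces spanned by the rows of a matrix *)

Section RowSpaces.
Context {K : fieldType}.

Definition rows_tuple r m (F : 'M[K]_(r, m)) : r.-tuple 'rV[K]_m :=
  map_tuple (fun i => row i F) (ord_tuple r).

Lemma rows_tupleE r m (F : 'M[K]_(r, m)) : rows F = rows_tuple F :> seq _.
Proof. by []. Qed.

Lemma sum_rows r m (F : 'M[K]_(r, m)) (k : 'I_r -> K) :
  \sum_i k i *: (rows_tuple F)`_i = (\row_i k i) *m F.
Proof.
rewrite mulmx_sum_row; apply: eq_bigr => i _; rewrite mxE; congr (_ *: _).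
by rewrite -tnth_nth tnth_map tnth_ord_tuple.
Qed.

Lemma span_rowsP r m (F : 'M[K]_(r, m)) v : (v \in <<rows F>>%VS) = (v <= F)%MS.
Proof.
rewrite rows_tupleE; apply/idP/idP.
  by move/coord_span => ->; rewrite sum_rows submxMl.
move=> /submxP[x ->]; rewrite mulmx_sum_row; apply: memv_suml => i _; apply: memvZ.
by apply: memv_span; apply/mapP; exists i; rewrite // val_ord_tuple mem_enum.
Qed.

Lemma free_rowsP r m (F : 'M[K]_(r, m)) : free (rows F) = row_free F.
Proof.
rewrite rows_tupleE; apply/freeP/idP => [H|Ff k].
  apply: inj_row_free => x; rewrite (_ : x = \row_i x 0 i) -?sum_rows; last by apply/rowP => i;
    rewrite mxE.
  by move=> /H x0; apply/rowP => i; rewrite !mxE x0.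
rewrite sum_rows => k0 i; have /eqP := k0.
by rewrite mulmx_free_eq0 // => /eqP/rowP/(_ i); rewrite !mxE.
Qed.

Lemma basis_rowsP r m (E : {vspace 'rV[K]_m}) (F : 'M[K]_(r, m)) :
  basis_of E (rows F) <-> row_free F /\ forall v, (v \in E) = (v <= F)%MS.
Proof.
rewrite /basis_of free_rowsP; split.
  by move=> /andP[/eqP <- ->]; split=> // v; rewrite span_rowsP.
move=> [-> H]; rewrite andbT; apply/eqP/vspaceP => v; by rewrite span_rowsP H.
Qed.

Definition vmx m (E : {vspace 'rV[K]_m}) : 'M[K]_(\dim E, m) := \matrix_i tnth (vbasis E) i.

Lemma rows_vmx m (E : {vspace 'rV[K]_m}) : rows (vmx E) = vbasis E :> seq _.
Proof.
rewrite rows_tupleE; congr val; apply/eq_from_tnth => i.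
by rewrite tnth_map tnth_ord_tuple rowK.
Qed.

Lemma vmxP m (E : {vspace 'rV[K]_m}) : row_free (vmx E) /\ forall v, (v \in E) = (v <= vmx E)%MS.
Proof. by apply/basis_rowsP; rewrite rows_vmx vbasisP. Qed.

Lemma basis_dim r m (E : {vspace 'rV[K]_m}) (F : 'M[K]_(r, m)) :
  basis_of E (rows F) -> \dim E = r.
Proof. by rewrite rows_tupleE => bF; rewrite -(size_basis bF). Qed.

Lemma eqmx_rV r1 r2 m (F1 : 'M[K]_(r1, m)) (F2 : 'M[K]_(r2, m)) :
  (forall v : 'rV_m, (v <= F1)%MS = (v <= F2)%MS) -> (F1 :=: F2)%MS.
Proof.
move=> H; apply/eqmxP/andP; split; apply/row_subP => i; [rewrite -H|rewrite H]; exact: row_sub.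
Qed.

End RowSpaces.

(** * The inner product and its complexification *)

Section InnerProduct.
Context {K : fieldType}.

Definition Jmx k : 'M[K]_k.+1 := diag_mx (\row_i mink K i).

Lemma ipE k (v w : 'rV[K]_k.+1) : ip v w = (v *m Jmx k *m w^T) 0 0.
Proof.
rewrite mxE; apply: eq_bigr => i _; rewrite /Jmx mul_mx_diag !mxE; congr (_ * _).
by rewrite mulrC.
Qed.

Lemma Jmx_tr k : (Jmx k)^T = Jmx k.
Proof. exact: tr_diag_mx. Qed.

Lemma Jmx_inv k : Jmx k *m Jmx k = 1%:M.
Proof.
rewrite /Jmx mulmx_diag -[RHS]diag_const_mx; congr diag_mx; apply/rowP => i; rewrite !mxE /mink.
by case: ifP => _; rewrite ?mulrNN ?mulr1.
Qed.

Lemma Jmx_unit k : Jmx k \in unitmx.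
Proof. by case: (mulmx1_unit (Jmx_inv k)). Qed.

Lemma ipC k (v w : 'rV[K]_k.+1) : ip v w = ip w v.
Proof. by apply: eq_bigr => i _; rewrite -!mulrA [v 0 i * _]mulrC. Qed.

Lemma ipDl k (u v w : 'rV[K]_k.+1) : ip (u + v) w = ip u w + ip v w.
Proof. by rewrite -big_split; apply: eq_bigr => i _; rewrite !mxE /=; ring. Qed.

Lemma ipDr k (u v w : 'rV[K]_k.+1) : ip w (u + v) = ip w u + ip w v.
Proof. by rewrite ipC ipDl !(ipC w). Qed.

Lemma ipZl k a (v w : 'rV[K]_k.+1) : ip (a *: v) w = a * ip v w.
Proof. by rewrite mulr_sumr; apply: eq_bigr => i _; rewrite !mxE /=; ring. Qed.

Lemma ipZr k a (v w : 'rV[K]_k.+1) : ip v (a *: w) = a * ip v w.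
Proof. by rewrite ipC ipZl ipC. Qed.

Lemma ip0l k (v : 'rV[K]_k.+1) : ip 0 v = 0.
Proof. by rewrite ipE !mul0mx mxE. Qed.

Lemma ipNl k (v w : 'rV[K]_k.+1) : ip (- v) w = - ip v w.
Proof. by rewrite -scaleN1r ipZl mulN1r. Qed.

Lemma ip_mx k a b (A : 'M[K]_(a, k.+1)) (B : 'M[K]_(b, k.+1)) i j :
  (A *m Jmx k *m B^T) i j = ip (row i A) (row j B).
Proof. by rewrite ipE !mxE; apply: eq_bigr => l _; rewrite !mxE; congr (_ * _); apply: eq_bigr =>
  ? _; rewrite !mxE. Qed.

End InnerProduct.
Arguments Jmx : clear implicits.

Section Complexify.
Context {R : realType}.

Definition cmx a b (A : 'M[R]_(a, b)) : 'M[R[i]]_(a, b) := map_mx (real_complex R) A.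
Definition cjmx a b (A : 'M[R[i]]_(a, b)) : 'M[R[i]]_(a, b) := map_mx (@conjc R) A.
Definition remx a b (A : 'M[R[i]]_(a, b)) : 'M[R]_(a, b) := map_mx (@complex.Re R) A.
Definition immx a b (A : 'M[R[i]]_(a, b)) : 'M[R]_(a, b) := map_mx (@complex.Im R) A.

Lemma cmxM a b c (A : 'M[R]_(a, b)) (B : 'M[R]_(b, c)) : cmx (A *m B) = cmx A *m cmx B.
Proof. exact: map_mxM. Qed.

Lemma cjmxM a b c (A : 'M[R[i]]_(a, b)) (B : 'M[R[i]]_(b, c)) : cjmx (A *m B) = cjmx A *m cjmx B.
Proof. exact: map_mxM. Qed.

Lemma cjmxK a b (A : 'M[R[i]]_(a, b)) : cjmx (cjmx A) = A.
Proof. by apply/matrixP => i j; rewrite !mxE conjcK. Qed.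

Lemma cjmx_cmx a b (A : 'M[R]_(a, b)) : cjmx (cmx A) = cmx A.
Proof. by apply/matrixP => i j; rewrite !mxE conjc_real. Qed.

Lemma cmx_tr a b (A : 'M[R]_(a, b)) : (cmx A)^T = cmx A^T.
Proof. by rewrite /cmx map_trmx. Qed.

Lemma cmx_inj a b : injective (@cmx a b).
Proof. by apply: map_mx_inj; exact: fmorph_inj. Qed.

Lemma cmx_eq0 a b (A : 'M[R]_(a, b)) : (cmx A == 0) = (A == 0).
Proof. by rewrite -(inj_eq (@cmx_inj a b)) /cmx map_mx0. Qed.

Lemma cmxJ k : cmx (Jmx R k) = Jmx R[i] k.
Proof.
rewrite /cmx /Jmx map_diag_mx; congr diag_mx; apply/rowP => i; rewrite !mxE /mink.
by case: ifP => _; rewrite ?rmorphN ?rmorph1.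
Qed.

Lemma reim a b (A : 'M[R[i]]_(a, b)) : A = cmx (remx A) + (0 +i* 1) *: cmx (immx A).
Proof.
apply/matrixP => i j; rewrite !mxE; case: (A i j) => x y /=.
by apply/eqP; rewrite eq_complex /= !(mulr0, mul0r, mul1r, subr0, addr0, add0r, oppr0) !eqxx.
Qed.

Lemma cmx_reim_sub r a b (A : 'M[R[i]]_(a, b)) (F : 'M[R]_(r, b)) :
  (A <= cmx F)%MS -> (remx A <= F)%MS /\ (immx A <= F)%MS.
Proof.
move=> /submxP[X ->].
rewrite [X]reim mulmxDl -scalemxAl -!cmxM.
set P := remx X *m F; set Q := immx X *m F.
have -> : remx (cmx P + (0 +i* 1) *: cmx Q) = P.
  by apply/matrixP => i j; rewrite !mxE /= !(mulr0, mul0r, mul1r, subr0, addr0).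
have -> : immx (cmx P + (0 +i* 1) *: cmx Q) = Q.
  by apply/matrixP => i j; rewrite !mxE /= !(mulr0, mul0r, mul1r, subr0, addr0, add0r).
by rewrite !submxMl.
Qed.

Lemma cplxP r m (E : {vspace 'rV[R]_m}) (F : 'M[R]_(r, m)) : basis_of E (rows F) ->
  forall w, (w \in cplx E) = (w <= cmx F)%MS.
Proof.
move=> /basis_rowsP[Ff EF] w; rewrite /cplx.
have [Vf EV] := vmxP E.
have VF : (vmx E :=: F)%MS by apply: eqmx_rV => v; rewrite -EV EF.
rewrite (_ : map cvec (vbasis E) = rows (cmx (vmx E))); last first.
  rewrite -rows_vmx !rows_tupleE /= -map_comp; apply: eq_map => i /=.
  by rewrite /cvec map_row.
by rewrite span_rowsP /cmx ((map_eqmx _ _ _).2 VF).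
Qed.

Lemma conjvP m (E : {vspace 'rV[R[i]]_m}) w : (w \in conjv E) = (cjmx w \in E).
Proof.
rewrite /conjv; have [Vf EV] := vmxP E.
rewrite (_ : map (map_mx (@conjc R)) (vbasis E) = rows (cjmx (vmx E))); last first.
  rewrite -rows_vmx !rows_tupleE /= -map_comp; apply: eq_map => i /=.
  by rewrite /cjmx map_row.
by rewrite span_rowsP EV -[w in LHS]cjmxK /cjmx map_submx.
Qed.

Lemma cvec_cplx m (E : {vspace 'rV[R]_m}) v : (cmx v \in cplx E) = (v \in E).
Proof.
have bE : basis_of E (rows (vmx E)) by rewrite rows_vmx vbasisP.
by rewrite (cplxP bE) (vmxP E).2 /cmx map_submx.
Qed.

Lemma cmx_ip k (v w : 'rV[R]_k.+1) : ip (cmx v) (cmx w) = (ip v w)%:C.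
Proof.
rewrite /ip rmorph_sum; apply: eq_bigr => i _; rewrite !mxE !rmorphM /mink.
by congr (_ * _ * _); case: ifP => _; rewrite ?rmorphN ?rmorph1.
Qed.

Lemma ip_conj k (v w : 'rV[R[i]]_k.+1) : ip (cjmx v) (cjmx w) = conjc (ip v w).
Proof.
rewrite /ip rmorph_sum; apply: eq_bigr => i _; rewrite !mxE !rmorphM /mink.
by congr (_ * _ * _); case: ifP => _; rewrite ?rmorphN ?rmorph1.
Qed.

End Complexify.

(** * Subspaces of signature (3,1) *)

Section Signature31.
Context {R : realType} {n : nat}.
Local Notation N := n.+2.
Local Notation JN := (Jmx R n.+1).
Local Notation JC := (Jmx R[i] n.+1).
Implicit Types (E : {vspace 'rV[R]_n.+2}).

Definition gram r (F : 'M[R]_(r, N)) : 'M[R]_r := F *m JN *m F^T.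

Lemma det_J3 : \det (Jmx R 3) = -1.
Proof.
by rewrite /Jmx det_diag !big_ord_recl big_ord0 !mxE /mink /= !mul1r mulr1.
Qed.

Lemma signature31P E : signature31 E ->
  exists F0 : 'M[R]_(4, N), basis_of E (rows F0) /\ gram F0 = Jmx R 3.
Proof.
move=> [F [bF gF]]; exists F; split=> //; apply/matrixP => i j.
rewrite /gram ip_mx gF !mxE; case: eqP => [->|]; by rewrite ?eqxx ?mulr1n ?mulr0n.
Qed.

Lemma change_basis E r (F F' : 'M[R]_(r, N)) : basis_of E (rows F) -> basis_of E (rows F') ->
  exists2 A : 'M[R]_r, A \in unitmx & F = A *m F'.
Proof.
move=> /basis_rowsP[Ff EF] /basis_rowsP[Ff' EF'].
have /submxP[A FA] : (F <= F')%MS by rewrite -(eqmx_rV (fun v => etrans (esym (EF v)) (EF' v))).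
exists A => //; rewrite -row_free_unit; apply: inj_row_free => x xA.
by apply/eqP; rewrite -(mulmx_free_eq0 _ Ff) FA mulmxA xA mul0mx.
Qed.

Lemma gram_det_lt0 E (F : 'M[R]_(4, N)) : signature31 E -> basis_of E (rows F) -> \det (gram F) < 0.
Proof.
move=> /signature31P[F0 [bF0 gF0]] bF; have [A Au ->] := change_basis bF bF0.
rewrite /gram trmx_mul -!mulmxA [F0 *m _]mulmxA [_ *m (F0^T *m _)]mulmxA -/(gram F0) gF0.
rewrite !det_mulmx det_tr det_J3 mulN1r mulrN oppr_lt0.
by rewrite -expr2 exprn_even_gt0 //= -unitfE -unitmxE.
Qed.

Lemma gram_unit E (F : 'M[R]_(4, N)) : signature31 E -> basis_of E (rows F) -> gram F \in unitmx.
Proof. by move=> sE bF; rewrite unitmxE unitfE lt_eqF // (gram_det_lt0 sE bF). Qed.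

Lemma ip4E (K : fieldType) (x y : 'rV[K]_4) :
  ip x y = x 0 0 * y 0 0 + x 0 1 * y 0 1 + x 0 2%:R * y 0 2%:R - x 0 3%:R * y 0 3%:R.
Proof.
rewrite /ip !big_ord_recl big_ord0 /mink /= !mul1r addr0 !addrA mulNr mul1r mulNr.
by congr (_ * _ + _ * _ + _ * _ - _ * _); congr (_ _ _); apply/val_inj.
Qed.

Lemma row4P (K : fieldType) (x y : 'rV[K]_4) :
  x 0 0 = y 0 0 -> x 0 1 = y 0 1 -> x 0 2%:R = y 0 2%:R -> x 0 3%:R = y 0 3%:R -> x = y.
Proof.
move=> h0 h1 h2 h3; apply/rowP => -[[|[|[|[|//]]]] lt].
- by rewrite (_ : Ordinal lt = 0) //; exact: val_inj.
- by rewrite (_ : Ordinal lt = 1) //; exact: val_inj.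
- by rewrite (_ : Ordinal lt = 2%:R) //; exact: val_inj.
- by rewrite (_ : Ordinal lt = 3%:R) //; exact: val_inj.
Qed.

(** If t and s are the last, negative, coordinates of x and y, then t y - s x
    is null with last coordinate 0, hence vanishes. *)
Lemma null_proportional4 (x y : 'rV[R]_4) : x != 0 -> ip x x = 0 -> ip x y = 0 -> ip y y = 0 ->
  exists a, y = a *: x.
Proof.
rewrite !ip4E => x0 xx xy yy.
set x1 := x 0 0 in xx xy; set x2 := x 0 1 in xx xy; set x3 := x 0 2%:R in xx xy; set t :=
  x 0 3%:R in xx xy.
set y1 := y 0 0 in xy yy; set y2 := y 0 1 in xy yy; set y3 := y 0 2%:R in xy yy; set s :=
  y 0 3%:R in xy yy.
have sq0 (a b c : R) : a ^+ 2 + b ^+ 2 + c ^+ 2 = 0 -> [/\ a = 0, b = 0 & c = 0].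
  move=> H; have Ha := sqr_ge0 a; have Hb := sqr_ge0 b; have Hc := sqr_ge0 c.
  by split; apply/eqP; rewrite -sqrf_eq0; apply/eqP; lra.
have t0 : t != 0.
  apply: contra x0 => /eqP t0; rewrite t0 in xx.
  have [|a b c] := sq0 x1 x2 x3; first by rewrite !expr2; lra.
  by apply/eqP/row4P; rewrite mxE.
have [|e_1 e_2 e_3] := sq0 (t * y1 - s * x1) (t * y2 - s * x2) (t * y3 - s * x3).
  transitivity (t ^+ 2 * (y1 * y1 + y2 * y2 + y3 * y3) + s ^+ 2 * (x1 * x1 + x2 * x2 + x3 * x3)
     - 2 * t * s * (x1 * y1 + x2 * y2 + x3 * y3)); first by ring.
  have -> : y1 * y1 + y2 * y2 + y3 * y3 = s * s by lra.
  have -> : x1 * x1 + x2 * x2 + x3 * x3 = t * t by lra.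
  have -> : x1 * y1 + x2 * y2 + x3 * y3 = t * s by lra.
  by ring.
exists (s / t); apply: row4P; rewrite mxE; apply: (mulfI t0);
rewrite mulrA [t * (s / t)]mulrC divfK //;
  [rewrite -/x1 -/y1|rewrite -/x2 -/y2|rewrite -/x3 -/y3|exact: mulrC]; lra.
Qed.

Lemma ip_frame r (F : 'M[R]_(r, N)) (x y : 'rV[R]_r) :
  ip (x *m F) (y *m F) = (x *m gram F *m y^T) 0 0.
Proof. by rewrite ipE trmx_mul /gram !mulmxA. Qed.

Lemma null_proportional E (v w : 'rV[R]_N) : signature31 E -> v \in E -> w \in E -> v != 0 ->
  ip v v = 0 -> ip v w = 0 -> ip w w = 0 -> exists a, w = a *: v.
Proof.
move=> /signature31P[F [/basis_rowsP[Ff EF] gF]].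
rewrite !EF => /submxP[x ->] /submxP[y ->] x0; rewrite !ip_frame gF -!ipE => xx xy yy.
have [|a ->] := null_proportional4 _ xx xy yy.
  by apply: contra x0 => /eqP ->; rewrite mul0mx.
by exists a; rewrite scalemxAl.
Qed.

(** The orthogonal of the plane in the four-dimensional nondegenerate space has
    dimension 2 and contains the plane. *)
Lemma isotropic_plane_max E (P : 'M[R[i]]_(2, N)) (v : 'rV[R[i]]_N) : signature31 E ->
  row_free P -> (forall i, row i P \in cplx E) -> v \in cplx E ->
  P *m JC *m P^T = 0 -> v *m JC *m P^T = 0 -> (v <= P)%MS.
Proof.
move=> sE Pf PE; have [F [bF gF]] := signature31P sE.
have /submxP[X PX] : (P <= cmx F)%MS by apply/row_subP => i; rewrite -(cplxP bF).
rewrite (cplxP bF) => /submxP[x ->]; rewrite PX.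
have gFc : cmx F *m JC *m (cmx F)^T = Jmx R[i] 3 by rewrite -cmxJ cmx_tr -!cmxM -cmxJ -gF.
have E1 a (Y : 'M[R[i]]_(a, 4)) : Y *m cmx F *m JC *m (X *m cmx F)^T = Y *m (Jmx R[i] 3 *m X^T).
  by rewrite trmx_mul -gFc !mulmxA.
rewrite !E1 => XX xX; apply: submxMr.
have Xr : \rank X = 2%N.
  apply/eqP; rewrite eqn_leq rank_leq_row /=.
  by move/eqP: Pf; rewrite PX => Pf; rewrite -{1}Pf mxrankM_maxl.
have rK : \rank (kermx (Jmx R[i] 3 *m X^T)) = 2%N.
  rewrite mxrank_ker -mxrank_tr trmx_mul trmxK Jmx_tr mxrankMfree ?Xr //.
  rewrite row_free_unit; exact: Jmx_unit.
have XK : (X <= kermx (Jmx R[i] 3 *m X^T))%MS by apply/sub_kermxP.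
have := mxrank_leqif_sup XK; rewrite Xr rK => -[_]; rewrite eqxx => /esym KX.
by apply: submx_trans KX; apply/sub_kermxP.
Qed.

End Signature31.

(** * The second fundamental form of V *)

Section Projection.
Context {R : realType} {S : riemann_surface R} {n : nat}.
Local Notation N := n.+2.
Local Notation JN := (Jmx R n.+1).
Local Notation JC := (Jmx R[i] n.+1).
Implicit Types (V : S -> {vspace 'rV[R]_n.+2}) (c : chart R S) (p q : S).
Implicit Types (C : set (chart R S)).

(** Matrices act on row vectors from the right, so the fibre of V at p is the
    space of vectors fixed by this matrix. *)
Definition tangmx V p : 'M[R[i]]_N := lin1_mx (daddv_pi (cplx (V p)) (Vperp V p)).

Lemma tangE V p v : tang V p v = v *m tangmx V p.
Proof. by rewrite mul_rV_lin1. Qed.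

Lemma perp_frame V p (F : 'M[R]_(4, N)) v : basis_of (V p) (rows F) ->
  (v \in Vperp V p) = (v *m JC *m (cmx F)^T == 0).
Proof.
move=> bF; apply/idP/eqP => [/mem_perp H|H].
  apply/rowP => i; rewrite ip_mx mxE (_ : row 0 v = v); last by apply/rowP => j; rewrite mxE.
  by rewrite ipC; apply: H; rewrite (cplxP bF) row_sub.
apply/mem_perp => w; rewrite (cplxP bF) => /submxP[x ->].
by rewrite ipC ipE trmx_mul mulmxA H mul0mx mxE.
Qed.

(** The orthogonal projection written with the inverse of the Gram matrix of a
    frame; smoothness in the base point is visible from this formula. *)
Definition frame_proj (F : 'M[R]_(4, N)) := JN *m F^T *m invmx (gram F) *m F.

Section AtPoint.
Variables (V : S -> {vspace 'rV[R]_n.+2}) (p : S) (sV : signature31 (V p)).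

Section WithFrame.
Variables (F : 'M[R]_(4, N)) (bF : basis_of (V p) (rows F)).

Let Gu := gram_unit sV bF.

Lemma frame_projF : F *m frame_proj F = F.
Proof. by rewrite /frame_proj !mulmxA -/(gram F) mulmxV // mul1mx. Qed.

Lemma frame_proj_perp : frame_proj F *m JN *m F^T = JN *m F^T.
Proof. by rewrite /frame_proj -!mulmxA [F *m (JN *m _)]mulmxA -/(gram F) mulVmx // mulmx1. Qed.

Lemma V_perp_cap : (cplx (V p) :&: Vperp V p = 0)%VS.
Proof.
apply/eqP; rewrite -subv0; apply/subvP => v /memv_capP[].
rewrite (cplxP bF) => /submxP[x ->]; rewrite (perp_frame _ bF) memv0.
have -> : x *m cmx F *m JC *m (cmx F)^T = x *m cmx (gram F).
  by rewrite /gram cmx_tr -cmxJ !cmxM !mulmxA.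
have cu : cmx (gram F) \in unitmx by rewrite map_unitmx.
rewrite mulmx_free_eq0 ?row_free_unit //.
by move=> /eqP ->; rewrite mul0mx.
Qed.

Lemma tangmx_frame : tangmx V p = cmx (frame_proj F).
Proof.
apply/row_matrixP => i; rewrite !rowE -[in LHS]tangE.
set v := delta_mx 0 i.
have vV : v *m cmx (frame_proj F) \in cplx (V p).
  by rewrite (cplxP bF) /frame_proj cmxM mulmxA submxMl.
have vP : v - v *m cmx (frame_proj F) \in Vperp V p.
  have E : cmx (frame_proj F) *m JC *m (cmx F)^T = JC *m (cmx F)^T.
    by rewrite cmx_tr -cmxJ -!cmxM frame_proj_perp.
  rewrite (perp_frame _ bF) !mulmxBl.
  have -> : v *m cmx (frame_proj F) *m JC *m (cmx F)^T = v *m (JC *m (cmx F)^T).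
    by rewrite -E !mulmxA.
  by rewrite mulmxA subrr.
have e : v = v *m cmx (frame_proj F) + (v - v *m cmx (frame_proj F)) by rewrite addrC subrK.
rewrite {1}e /tang linearD /= (daddv_pi_id V_perp_cap vV).
have := daddv_pi_add V_perp_cap (subvP (addvSr (cplx (V p)) (Vperp V p)) _ vP).
rewrite [X in _ + X]daddv_pi_id ?(capvC (Vperp V p)) ?V_perp_cap //.
by move=> /(canRL (addrK _)); rewrite subrr => ->; rewrite addr0.
Qed.

End WithFrame.

Lemma frame_ex : exists F : 'M[R]_(4, N), basis_of (V p) (rows F).
Proof. by have [F [bF _]] := signature31P sV; exists F. Qed.

Lemma tangmx_proj : tangmx V p *m tangmx V p = tangmx V p.
Proof.
have [F bF] := frame_ex; rewrite (tangmx_frame bF) -cmxM; congr cmx.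
by rewrite [X in X *m _]/frame_proj -[LHS]mulmxA (frame_projF bF).
Qed.

Lemma tangmx_real : cjmx (tangmx V p) = tangmx V p.
Proof. by have [F bF] := frame_ex; rewrite (tangmx_frame bF) cjmx_cmx. Qed.

Lemma tangmx_sym : tangmx V p *m JC = JC *m (tangmx V p)^T.
Proof.
have [F bF] := frame_ex; rewrite (tangmx_frame bF) cmx_tr -cmxJ -!cmxM; congr cmx.
rewrite /frame_proj !trmx_mul trmxK !Jmx_tr trmx_inv (_ : (gram F)^T = gram F) ?mulmxA //.
by rewrite /gram !trmx_mul trmxK Jmx_tr mulmxA.
Qed.

Lemma memV v : (v \in cplx (V p)) = (v *m tangmx V p == v).
Proof.
have [F bF] := frame_ex; rewrite (tangmx_frame bF) (cplxP bF); apply/idP/eqP.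
  by move=> /submxP[x ->]; rewrite -mulmxA -cmxM (frame_projF bF).
by move=> <-; rewrite /frame_proj cmxM mulmxA submxMl.
Qed.

Lemma memVperp v : (v \in Vperp V p) = (v *m tangmx V p == 0).
Proof.
have [F bF] := frame_ex; rewrite (tangmx_frame bF) (perp_frame _ bF).
apply/eqP/eqP => [H|H].
  by rewrite /frame_proj !cmxM !mulmxA cmxJ -cmx_tr H !mul0mx.
have : v *m cmx (frame_proj F *m JN *m F^T) = 0 by rewrite -mulmxA cmxM mulmxA H mul0mx.
by rewrite (frame_proj_perp bF) cmxM cmxJ cmx_tr mulmxA.
Qed.

Lemma nrmlE v : nrml V p v = v *m (1%:M - tangmx V p).
Proof.
have [F bF] := frame_ex.
rewrite mulmxBr mulmx1 -tangE; apply/eqP; rewrite eq_sym subr_eq eq_sym addrC; apply/eqP.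
apply: daddv_pi_add; first exact: (V_perp_cap bF).
rewrite -[v](subrK (v *m tangmx V p)) addrC; apply: memv_add.
  by rewrite memV -mulmxA tangmx_proj.
by rewrite memVperp mulmxBl -mulmxA tangmx_proj subrr.
Qed.

Lemma perp_nondeg v : v \in Vperp V p -> (forall w, w \in Vperp V p -> ip v w = 0) -> v = 0.
Proof.
rewrite memVperp => /eqP vP H.
have : v *m JC = 0.
  apply/rowP => j; rewrite [RHS]mxE.
  pose w := delta_mx 0 j *m (1%:M - tangmx V p) : 'rV[R[i]]_N.
  have wP : w \in Vperp V p by rewrite memVperp -mulmxA mulmxBl mul1mx tangmx_proj subrr mulmx0.
  have := H w wP; rewrite ipE trmx_mul linearB /= trmx1 !mulmxA mulmxBr mulmx1.
  rewrite -[_ *m JC *m (tangmx V p)^T]mulmxA -tangmx_sym mulmxA vP mul0mx subr0.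
  by rewrite trmx_delta -colE mxE.
move=> /(congr1 (mulmx^~ JC)); by rewrite -mulmxA Jmx_inv mulmx1 mul0mx.
Qed.

End AtPoint.

Section Bundle.
Variables (V : S -> {vspace 'rV[R]_n.+2}) (V31 : bundle31 V).
Let sV p : signature31 (V p) := V31.2 p.

Lemma mxgerm_frame r (O : set S) (F : S -> 'M[R]_(r, N)) p : open O -> O p -> rsmooth O F ->
  mxgerm (@atlas _ S) p (fun q => cmx (F q)).
Proof.
move=> oO Op sF i j; apply: cgerm_ext (cgerm_real (smooth_fun_germ oO Op (sF i j))).
by apply: nearW => q; rewrite mxE.
Qed.

Lemma mxgerm_csmooth r m (O : set S) (F : S -> 'M[R[i]]_(r, m)) p : open O -> O p -> csmooth O F ->
  mxgerm (@atlas _ S) p F.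
Proof.
by move=> oO Op sF i j; have [s1 s2] := sF i j; split; exact: smooth_fun_germ oO Op _.
Qed.

Lemma near_open (O : set S) p : open O -> O p -> \forall q \near p, O q.
Proof. by move=> oO Op; exact: open_nbhs_nbhs. Qed.

Lemma atlas_coverE p : exists c, atlas c /\ cdom c p.
Proof. by have [c ac cp] := @atlas_cover _ S p; exists c. Qed.

Lemma mxgerm_tangmx p : mxgerm (@atlas _ S) p (tangmx V).
Proof.
have [W [F [oO Op sF bF]]] := V31.1 p.
have [c [ac cp]] := atlas_coverE p.
have sFc := mxgerm_frame oO Op sF.
have smG : mxgerm (@atlas _ S) p (fun q => cmx (gram (F q))).
  apply: mxgerm_ext (mxgermM (mxgermM sFc (mxgerm_cst _ _ JC)) (mxgerm_tr sFc)).
  by apply: nearW => q; rewrite /gram cmxM cmxM cmxJ cmx_tr.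
have Gu : cmx (gram (F p)) \in unitmx by rewrite map_unitmx (gram_unit (sV p) (bF p Op)).
apply: mxgerm_ext (mxgermM (mxgermM (mxgermM (mxgerm_cst _ _ JC) (mxgerm_tr sFc))
  (mxgerm_inv ac cp smG Gu)) sFc).
apply: filterS (near_open oO Op) => q Oq.
rewrite (tangmx_frame (sV q) (bF q Oq)) /frame_proj (cmxM _ (F q)) (cmxM _ (invmx _)).
by rewrite (cmxM JN) cmxJ cmx_tr; congr (_ *m _ *m _); rewrite /cmx map_invmx.
Qed.

(** The second fundamental form of V.  The derivative of the projection P
    exchanges V and its orthogonal; the factor 1 - 2P, equal to -1 on V and to 1
    on the orthogonal, corrects its sign (see [cN_E]). *)
Definition Nmx c k p : 'M[R[i]]_N := dmx c k (tangmx V) p *m (1%:M - tangmx V p - tangmx V p).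

Section Chart.
Variables (c : chart R S) (ac : atlas c).

Lemma mxgerm_tangmx1 p : mxgerm [set c] p (tangmx V).
Proof. by apply: mxgerm_sub (mxgerm_tangmx p) => _ ->. Qed.

Lemma near_dom p : cdom c p -> \forall q \near p, cdom c q.
Proof. by move=> cp; apply: near_open cp; exact: cdom_open. Qed.

Lemma mxgerm_Nmx k p : cdom c p -> mxgerm [set c] p (Nmx c k).
Proof.
move=> cp; have sP := mxgerm_tangmx1 p.
exact: mxgermM (mxgerm_dmx k cp sP) (mxgermB (mxgermB (mxgerm_cst _ _ _) sP) sP).
Qed.

Section Pointwise.
Variables (p : S) (cp : cdom c p).
Let P := tangmx V p.
Let A k := dmx c k (tangmx V) p.

Lemma dtangmx_proj k : A k *m P + P *m A k = A k.
Proof.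
rewrite /A -(dmxM k cp (mxgerm_tangmx1 p) (mxgerm_tangmx1 p)); apply: dmx_near => //.
by apply: nearW => q; exact: tangmx_proj (sV q).
Qed.

Lemma dtangmx_sym k : A k *m JC = JC *m (A k)^T.
Proof.
rewrite /A -(dmxMr k _ cp (mxgerm_tangmx1 p)) -dmx_tr
  -(dmxMl k _ cp (mxgerm_tr (mxgerm_tangmx1 p))).
by apply: dmx_near => //; apply: nearW => q; exact: tangmx_sym (sV q).
Qed.

Lemma dtangmx_conj k : cjmx (A k) = A (conjc k).
Proof.
have := dmx_conj (conjc k) cp (mxgerm_tangmx1 p); rewrite conjcK /cjmx /A => <-.
by apply: dmx_near => //; apply: nearW => q; exact: tangmx_real (sV q).
Qed.

Let T := 1%:M - P - P.
Let PP : P *m P = P := tangmx_proj (sV p).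

Lemma PT : P *m T = - P.
Proof. by rewrite /T !mulmxBr mulmx1 PP subrr sub0r. Qed.

Lemma TP : T *m P = - P.
Proof. by rewrite /T !mulmxBl mul1mx PP subrr sub0r. Qed.

Lemma TT : T *m T = 1%:M.
Proof. by rewrite {2}/T !mulmxBr mulmx1 TP opprK /T addrAC subrK subrK. Qed.

Lemma AT k : A k *m T = - (T *m A k).
Proof.
have := dtangmx_proj k; rewrite /T; move: (A k) (P) => X Y XY.
apply/eqP; rewrite -subr_eq0 opprK !mulmxBr !mulmxBl mulmx1 mul1mx.
by apply/eqP; rewrite -{1 4}XY; apply/matrixP => i j; rewrite !mxE; ring.
Qed.

Lemma NmxE k : Nmx c k p = A k *m T. Proof. by []. Qed.

Lemma PNmx k : P *m Nmx c k p = Nmx c k p *m (1%:M - P).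
Proof.
rewrite NmxE (mulmxBr (A k *m T)) mulmx1 -[A k *m T *m P]mulmxA TP mulmxN opprK mulmxA.
have -> : P *m A k = A k - A k *m P by apply/eqP; rewrite eq_sym subr_eq addrC dtangmx_proj.
by rewrite mulmxBl -[A k *m P *m T]mulmxA PT mulmxN opprK.
Qed.

Lemma Nmx_skew k : Nmx c k p *m JC = - (JC *m (Nmx c k p)^T).
Proof.
have TJ : T *m JC = JC *m T^T.
  by rewrite /T !mulmxBl !linearB /= trmx1 ?mulmxBr mul1mx mulmx1 (tangmx_sym (sV p)).
rewrite NmxE trmx_mul mulmxA -TJ -[T *m JC *m _]mulmxA -dtangmx_sym mulmxA AT mulNmx.
by [].
Qed.

Lemma Nmx_conj k : cjmx (Nmx c k p) = Nmx c (conjc k) p.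
Proof.
rewrite NmxE cjmxM dtangmx_conj NmxE; congr (_ *m _); rewrite /T /cjmx !map_mxB map_mx1.
by rewrite -/(cjmx P) (tangmx_real (sV p)).
Qed.

Lemma Nmx_comp k l : Nmx c k p *m Nmx c l p = - (A k *m A l).
Proof.
rewrite !NmxE -mulmxA [T *m (A l *m T)]mulmxA.
have -> : T *m A l = - (A l *m T) by rewrite AT opprK.
by rewrite mulNmx -mulmxA TT mulmx1 mulmxN.
Qed.

Lemma dNmx k l : dmx c l (Nmx c k) p = dmx c l (dmx c k (tangmx V)) p *m T - A k *m A l - A k *m A
  l.
Proof.
have sP := mxgerm_tangmx1 p; have s1 := mxgermB (mxgerm_cst [set c] p 1%:M) sP.
rewrite [LHS](dmxM l cp (mxgerm_dmx k cp sP) (mxgermB s1 sP)).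
rewrite (dmxB l cp s1 sP) (dmxB l cp (mxgerm_cst _ _ _) sP) dmx_cst sub0r
  (mulmxBr (dmx c k (tangmx V) p)) mulmxN.
by rewrite addrA.
Qed.

(** Differentiating N produces the second derivatives of the projection, which
    cancel by symmetry, and terms quadratic in its first derivatives, which are
    products of the two values of N. *)
Lemma codazzi k l : dmx c k (Nmx c l) p - dmx c l (Nmx c k) p =
  (Nmx c l p *m Nmx c k p - Nmx c k p *m Nmx c l p) *+ 2.
Proof.
rewrite !dNmx !Nmx_comp (dmx_comm k l cp (mxgerm_tangmx1 p)) -!/(A _).
by apply/matrixP => i j; rewrite !mxE; ring.
Qed.

Section Operators.
Variables (k : R[i]) (d : (S -> 'rV[R[i]]_N) -> S -> 'rV[R[i]]_N).
Hypothesis dE : forall s q, d s q = dmx c k s q.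

Lemma d_tang s : mxgerm [set c] p s ->
  d (fun q => tang V q (s q)) p = dmx c k s p *m P + s p *m A k.
Proof.
move=> ss; rewrite dE -(dmxM k cp ss (mxgerm_tangmx1 p)); apply: dmx_near => //.
by apply: nearW => q; rewrite tangE.
Qed.

Lemma d_nrml s : mxgerm [set c] p s ->
  d (fun q => nrml V q (s q)) p = dmx c k s p *m (1%:M - P) - s p *m A k.
Proof.
move=> ss; have sP := mxgerm_tangmx1 p; rewrite dE.
have -> : dmx c k (fun q => nrml V q (s q)) p = dmx c k (fun q => s q *m (1%:M - tangmx V q)) p.
  by apply: dmx_near => //; apply: nearW => q; rewrite (nrmlE (sV q)).
rewrite (dmxM k cp ss (mxgermB (mxgerm_cst _ _ _) sP)) (dmxB k cp (mxgerm_cst _ _ _) sP) dmx_cst.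
by rewrite sub0r mulmxN.
Qed.

Lemma cN_E s : mxgerm [set c] p s -> cN V d s p = s p *m Nmx c k p.
Proof.
move=> ss; rewrite /cN (nrmlE (sV p)) tangE (d_tang ss) (d_nrml ss).
have e1 : P *m (1%:M - P) = 0 by rewrite mulmxBr mulmx1 PP subrr.
have e2 : (1%:M - P) *m P = 0 by rewrite mulmxBl mul1mx PP subrr.
rewrite mulmxDl mulmxBl -[_ *m P *m (1%:M - P)]mulmxA e1 mulmx0 add0r.
rewrite -[_ *m (1%:M - P) *m P]mulmxA e2 mulmx0 sub0r NmxE mulmxA /T.
by rewrite [RHS]mulmxBr.
Qed.

Lemma cD_cN s : mxgerm [set c] p s -> cD V d s p + cN V d s p = dmx c k s p.
Proof.
move=> ss; rewrite /cD /cN (d_tang ss) (d_nrml ss) 2!(nrmlE (sV p)) 2!tangE.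
move: (dmx c k s p) (s p *m A k) => X Y.
have mk (w : 'rV[R[i]]_N) : w *m P + w *m (1%:M - P) = w.
  by rewrite -mulmxDr addrC subrK mulmx1.
set a := X *m P + Y; set b := _ - Y.
by rewrite addrACA mk [b *m _ + _]addrC mk /a /b addrACA mk subrr addr0.
Qed.

Lemma cD_E s : mxgerm [set c] p s -> cD V d s p = dmx c k s p - s p *m Nmx c k p.
Proof. by move=> ss; rewrite -(cN_E ss) -(cD_cN ss) addrK. Qed.

Lemma Nend_E v : Nend V d p v = v *m Nmx c k p.
Proof. by rewrite /Nend cN_E //; exact: mxgerm_cst. Qed.

Lemma cDend_E (Ad : S -> 'rV[R[i]]_N -> 'rV[R[i]]_N) (B : S -> 'M[R[i]]_N) v :
  mxgerm [set c] p B -> (\forall q \near p, forall w, Ad q w = w *m B q) ->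
  cDend V d Ad p v = v *m (dmx c k B p - B p *m Nmx c k p + Nmx c k p *m B p).
Proof.
move=> sB AdB; have sAd : \forall q \near p, v *m B q = Ad q v.
  by apply: filterS AdB => q ->.
have sv : mxgerm [set c] p (fun q => Ad q v) by apply:
  mxgerm_ext sAd (mxgermM (mxgerm_cst _ _ _) sB).
have Adp w : Ad p w = w *m B p by have := nbhs_singleton AdB; apply.
rewrite /cDend (cD_E sv) (cD_E (mxgerm_cst _ _ v)) dmx_cst sub0r !Adp.
rewrite -(dmx_near k cp sAd) (dmxMl k v cp sB) mulNmx opprK !mulmxDr mulmxN !mulmxA.
by [].
Qed.

End Operators.

End Pointwise.

Local Notation kz := (0 -i* 1 : R[i]).
Local Notation kb := (0 +i* 1 : R[i]).

Lemma dz_dmx (s : S -> 'rV[R[i]]_N) q : dz c s q = dmx c kz s q.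
Proof. exact: dzE. Qed.

Lemma dzbar_dmx (s : S -> 'rV[R[i]]_N) q : dzbar c s q = dmx c kb s q.
Proof. exact: dzbarE. Qed.

(** Harmonicity makes the derivative of N_z along d/dzbar opposite to that of
    N_zbar along d/dz, while [codazzi] gives their difference, so both are known.
    The result is the equation D_zbar N_z = 0. *)
Lemma harmonic_holomorphic p : cdom c p -> harmonic_bundle [set: S] V ->
  dmx c kb (Nmx c kz) p = Nmx c kz p *m Nmx c kb p - Nmx c kb p *m Nmx c kz p.
Proof.
move=> cp Vh.
have H (v : 'rV[R[i]]_N) : v *m (dmx c kz (Nmx c kb) p + dmx c kb (Nmx c kz) p) = 0.
  have := Vh c p ac I cp v; rewrite /tension /extD /star1 /Nform /=.
  have sNz := mxgerm_Nmx kz cp; have sNb := mxgerm_Nmx kb cp.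
  have s1 := mxgermZ (cgerm_cst [set c] p kb) sNz.
  have s2 := mxgermN (mxgermZ (cgerm_cst [set c] p kb) sNb).
  rewrite (cDend_E cp dz_dmx v s2); last first.
    apply: filterS (near_dom cp) => q cq w.
    by rewrite (Nend_E cq dzbar_dmx) mulmxN scalemxAr.
  rewrite (cDend_E cp dzbar_dmx v s1); last first.
    apply: filterS (near_dom cp) => q cq w.
    by rewrite (Nend_E cq dz_dmx) scalemxAr.
  have -> : dmx c kz (fun q => - (kb *: Nmx c kb q)) p = - (kb *: dmx c kz (Nmx c kb) p).
    rewrite (dmxN _ cp (mxgermZ (cgerm_cst [set c] p kb) sNb)).
    by congr (- _); apply/matrixP => i j; rewrite !mxE -(wirtZ _ _ cp (sNb i j)); apply:
      wirt_fun => q; rewrite mxE.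
  have -> : dmx c kb (fun q => kb *: Nmx c kz q) p = kb *: dmx c kb (Nmx c kz) p.
    by apply/matrixP => i j; rewrite !mxE -(wirtZ _ _ cp (sNz i j)); apply: wirt_fun => q;
      rewrite mxE.
  rewrite -mulmxBr => /eqP; rewrite scaler_eq0 => /orP[|].
    by rewrite eq_complex /= eqxx /= oppr_eq0 pnatr_eq0.
  set X := (X in v *m X == 0).
  have -> : X = - (kb *: (dmx c kz (Nmx c kb) p + dmx c kb (Nmx c kz) p)).
    rewrite /X -!scalemxAl -!scalemxAr !mulNmx !mulmxN -!scalemxAl -!scalemxAr.
    move: (_ *m _) (_ *m _) (dmx _ _ _ _) (dmx _ _ _ _) => A1 A2 A3 A4.
    by apply/matrixP => i j; rewrite !mxE; ring.
  rewrite mulmxN oppr_eq0 -scalemxAr scaler_eq0 => /orP[|/eqP //].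
  by rewrite eq_complex /= oner_eq0 andbF.
have H0 : dmx c kz (Nmx c kb) p + dmx c kb (Nmx c kz) p = 0.
  by apply/row_matrixP => i; rewrite rowE H linear0.
have := codazzi cp kz kb.
move/eqP: H0; rewrite addr_eq0 => /eqP ->; rewrite -opprD -mulr2n -mulNrn.
move=> /eqP; rewrite -subr_eq0 -mulrnBl -scaler_nat scaler_eq0 pnatr_eq0 /= subr_eq0 => /eqP.
by move/(canRL opprK) => ->; rewrite opprB.
Qed.

End Chart.
End Bundle.
End Projection.

(** * The kernel of N and the orthogonal of U *)

Section Envelopes.
Context {R : realType} {S : riemann_surface R} {n : nat}.
Local Notation N := n.+2.
Local Notation JC := (Jmx R[i] n.+1).
Local Notation kz := (0 -i* 1 : R[i]).
Local Notation kb := (0 +i* 1 : R[i]).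
Implicit Types (c : chart R S) (p q : S) (W O : set S).

Lemma csmooth_local r m W (F : S -> 'M[R[i]]_(r, m)) :
  (forall q, W q -> mxgerm (@atlas _ S) q F) -> csmooth W F.
Proof. by move=> H i j; split; apply: germ_local => q /H/(_ i j)[]. Qed.

Lemma rsmooth_local r m W (F : S -> 'M[R]_(r, m)) :
  (forall q, W q -> mxgerm (@atlas _ S) q (fun q => cmx (F q))) -> rsmooth W F.
Proof.
move=> H i j; apply: germ_local => q /H/(_ i j)[sr _].
by apply: germ_ext sr; apply: nearW => q'; rewrite mxE.
Qed.

Lemma row_free_near p a b (M : S -> 'M[R]_(a, b)) c : cdom c p ->
  mxgerm [set c] p (fun q => cmx (M q)) ->
  row_free (M p) -> \forall q \near p, row_free (M q).
Proof.
move=> cp sM /row_freeP[B MB].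
have sMB := mxgermM sM (mxgerm_cst [set c] p (cmx B)).
have MBp : cmx (M p) *m cmx B \in unitmx by rewrite -cmxM MB map_unitmx unitmx1.
apply: filterS (near_unitmx (C := [set c]) erefl cp sMB MBp) => q Mq.
apply: inj_row_free => x xM.
have : x *m (M q *m B) = 0 by rewrite mulmxA xM mul0mx.
move: Mq; rewrite -cmxM map_unitmx => Mq /(congr1 (mulmx^~ (invmx (M q *m B)))).
by rewrite mulmxK // mul0mx.
Qed.

Lemma not_isolated p W : nbhs p W -> exists2 q, W q & q <> p.
Proof.
move=> /nbhs_open[W' [oW' W'p W'W]].
have [c [ac cp]] := atlas_coverE p.
have oI := @open_chart_image _ _ c _ oW'.
have Ip : (cmap c @` (W' `&` cdom c)) (cmap c p) by exists p.
have [e e0 eI] := open_ballP oI Ip.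
have [q [W'q cq] qE] : (cmap c @` (W' `&` cdom c)) ((cmap c p).1 + e / 2, (cmap c p).2).
  apply: eI; apply/ball_planeP => /=; rewrite subrr normr0 e0; split=> //.
  rewrite opprD addrA subrr sub0r normrN ger0_norm ?divr_ge0 ?ltW //.
  by rewrite ltr_pdivrMr // ltr_pMr // ltrDl.
exists q; first exact: W'W.
move=> qp; move: qE; rewrite qp => /(congr1 fst) /= /eqP.
rewrite -subr_eq0 opprD addrA subrr sub0r oppr_eq0 mulf_eq0 invr_eq0.
by rewrite (gt_eqF e0) (gt_eqF (ltr0Sn _ _)).
Qed.

(** A Riemann surface has no isolated point, so a set without limit points has
    dense complement. *)
Lemma off_divisor_dense (Delta : set S) p W : limit_point Delta = set0 -> nbhs p W ->
  exists2 q, W q & ~ Delta q.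
Proof.
move=> D0 nW; apply: contrapT => H.
have WD q : W q -> Delta q by move=> Wq; apply: contrapT => nD; apply: H; exists q.
have : limit_point Delta p.
  move=> W' nW'; have [q [Wq W'q] qp] := not_isolated (filterI nW nW').
  by exists q; split=> //; [apply/eqP|exact: WD].
by rewrite D0.
Qed.

Section Bundle.
Variables (V : S -> {vspace 'rV[R]_n.+2}) (V31 : bundle31 V).
Let sV p : signature31 (V p) := V31.2 p.

Lemma ip_skew c k p : cdom c p -> atlas c -> forall x y : 'rV[R[i]]_N,
  ip (x *m Nmx V c k p) y = - ip x (y *m Nmx V c k p).
Proof.
move=> cp ac x y; rewrite !ipE -[x *m _ *m JC]mulmxA (Nmx_skew V31 ac cp) mulmxN mulNmx [LHS]mxE.
by rewrite (trmx_mul y) !mulmxA.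
Qed.

Lemma ip_deriv c k p (s t : S -> 'rV[R[i]]_N) : cdom c p ->
  mxgerm [set c] p s -> mxgerm [set c] p t -> (\forall q \near p, ip (s q) (t q) = 0) ->
  ip (dmx c k s p) (t p) + ip (s p) (dmx c k t p) = 0.
Proof.
move=> cp ss st H.
have ssJ := mxgermM ss (mxgerm_cst [set c] p JC); have stT := mxgerm_tr st.
have : dmx c k (fun q => s q *m JC *m (t q)^T) p = 0.
  rewrite -(dmx_cst c k p (0 : 'M[R[i]]_1)); apply: dmx_near => //.
  by apply: filterS H => q; rewrite ipE => H; apply/rowP => i; rewrite ord1 H mxE.
rewrite (dmxM k cp ssJ stT) (dmxMr k _ cp ss) dmx_tr => /rowP/(_ 0).
by rewrite mxE -!ipE [RHS]mxE.
Qed.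

(** For s = s P the derivative is s' P + s P', so that s P' is the component of
    s' normal to V. *)
Lemma Nmx_section c k p (s : S -> 'rV[R[i]]_N) : atlas c -> cdom c p -> mxgerm [set c] p s ->
  (\forall q \near p, s q \in cplx (V q)) ->
  s p *m Nmx V c k p = dmx c k s p *m (1%:M - tangmx V p).
Proof.
move=> ac cp ss sin.
have sP : mxgerm [set c] p (tangmx V) := mxgerm_tangmx1 V31 ac p.
have E : dmx c k s p = dmx c k s p *m tangmx V p + s p *m dmx c k (tangmx V) p.
  rewrite -(dmxM k cp ss sP); apply: dmx_near => //.
  by apply: filterS sin => q; rewrite (memV (sV q)) => /eqP.
have sA : s p *m dmx c k (tangmx V) p = dmx c k s p *m (1%:M - tangmx V p).
  by apply/eqP; rewrite mulmxBr mulmx1 eq_sym subr_eq addrC -E.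
have PP := tangmx_proj (sV p).
rewrite /Nmx mulmxA sA -mulmxA; congr (_ *m _).
rewrite mulmxBl mul1mx [X in _ - X]mulmxBr [X in _ - (X - _)]mulmxBr mulmx1 PP subrr sub0r.
by rewrite opprK subrK.
Qed.

Lemma deriv_in_V c k p (s : S -> 'rV[R[i]]_N) : atlas c -> cdom c p -> mxgerm [set c] p s ->
  (\forall q \near p, s q \in cplx (V q)) ->
  (dmx c k s p \in cplx (V p)) = (s p *m Nmx V c k p == 0).
Proof.
move=> ac cp ss sin; rewrite (memV (sV p)) (Nmx_section k ac cp ss sin).
by rewrite mulmxBr mulmx1 subr_eq0 eq_sym.
Qed.

Lemma Nmx_perp c k p x : atlas c -> cdom c p -> x \in cplx (V p) -> x *m Nmx V c k p \in Vperp V p.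
Proof.
move=> ac cp; rewrite (memV (sV p)) (memVperp (sV p)) => /eqP xP.
rewrite -{1}xP -[x *m tangmx V p *m _]mulmxA (PNmx V31 ac cp) mulmxA -mulmxA mulmxBl mul1mx
  (tangmx_proj (sV p)).
by rewrite subrr mulmx0.
Qed.

Variables (r : nat) (U : S -> {vspace 'rV[R[i]]_n.+2}) (hU : is_bundle_U V U r).

Definition orthU p (x : 'rV[R[i]]_N) := forall u, u \in U p -> ip x u = 0.

(** Off the divisor U is the image under N_z of the orthogonal of V.  Since N_z
    is skew, a vector x of V is orthogonal to this image iff N_z x is orthogonal
    to the orthogonal of V, where it lies and where the product is nondegenerate. *)
Lemma ker_NmxP : exists2 Delta : set S, limit_point Delta = set0 &
  forall c p x, atlas c -> cdom c p -> ~ Delta p -> x \in cplx (V p) ->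
   (x *m Nmx V c kz p = 0 <-> orthU p x).
Proof.
case: hU => _ _ _ _ [Delta D0 HD]; exists Delta => // c p x ac cp nD xV.
have NE v : Nend V (dz c) p v = v *m Nmx V c kz p.
  by apply: (Nend_E V31 ac cp); exact: dz_dmx.
split.
  move=> x0 u; rewrite (HD c p ac cp nD u) => -[v vP ->]; rewrite NE.
  by apply: oppr_inj; rewrite -(ip_skew _ cp ac) x0 oppr0 ipE !mul0mx mxE.
move=> xU; apply: (perp_nondeg (sV p)); first exact: Nmx_perp.
move=> w wP; rewrite (ip_skew _ cp ac) xU ?oppr0 //.
by rewrite (HD c p ac cp nD); exists w; rewrite ?NE.
Qed.

(** True off the divisor by [ker_NmxP], hence everywhere by density. *)
Lemma orthU_Nmx c p (x : S -> 'rV[R[i]]_N) : atlas c -> cdom c p -> mxgerm [set c] p x ->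
  (\forall q \near p, x q \in cplx (V q) /\ orthU q (x q)) -> x p *m Nmx V c kz p = 0.
Proof.
move=> ac cp sx H; have [Delta D0 HD] := ker_NmxP.
have sxN : mxgerm [set c] p (fun q => x q *m Nmx V c kz q) := mxgermM sx (mxgerm_Nmx V31 ac kz cp).
apply: (mxgerm_dense (C := [set c]) (c := c) _ cp sxN) => // W oW Wp.
have [q [Wq [[xV xU] cq]] nD] := off_divisor_dense D0 (filterI (open_nbhs_nbhs (conj oW Wp))
  (filterI H (near_dom cp))).
by exists q => //; apply/(HD c q (x q) ac cq nD xV).
Qed.

Lemma U_frame p : exists Fu : S -> 'M[R[i]]_(r, N), mxgerm (@atlas _ S) p Fu /\
  exists W, [/\ open W, W p, csmooth W Fu & frame W Fu U].
Proof.
case: hU => /(_ p) [W [Fu [oW Wp sF bF]]] _ _ _ _; exists Fu; split; last by exists W.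
exact: mxgerm_csmooth oW Wp sF.
Qed.

(** The products of x with a frame of U vanish off the divisor, hence
    everywhere. *)
Lemma Nmx_orthU c p (x : S -> 'rV[R[i]]_N) : atlas c -> cdom c p -> mxgerm [set c] p x ->
  (\forall q \near p, x q \in cplx (V q) /\ x q *m Nmx V c kz q = 0) -> orthU p (x p).
Proof.
move=> ac cp sx H; have [Delta D0 HD] := ker_NmxP.
have [Fu [sFu [W0 [oW0 W0p _ bFu]]]] := U_frame p.
have sF1 : mxgerm [set c] p Fu by apply: mxgerm_sub sFu => _ ->.
have E : x p *m JC *m (Fu p)^T = 0.
  have sE := mxgermM (mxgermM sx (mxgerm_cst [set c] p JC)) (mxgerm_tr sF1).
  apply: (mxgerm_dense (C := [set c]) (c := c) _ cp sE) => // W oW Wp.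
  have [q [[Wq W0q] [[xV xN] cq]] nD] := off_divisor_dense D0
    (filterI (filterI (open_nbhs_nbhs (conj oW Wp)) (open_nbhs_nbhs (conj oW0 W0p)))
    (filterI H (near_dom cp))).
  have xU := (HD c q (x q) ac cq nD xV).1 xN.
  exists q => //; apply/rowP => i; rewrite ip_mx mxE (_ : row 0 (x q) = x q); last first.
    by apply/rowP => j; rewrite mxE.
  by apply: xU; rewrite ((basis_rowsP _ _).1 (bFu q W0q)).2 row_sub.
move=> u; rewrite ((basis_rowsP _ _).1 (bFu p W0p)).2 => /submxP[y ->].
by rewrite ipE trmx_mul mulmxA E mul0mx mxE.
Qed.

End Bundle.
End Envelopes.

(** * Linear independence of two, three or four vectors *)

Section Free.
Context {K : fieldType} {m : nat}.
Implicit Types (a b d e : 'rV[K]_m).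

Lemma free2P a b : free [:: a; b] <-> (forall x y, x *: a + y *: b = 0 -> x = 0 /\ y = 0).
Proof.
split=> [/(@freeP _ _ _ (in_tuple [:: a; b])) H x y E|H].
  have := H (fun i : 'I_2 => [tuple x; y]`_i).
  rewrite !big_ord_recl big_ord0 /= addr0 => /(_ E) Z.
  by split; [exact: (Z 0)|exact: (Z 1)].
apply/(@freeP _ _ _ (in_tuple [:: a; b])) => k.
rewrite !big_ord_recl big_ord0 /= addr0 => /H[k0 k1] i.
case: i => -[|[|//]] lt; [rewrite -[RHS]k0|rewrite -[RHS]k1]; congr k; exact: val_inj.
Qed.

Lemma free3P a b d : free [:: a; b; d] <->
  (forall x y z, x *: a + y *: b + z *: d = 0 -> [/\ x = 0, y = 0 & z = 0]).
Proof.
split=> [/(@freeP _ _ _ (in_tuple [:: a; b; d])) H x y z E|H].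
  have := H (fun i : 'I_3 => [tuple x; y; z]`_i).
  rewrite !big_ord_recl big_ord0 /= addr0 addrA => /(_ E) Z.
  by split; [exact: (Z 0)|exact: (Z 1)|exact: (Z 2%:R)].
apply/(@freeP _ _ _ (in_tuple [:: a; b; d])) => k.
rewrite !big_ord_recl big_ord0 /= addr0 addrA => /H[k0 k1 k2] i.
case: i => -[|[|[|//]]] lt; [rewrite -[RHS]k0|rewrite -[RHS]k1|rewrite -[RHS]k2]; congr k; exact:
  val_inj.
Qed.

Definition mx3 a b d : 'M[K]_(3, m) :=
  \matrix_(i, j) (if i == 0 then a 0 j else if i == 1 then b 0 j else d 0 j).

Lemma rows3 a b d : rows (mx3 a b d) = [:: a; b; d].
Proof.
rewrite rows_tupleE /= !enum_ordSl enum_ord0 /=.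
by congr [:: _; _; _]; apply/rowP => j; rewrite !mxE.
Qed.

Lemma free4 a b d e :
  (forall x y z w, x *: a + y *: b + z *: d + w *: e = 0 -> [/\ x = 0, y = 0, z = 0 & w = 0]) ->
  free [:: a; b; d; e].
Proof.
move=> H; apply/(@freeP _ _ _ (in_tuple [:: a; b; d; e])) => k.
rewrite !big_ord_recl big_ord0 /= addr0 !addrA => /H[k0 k1 k2 k3] i.
case: i => -[|[|[|[|//]]]] lt;
  [rewrite -[RHS]k0|rewrite -[RHS]k1|rewrite -[RHS]k2|rewrite -[RHS]k3];
congr k; exact: val_inj.
Qed.

Lemma span2P a b v : v \in <<[:: a; b]>>%VS -> exists x y, v = x *: a + y *: b.
Proof.
rewrite -[_ :: _]/(in_tuple [:: a; b] : seq _) => /coord_span ->.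
by rewrite !big_ord_recl big_ord0 /= addr0; do 2 eexists.
Qed.

End Free.

(** * Null sections of V orthogonal to U *)

Section Enveloping.
Context {R : realType} {S : riemann_surface R} {n : nat}.
Local Notation N := n.+2.
Local Notation JC := (Jmx R[i] n.+1).
Local Notation kz := (0 -i* 1 : R[i]).
Local Notation kb := (0 +i* 1 : R[i]).
Implicit Types (c : chart R S) (p q : S) (W O : set S).
Variables (V : S -> {vspace 'rV[R]_n.+2}) (V31 : bundle31 V).
Variables (Vh : harmonic_bundle [set: S] V).
Variables (r : nat) (U : S -> {vspace 'rV[R[i]]_n.+2}) (hU : is_bundle_U V U r).
Let sV p : signature31 (V p) := V31.2 p.

(** What a section of a real null line of V must satisfy for the line to
    envelop V.  The vector u outside the line completes it to an isotropic
    plane, the largest possible isotropic space in V. *)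
Definition env_at (s : S -> 'rV[R[i]]_N) q := 
  [/\ cjmx (s q) = s q, s q \in cplx (V q), ip (s q) (s q) = 0, orthU U q (s q)
    & exists2 u, u \in U q & s q != 0 /\ forall a, u <> a *: s q].

Lemma conj_kz : conjc kz = kb. Proof. by rewrite /= opprK. Qed.
Lemma conj_kb : conjc kb = kz. Proof. by []. Qed.

Lemma U_sub p u : u \in U p -> u \in cplx (V p).
Proof. by case: hU => _ /(_ p) /subvP H _ _ _; exact: H. Qed.

Lemma U_iso p u w : u \in U p -> w \in U p -> ip u w = 0.
Proof. by case: hU => _ _ _ /(_ p) H _; exact: H. Qed.

(** The plane of s and u is isotropic, hence its own orthogonal in V. *)
Lemma iso_plane p (s u x : 'rV[R[i]]_N) : s \in cplx (V p) -> u \in cplx (V p) ->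
  x \in cplx (V p) ->
  s != 0 -> (forall a, u <> a *: s) -> ip s s = 0 -> ip s u = 0 -> ip u u = 0 ->
  ip x s = 0 -> ip x u = 0 -> exists a b, x = a *: s + b *: u.
Proof.
move=> sV' uV xV s0 us ss su uu xs xu.
pose P := \matrix_(i < 2) (if i == 0 then s else u).
have r0 : row 0 P = s by rewrite rowK.
have r1 : row 1 P = u by rewrite rowK.
have mulP (y : 'rV_2) : y *m P = y 0 0 *: s + y 0 1 *: u.
  rewrite mulmx_sum_row !big_ord_recl big_ord0 addr0 r0.
  by rewrite (_ : lift ord0 ord0 = 1) ?r1 //; exact: val_inj.
have I2 (i : 'I_2) : i = 0 \/ i = 1.
  by case: i => -[|[|//]] lt; [left|right]; exact: val_inj.
have Pf : row_free P.
  apply: inj_row_free => y; rewrite mulP => E.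
  have y1 : y 0 1 = 0.
    apply: contrapT => /eqP y1; apply: (us (- (y 0 1)^-1 * y 0 0)).
    apply: (scalerI y1); rewrite scalerA mulrA mulrN divff // mulN1r scaleNr.
    by apply/eqP; rewrite -addr_eq0 addrC E.
  move: E; rewrite y1 scale0r addr0 => /eqP; rewrite scaler_eq0 (negbTE s0) orbF => /eqP y0.
  by apply/rowP => i; rewrite mxE; case: (I2 i) => ->.
have /submxP[y xy] : (x <= P)%MS.
  apply: (isotropic_plane_max (sV p)) Pf _ xV _ _.
  - by move=> i; case: (I2 i) => ->; rewrite ?r0 ?r1.
  - apply/matrixP => i j; rewrite ip_mx mxE.
    by case: (I2 i) (I2 j) => -> [->|->]; rewrite ?r0 ?r1 // ipC.
  - apply/rowP => j; rewrite ip_mx mxE (_ : row 0 x = x); last by apply/rowP => k; rewrite mxE.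
    by case: (I2 j) => ->; rewrite ?r0 ?r1.
by exists (y 0 0), (y 0 1); rewrite xy mulP.
Qed.

Section AtPoint.
Variables (c : chart R S) (ac : atlas c).

Definition enveloping p s := [/\ cdom c p, mxgerm [set c] p s & \forall q \near p, env_at s q].

Lemma enveloping_near p s : enveloping p s -> \forall q \near p, enveloping q s.
Proof.
move=> [cp ss es].
apply: filterS3 (near_dom cp) (mxgerm_near ss) (_ : \forall q \near p, \forall q' \near q,
  env_at s q').
  by move=> q ? ? ?; split.
exact: nbhs_interior.
Qed.

Section FirstOrder.
Variables (p : S) (s : S -> 'rV[R[i]]_N) (es : enveloping p s).
Let cp : cdom c p. Proof. by case: es. Qed.
Let ss : mxgerm [set c] p s. Proof. by case: es. Qed.
Let ep : env_at s p. Proof. by case: es => _ _ /nbhs_singleton. Qed.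
Let nV : \forall q \near p, s q \in cplx (V q).
Proof. by case: es => _ _; apply: filterS => q []. Qed.
Let s0 : s p != 0. Proof. by case: ep => _ _ _ _ [u _ []]. Qed.

Lemma env_conj k : cjmx (dmx c k s p) = dmx c (conjc k) s p.
Proof.
have := dmx_conj (conjc k) cp ss; rewrite conjcK /cjmx => <-; apply: dmx_near => //.
by case: es => _ _; apply: filterS => q [].
Qed.

Lemma env_N : s p *m Nmx V c kz p = 0.
Proof.
apply: (orthU_Nmx V31 hU ac cp ss); case: es => _ _; apply: filterS => q [_ ? _ ? _]; by split.
Qed.

Lemma env_Nb : s p *m Nmx V c kb p = 0.
Proof.
have [sr _ _ _ _] := ep.
have := congr1 (@cjmx R _ _) env_N; rewrite cjmxM (Nmx_conj V31 ac cp) sr conj_kz => ->.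
by rewrite /cjmx map_mx0.
Qed.

Lemma env_zV : dmx c kz s p \in cplx (V p).
Proof. by rewrite (deriv_in_V V31 kz ac cp ss nV) env_N. Qed.

Lemma env_bV : dmx c kb s p \in cplx (V p).
Proof. by rewrite (deriv_in_V V31 kb ac cp ss nV) env_Nb. Qed.

Lemma env_ds k : ip (dmx c k s p) (s p) = 0.
Proof.
have : ip (dmx c k s p) (s p) + ip (s p) (dmx c k s p) = 0.
  by apply: ip_deriv => //; case: es => _ _; apply: filterS => q [].
rewrite [X in _ + X]ipC -mulr2n => /eqP; rewrite -mulr_natl mulf_eq0.
by rewrite pnatr_eq0 => /eqP.
Qed.

(** For a section t of U, differentiating (s, t) = 0 leaves (s, t_zbar).  By
    holomorphy D_zbar t lies in U, so that only (s, N_zbar t) = - (N_zbar s, t)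
    remains, and N_zbar s is the conjugate of N_z s = 0. *)
Lemma env_bU : orthU U p (dmx c kb s p).
Proof.
have [Fu [sFu [W [oW Wp csF bFu]]]] := U_frame hU p.
have bFup := (basis_rowsP _ _).1 (bFu p Wp).
move=> u; rewrite bFup.2 => /submxP[y ->].
pose t q := y *m Fu q.
have tU q : W q -> t q \in U q.
  by move=> Wq; rewrite ((basis_rowsP _ _).1 (bFu q Wq)).2 submxMl.
have st : mxgerm [set c] p t.
  by apply: mxgermM; [exact: mxgerm_cst|apply: mxgerm_sub sFu => _ ->].
have st1 : csmooth W t.
  apply: csmooth_local => q Wq; apply: mxgermM; first exact: mxgerm_cst.
  exact: mxgerm_csmooth oW Wq csF.
have : ip (dmx c kb s p) (t p) + ip (s p) (dmx c kb t p) = 0.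
  apply: ip_deriv => //; case: es => _ _ es'.
  by apply: filterS2 es' (near_open oW Wp) => q [_ _ _ sU _] Wq; apply: sU; exact: tU.
have tD : dmx c kb t p = cD V (dzbar c) t p + t p *m Nmx V c kb p.
  by rewrite (cD_E V31 ac cp (@dzbar_dmx _ _ _ c) st) subrK.
have [_ _ _ sU _] := ep.
rewrite tD ipDr sU ?add0r; last first.
  by case: hU => _ _ hol _ _; apply: (hol W t c p).
have -> : ip (s p) (t p *m Nmx V c kb p) = 0.
  by apply: oppr_inj; rewrite -(ip_skew V31 kb cp ac) env_Nb ip0l oppr0.
by rewrite addr0.
Qed.

Lemma env_b_plane : exists u a b, [/\ u \in U p, ip u (s p) = 0 & dmx c kb s p = a *: s p + b *: u].
Proof.
have [_ sVp sn sU [u uU [_ us]]] := ep.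
have [a [b E]] := iso_plane sVp (U_sub uU) env_bV s0 us sn (sU u uU) (U_iso uU uU) (env_ds kb)
  (env_bU uU).
by exists u, a, b; split=> //; rewrite ipC sU.
Qed.

Lemma env_b_null : ip (dmx c kb s p) (dmx c kb s p) = 0.
Proof.
have [u [a [b [uU us E]]]] := env_b_plane.
by rewrite {1}E ipDl !ipZl [ip u _]ipC (env_bU uU) [ip (s p) _]ipC env_ds !mulr0 addr0.
Qed.

End FirstOrder.

Lemma env_b_section p s : enveloping p s ->
  [/\ mxgerm [set c] p (dmx c kb s) & \forall q \near p, dmx c kb s q \in cplx (V q) /\ orthU U q
    (dmx c kb s q)].
Proof.
move=> es; have [cp ss _] := es; split; first exact: mxgerm_dmx.
apply: filterS (enveloping_near es) => q eq; split; [exact: env_bV|exact: env_bU].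
Qed.

Section SecondOrder.
Variables (p : S) (s : S -> 'rV[R[i]]_N) (es : enveloping p s).
Let cp : cdom c p. Proof. by case: es. Qed.
Let ss : mxgerm [set c] p s. Proof. by case: es. Qed.
Let ep : env_at s p. Proof. by case: es => _ _ /nbhs_singleton. Qed.
Let s0 : s p != 0. Proof. by case: ep => _ _ _ _ [u _ []]. Qed.
Local Notation sz := (dmx c kz s p).
Local Notation sb := (dmx c kb s p).
Local Notation szb := (dmx c kz (dmx c kb s) p).

Lemma env_bN : sb *m Nmx V c kz p = 0.
Proof.
have [sm sn] := env_b_section es.
exact: (orthU_Nmx V31 hU ac cp sm sn).
Qed.

Lemma env_zNb : sz *m Nmx V c kb p = 0.
Proof.
have := congr1 (@cjmx R _ _) env_bN; rewrite cjmxM (Nmx_conj V31 ac cp) (env_conj es) conj_kz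
  conj_kb => ->.
by rewrite /cjmx map_mx0.
Qed.

(** The section s_zbar of V is killed by N_z, as it is orthogonal to U. *)
Lemma env_zbV : szb \in cplx (V p).
Proof.
have [sm sn] := env_b_section es.
rewrite (deriv_in_V V31 kz ac cp sm) ?env_bN //.
by apply: filterS sn => q [].
Qed.

Lemma env_zb_s : ip szb (s p) = - ip sb sz.
Proof.
have [sm sn] := env_b_section es.
apply/eqP; rewrite -addr_eq0; apply/eqP; apply: ip_deriv => //.
by apply: filterS (enveloping_near es) => q eq; exact: env_ds.
Qed.

Hypothesis imm : free [:: s p; sz; sb].

(** Were (s_z, s_zbar) zero, s and s_zbar would span an isotropic plane
    orthogonal to s_z, hence containing it. *)
Lemma env_metric : ip sz sb != 0.
Proof.
apply/negP => /eqP z0.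
have [_ sVp sn _ _] := ep.
have sb_s a : sb <> a *: s p.
  move=> E; have /free3P/(_ (- a) 0 1) := imm.
  rewrite scale0r addr0 scale1r E scaleNr addNr => /(_ erefl)[_ _ /eqP].
  by rewrite oner_eq0.
have [a [b E]] := iso_plane sVp (env_bV es) (env_zV es) s0 sb_s sn
  (etrans (ipC _ _) (env_ds es kb)) (env_b_null es) (env_ds es kz) z0.
have /free3P/(_ (- a) 1 (- b)) := imm.
rewrite scale1r E !scaleNr addrA addNr add0r subrr => /(_ erefl)[_ /eqP].
by rewrite oner_eq0.
Qed.

Lemma env_zb_s_neq0 : ip szb (s p) != 0.
Proof. by rewrite env_zb_s oppr_eq0 ipC env_metric. Qed.

Lemma env_gauss_free : free [:: s p; sz; sb; szb].
Proof.
apply: free4 => x y z w E.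
have w0 : w = 0.
  have [_ _ sn _ _] := ep.
  have : ip (x *: s p + y *: sz + z *: sb + w *: szb) (s p) = 0 by rewrite E ip0l.
  rewrite ipDl ipDl ipDl 4!ipZl sn (env_ds es kz) (env_ds es kb) !mulr0 !add0r => /eqP.
  by rewrite mulf_eq0 (negbTE env_zb_s_neq0) orbF => /eqP.
move: E; rewrite w0 scale0r addr0 => E.
by have /free3P/(_ x y z E)[] := imm.
Qed.

Lemma env_gauss : <<[:: s p; sz; sb; szb]>>%VS = cplx (V p).
Proof.
have [_ sVp _ _ _] := ep.
have [F bF] := frame_ex (sV p).
apply/eqP; rewrite eqEdim; apply/andP; split.
  apply/span_subvP => v; rewrite !inE => /or4P[] /eqP -> //.
  - exact: env_zV.
  - exact: env_bV.
  - exact: env_zbV.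
have := env_gauss_free; rewrite /free => /eqP ->.
have bFc : basis_of (cplx (V p)) (rows (cmx F)).
  apply/basis_rowsP; split; last exact: cplxP.
  by rewrite /cmx row_free_map; case/basis_rowsP: bF.
by rewrite (basis_dim bFc).
Qed.

Lemma env_z_null : ip sz sz = 0.
Proof.
by rewrite -conj_kb -(env_conj es) ip_conj (env_b_null es) conjc0.
Qed.

Lemma env_kappa : nrml V p (dmx c kz (dmx c kz s) p) = sz *m Nmx V c kz p.
Proof.
rewrite (nrmlE (sV p)) -(Nmx_section V31 kz ac cp (mxgerm_dmx kz cp ss)) //.
by apply: filterS (enveloping_near es) => q eq; exact: env_zV.
Qed.

End SecondOrder.

(** Differentiate kappa = N_z s_z: by [harmonic_holomorphic] the derivative of
    N_z is a commutator, one term of which cancels the difference between D and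
    d, while the other vanishes because N_zbar kills s_z. *)
Lemma env_Dkappa p s : enveloping p s ->
  cD V (dzbar c) (fun q => nrml V q (dmx c kz (dmx c kz s) q)) p =
  dmx c kz (dmx c kb s) p *m Nmx V c kz p.
Proof.
move=> es; have [cp ss _] := es.
have sz_s := mxgerm_dmx kz cp ss; have sN := mxgerm_Nmx V31 ac kz cp.
have E : \forall q \near p, dmx c kz s q *m Nmx V c kz q = nrml V q (dmx c kz (dmx c kz s) q).
  by apply: filterS (enveloping_near es) => q eq; rewrite (env_kappa eq).
rewrite (cD_E V31 ac cp (@dzbar_dmx _ _ _ c) (mxgerm_ext E (mxgermM sz_s sN))).
rewrite -(dmx_near kb cp E) (dmxM kb cp sz_s sN) (harmonic_holomorphic V31 ac cp Vh) (env_kappa es).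
rewrite mulmxBr [X in _ + (_ - X)]mulmxA (env_zNb es) mul0mx subr0.
by rewrite [X in _ + X - _]mulmxA addrK (dmx_comm kb kz cp ss).
Qed.

End AtPoint.
End Enveloping.

(** * The immersed locus of a line bundle *)

Section Immersion.
Context {R : realType} {S : riemann_surface R}.
Implicit Types (c : chart R S) (p q : S) (O : set S).

Lemma derive_coord (e x : R * R) :
  'D_e (fun y : R * R => y.1) x = e.1 /\ 'D_e (fun y : R * R => y.2) x = e.2.
Proof.
split; apply/lim_near_cst => //=; near=> h; rewrite addrK scalerA mulVf ?scale1r //;
near: h; exact: nbhs_dnbhs_neq.
Unshelve. all: by end_near. Qed.

Definition xcoord c q : R := (cmap c q).1.
Definition ycoord c q : R := (cmap c q).2.

Lemma germ_coord c c' q : atlas c -> atlas c' -> cdom c q -> cdom c' q ->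
  germ [set c] q (xcoord c') /\ germ [set c] q (ycoord c').
Proof.
move=> ac ac' cq c'q; have [h1 h2 _] := atlas_holomorphic ac ac'.
by split; (exists (cdom c'); split; [exact: cdom_open|by []|move=> _ ->; rewrite setIC]).
Qed.

Lemma pder_own c q : cdom c q ->
  [/\ pder c (e1 R) (xcoord c) q = 1, pder c (e1 R) (ycoord c) q = 0,
      pder c (e2 R) (xcoord c) q = 0 & pder c (e2 R) (ycoord c) q = 1].
Proof.
move=> cq.
have nD : \forall y \near cmap c q, cmap c (cinv c y) = y.
  have : nbhs (cmap c q) (cmap c @` cdom c).
    by apply: open_nbhs_nbhs; split; [exact: cimg_open|exists q].
  by apply: filterS => _ [q' cq' <-]; rewrite cinvK.
have E1 e : pder c e (xcoord c) q = e.1.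
  transitivity ('D_e (fun y : R * R => y.1) (cmap c q)).
    by apply: near_eq_derive; apply: filterS nD => y; rewrite /xcoord /= => ->.
  exact: (derive_coord e _).1.
have E2 e : pder c e (ycoord c) q = e.2.
  transitivity ('D_e (fun y : R * R => y.2) (cmap c q)).
    by apply: near_eq_derive; apply: filterS nD => y; rewrite /ycoord /= => ->.
  exact: (derive_coord e _).2.
by rewrite !E1 !E2.
Qed.

Opaque e1 e2.

Lemma pder_chain c c' e q (g : S -> R) : axis e -> atlas c -> atlas c' -> cdom c q -> cdom c' q ->
  germ [set c] q g ->
  pder c' e g q = pder c' e (xcoord c) q * pder c (e1 R) g q + pder c' e (ycoord c) q * pder c
    (e2 R) g q.
Proof.
move=> he ac ac' cq c'q [W [oW Wq sW]].
have [s1 s2] := germ_coord ac' ac c'q cq.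
have d1 := germ_derivable_axis he c'q s1; have d2 := germ_derivable_axis he c'q s2.
pose t := cmap c \o cinv c'.
have tq : t (cmap c' q) = cmap c q by rewrite /t /= cinvK.
have Dt : (cmap c @` (W `&` cdom c)) (t (cmap c' q)) by rewrite tq; exists q.
have := chain_rule (@open_chart_image _ _ c _ oW) (sW c erefl 1%N) Dt d1 d2.
move=> H; have {H} := derive_val (is_derive := H); rewrite tq => H.
refine (etrans _ H); apply: near_eq_derive.
have n1 := near_chart c'q (near_open (@cdom_open _ _ c) cq).
by apply: filterS n1 => y cy; rewrite /= cinvK.
Qed.

Section Rows.
Context {m : nat}.
Implicit Types (s : S -> 'rV[R]_m).

Definition rowgerm (C : set (chart R S)) p s := forall j, germ C p (fun q => s q 0 j).

Lemma rsmooth_germ O s p : open O -> O p -> rsmooth O s -> rowgerm (@atlas _ S) p s.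
Proof. by move=> oO Op ss j; exact: smooth_fun_germ oO Op (ss 0 j). Qed.

Lemma rowgerm_sub c p s : atlas c -> rowgerm (@atlas _ S) p s -> rowgerm [set c] p s.
Proof. by move=> ac ss j; apply: germ_sub (ss j) => _ ->. Qed.

Lemma rder_chain c c' e q s : axis e -> atlas c -> atlas c' -> cdom c q -> cdom c' q ->
  rowgerm (@atlas _ S) q s ->
  rder c' e s q = pder c' e (xcoord c) q *: rder c (e1 R) s q + pder c' e (ycoord c) q *:
    rder c (e2 R) s q.
Proof.
move=> he ac ac' cq c'q ss; apply/rowP => j; rewrite !mxE.
by apply: pder_chain => //; exact: rowgerm_sub ss _.
Qed.

Lemma rderZ c e q (l : S -> R) s : axis e -> cdom c q -> germ [set c] q l -> rowgerm [set c] q s ->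
  rder c e (fun q => l q *: s q) q = l q *: rder c e s q + pder c e l q *: s q.
Proof.
move=> he cq sl ss; apply/rowP => j; rewrite !mxE.
transitivity (pder c e (fun q => l q * s q 0 j) q).
  by apply: pder_fun => q'; rewrite mxE.
by rewrite (pderM he cq sl (ss j)) [s q 0 j * _]mulrC.
Qed.

Lemma rder_near c e q s s' : cdom c q -> (\forall q' \near q, s q' = s' q') ->
  rder c e s q = rder c e s' q.
Proof.
by move=> cq H; apply/rowP => j; rewrite !mxE; apply: pder_near => //; apply: filterS H => q' ->.
Qed.

(** The partial derivatives in one chart are combinations of those in the
    other.  The chain rule applied to the coordinates of the second chart shows
    that the matrix of coefficients is invertible. *)
Lemma free_chart c c' q s : atlas c -> atlas c' -> cdom c q -> cdom c' q ->
  rowgerm (@atlas _ S) q s ->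
  free [:: s q; rder c (e1 R) s q; rder c (e2 R) s q] ->
  free [:: s q; rder c' (e1 R) s q; rder c' (e2 R) s q].
Proof.
have regroup (x y z b11 b12 b21 b22 : R) (v v1 v2 : 'rV[R]_m) :
    x *: v + (y * b11 + z * b21) *: v1 + (y * b12 + z * b22) *: v2 =
    x *: v + y *: (b11 *: v1 + b12 *: v2) + z *: (b21 *: v1 + b22 *: v2).
  by apply/rowP => j; rewrite !mxE; ring.
move=> ac ac' cq c'q ss /free3P H; apply/free3P => x y z.
rewrite (rder_chain axis_e1 ac ac' cq c'q ss) (rder_chain axis_e2 ac ac' cq c'q ss).
set a11 := pder c' (e1 R) (xcoord c) q; set a12 := pder c' (e1 R) (ycoord c) q.
set a21 := pder c' (e2 R) (xcoord c) q; set a22 := pder c' (e2 R) (ycoord c) q.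
move=> E; have [|x0 h1 h2] := H x (y * a11 + z * a21) (y * a12 + z * a22).
  by rewrite -[RHS]E; exact: regroup.
have [s1 s2] := germ_coord ac ac' cq c'q.
have [p11 p12 p21 p22] := pder_own c'q.
have := pder_chain axis_e1 ac ac' cq c'q s1; rewrite p11 -/a11 -/a12.
have := pder_chain axis_e1 ac ac' cq c'q s2; rewrite p12 -/a11 -/a12.
have := pder_chain axis_e2 ac ac' cq c'q s1; rewrite p21 -/a21 -/a22.
have := pder_chain axis_e2 ac ac' cq c'q s2; rewrite p22 -/a21 -/a22.
move: (pder c (e1 R) (xcoord c') q) (pder c (e2 R) (xcoord c') q) => b11 b21.
move: (pder c (e1 R) (ycoord c') q) (pder c (e2 R) (ycoord c') q) => b12 b22.
move=> k4 k3 k2 k1; split=> //.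
  rewrite -[y]mulr1 k1 -[RHS](mul0r b11) -h1 -[LHS]addr0 -[X in _ + X](mulr0 z) k3.
  transitivity ((y * a11 + z * a21) * b11 + (y * a12 + z * a22) * b21); first by ring.
  by rewrite h2 mul0r addr0.
rewrite -[z]mulr1 k4 -[RHS](mul0r b12) -h1 -[LHS]addr0 -[X in _ + X](mulr0 y) k2.
transitivity ((y * a11 + z * a21) * b12 + (y * a12 + z * a22) * b22); first by ring.
by rewrite h2 mul0r addr0.
Qed.

Lemma free_section c q s (l : S -> R) : cdom c q -> germ [set c] q l -> l q != 0 ->
  rowgerm [set c] q s ->
  free [:: s q; rder c (e1 R) s q; rder c (e2 R) s q] ->
  free [:: l q *: s q; rder c (e1 R) (fun q => l q *: s q) q; rder c (e2 R) (fun q => l q *: s q)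
    q].
Proof.
move=> cq sl l0 ss /free3P H; apply/free3P => x y z.
rewrite (rderZ axis_e1 cq sl ss) (rderZ axis_e2 cq sl ss).
move: (pder c (e1 R) l q) (pder c (e2 R) l q) => d1 d2.
move=> E; have [|h0 h1 h2] := H (x * l q + y * d1 + z * d2) (y * l q) (z * l q).
  rewrite -[RHS]E.
  move: (rder _ _ _ _) (rder _ _ _ _) => v1 v2.
  by apply/rowP => j; rewrite !mxE; ring.
have y0 : y = 0 by apply: (mulIf l0); rewrite h1 mul0r.
have z0 : z = 0 by apply: (mulIf l0); rewrite h2 mul0r.
split=> //; apply: (mulIf l0); move: h0; rewrite y0 z0 !mul0r !addr0; exact.
Qed.

End Rows.

Section Locus.
Context {n : nat}.
Implicit Types (f : S -> {vspace 'rV[R]_n.+2}).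

Lemma line_section f p : rsubbundle 1 f -> exists O s, O p /\ local_section f O s.
Proof.
move=> /(_ p)[W [F [oW Wp sF bF]]]; exists W, F; split=> //; split=> // q Wq.
have /basis_rowsP[Ff EF] := bF q Wq.
rewrite EF submx_refl; split=> //.
by apply: contraTneq Ff => ->; rewrite /row_free mxrank0.
Qed.

Lemma line_multiple f p v w : rsubbundle 1 f -> v \in f p -> v != 0 -> w \in f p -> exists a,
  w = a *: v.
Proof.
move=> /(_ p)[W [F [oW Wp sF bF]]].
have /basis_rowsP[Ff EF] := bF p Wp; rewrite !EF => /submxP[x ->] v0 /submxP[y ->].
have x0 : x 0 0 != 0.
  apply: contra v0 => /eqP x0; rewrite (_ : x = 0) ?mul0mx //.
  by apply/rowP => i; rewrite ord1 x0 mxE.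
exists (y 0 0 / x 0 0); rewrite scalemxAl; congr (_ *m _).
by apply/rowP => i; rewrite ord1 mxE divfK.
Qed.

(** By [free_chart] and [free_section] one chart and one local section decide
    whether the line bundle immerses at a point. *)
Lemma immersed_one f c q O s : rsubbundle 1 f -> atlas c -> cdom c q -> O q ->
  local_section f O s ->
  free [:: s q; rder c (e1 R) s q; rder c (e2 R) s q] -> immersed_at f q.
Proof.
move=> lf ac cq Oq [oO sO fO] H c' O' s' ac' c'q O'q [oO' sO' fO'].
have ss := rsmooth_germ oO Oq sO; have ss' := rsmooth_germ oO' O'q sO'.
have {}H := free_chart ac ac' cq c'q ss H.
have [sf s0] := fO q Oq; have [s'f s'0] := fO' q O'q.
have [j sj] : exists j, s q 0 j != 0.
  apply: contrapT => nj; case/eqP: s0; apply/rowP => j; rewrite mxE.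
  by apply/eqP; apply: contrapT => sj; apply: nj; exists j; apply/negP.
pose l q := s' q 0 j / s q 0 j.
have nsj := near_neq0 (C := [set c']) erefl c'q (rowgerm_sub ac' ss j) sj.
have sl : germ [set c'] q l.
  exact: germM (rowgerm_sub ac' ss' j) (germV (C := [set c']) erefl c'q (rowgerm_sub ac' ss j) sj).
have E : \forall q' \near q, l q' *: s q' = s' q'.
  apply: filterS3 nsj (near_open oO Oq) (near_open oO' O'q) => q' sj' Oq' O'q'.
  have [sf' s0'] := fO q' Oq'; have [s'f' _] := fO' q' O'q'.
  have [a E] := line_multiple lf sf' s0' s'f'.
  by rewrite /l E mxE mulfK.
have lq : l q *: s q = s' q by have := nbhs_singleton E.
have l0 : l q != 0.
  by apply: contra s'0 => /eqP l0; rewrite -lq l0 scale0r.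
have := free_section c'q sl l0 (rowgerm_sub ac' ss) H.
by rewrite lq !(rder_near _ c'q E).
Qed.

(** Independence of the rows of a continuous family of matrices is an open
    condition. *)
Lemma immersed_near f p : rsubbundle 1 f -> immersed_at f p -> \forall q \near p, immersed_at f q.
Proof.
move=> lf imm; have [W [s [Wp sec]]] := line_section p lf.
have [c [ac cp]] := atlas_coverE p.
have H := imm c W s ac cp Wp sec.
case: (sec) => oW sW fW; have ss := rowgerm_sub ac (rsmooth_germ oW Wp sW).
pose M q := mx3 (s q) (rder c (e1 R) s q) (rder c (e2 R) s q).
have sM : mxgerm [set c] p (fun q => cmx (M q)).
  move=> i j; apply: cgerm_ext (cgerm_real (_ : germ [set c] p (fun q => M q i j))).
    by apply: nearW => q; rewrite [RHS]mxE.
  case: i => -[|[|[|//]]] lt.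
  - by apply: germ_ext (ss j); apply: nearW => q; rewrite !mxE.
  - by apply: germ_ext (germ_pder axis_e1 cp (ss j)); apply: nearW => q; rewrite !mxE.
  - by apply: germ_ext (germ_pder axis_e2 cp (ss j)); apply: nearW => q; rewrite !mxE.
have Mp : row_free (M p) by rewrite -free_rowsP rows3.
apply: filterS3 (row_free_near cp sM Mp) (near_open oW Wp) (near_dom cp) => q Mq Wq cq.
by apply: (immersed_one lf ac cq Wq sec); rewrite -rows3 free_rowsP.
Qed.

End Locus.
End Immersion.

(** * Line bundles enveloping V *)

Opaque e1 e2.

Section Lines.
Context {R : realType} {S : riemann_surface R} {n : nat}.
Local Notation N := n.+2.
Local Notation kz := (0 -i* 1 : R[i]).
Local Notation kb := (0 +i* 1 : R[i]).
Implicit Types (c : chart R S) (p q : S) (W O : set S) (f g : S -> {vspace 'rV[R]_n.+2}).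
Implicit Types (s : S -> 'rV[R]_n.+2).

Lemma cder_csec c e s p : cder c e (csec s) p = cmx (rder c e s p).
Proof.
apply/rowP => j; rewrite !mxE /=; congr (_ +i* _).
  by apply: pder_fun => q; rewrite mxE.
rewrite -[RHS](pder_cst c e 0 p).
by apply: pder_fun => q; rewrite mxE.
Qed.

Lemma dmxz_csec c s p : dmx c kz (csec s) p =
  2^-1 *: (cmx (rder c (e1 R) s p) - kb *: cmx (rder c (e2 R) s p)).
Proof. by rewrite -dzE /dz !cder_csec. Qed.

Lemma dmxb_csec c s p : dmx c kb (csec s) p =
  2^-1 *: (cmx (rder c (e1 R) s p) + kb *: cmx (rder c (e2 R) s p)).
Proof. by rewrite -dzbarE /dzbar !cder_csec. Qed.

Lemma kb_sq : kb * kb = -1 :> R[i].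
Proof. by apply/eqP; rewrite eq_complex /= !(mulr0, mul0r, mul1r, add0r, addr0, sub0r, oppr0)
  !eqxx. Qed.

Lemma kb_neq0 : kb != 0 :> R[i].
Proof. by rewrite eq_complex /= oner_eq0 andbF. Qed.

Lemma half_add_half : 2^-1 + 2^-1 = 1 :> R[i].
Proof. by have /esym := splitr (1 : R[i]); rewrite div1r. Qed.

Lemma rder1E c s p : cmx (rder c (e1 R) s p) = dmx c kz (csec s) p + dmx c kb (csec s) p.
Proof.
rewrite dmxz_csec dmxb_csec; move: (cmx (rder c (e1 R) s p)) (cmx (rder c (e2 R) s p)) => a b.
apply/rowP => j; rewrite !mxE.
transitivity ((2^-1 + 2^-1) * a 0 j); first by rewrite half_add_half mul1r.
by ring.
Qed.

Lemma rder2E c s p : cmx (rder c (e2 R) s p) = kb *: (dmx c kz (csec s) p - dmx c kb (csec s) p).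
Proof.
rewrite dmxz_csec dmxb_csec; move: (cmx _) (cmx _) => a b.
transitivity (- (kb * kb) *: b); first by rewrite kb_sq opprK scale1r.
apply/rowP => j; rewrite !mxE.
transitivity ((2^-1 + 2^-1) * (- (kb * kb) * b 0 j)); first by rewrite half_add_half mul1r.
by ring.
Qed.

Lemma free3_cmx m (a b d : 'rV[R]_m) : free [:: a; b; d] -> free [:: cmx a; cmx b; cmx d].
Proof.
rewrite -!rows3 !free_rowsP => H; rewrite -(row_free_map (real_complex R)) in H.
move: H; congr (is_true (row_free _)); apply/matrixP => i j; rewrite !mxE.
by case: eqP => _ //; case: eqP.
Qed.

Lemma free_dz c s p : free [:: s p; rder c (e1 R) s p; rder c (e2 R) s p] ->
  free [:: csec s p; dmx c kz (csec s) p; dmx c kb (csec s) p].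
Proof.
move=> /free3_cmx/free3P H; apply/free3P => x y z.
rewrite dmxz_csec dmxb_csec -[csec s p]/(cmx (s p)).
move: (cmx (rder c (e1 R) s p)) (cmx (rder c (e2 R) s p)) (cmx (s p)) H => a b v H E.
have [|x0 h1 h2] := H x (2^-1 * (y + z)) (2^-1 * kb * (z - y)).
  rewrite -[RHS]E.
  by apply/rowP => j; rewrite !mxE; ring.
move/eqP: h2; rewrite mulf_eq0 (negbTE (mulf_neq0 _ kb_neq0)) ?invr_eq0 ?pnatr_eq0 //= subr_eq0 =>
  /eqP zy.
move/eqP: h1; rewrite zy mulf_eq0 invr_eq0 pnatr_eq0 /= -mulr2n -mulr_natl mulf_eq0 pnatr_eq0 /= =>
  /eqP y0.
by split=> //; rewrite zy.
Qed.

Variables (V : S -> {vspace 'rV[R]_n.+2}) (V31 : bundle31 V).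
Variables (Vh : harmonic_bundle [set: S] V).
Variables (r : nat) (U : S -> {vspace 'rV[R[i]]_n.+2}) (hU : is_bundle_U V U r).
Let sV p : signature31 (V p) := V31.2 p.

Lemma mxgerm_csec O s c p : open O -> O p -> rsmooth O s -> atlas c -> mxgerm [set c] p (csec s).
Proof. by move=> oO Op ss ac; apply: (mxgerm_sub _ (mxgerm_frame oO Op ss)) => _ ->. Qed.

Section Envelope.
Variable f : S -> {vspace 'rV[R]_n.+2}.
Hypothesis (nlf : null_line_subbundle V f).
Hypothesis (fU : forall p v, v \in f p -> orthU U p (cmx v)).
Hypothesis (Uf : forall p v, v \in f p -> v != 0 -> exists2 u, u \in U p & forall a, u <> a *:
  cmx v).

Lemma section_enveloping c p O s : atlas c -> cdom c p -> O p -> local_section f O s ->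
  enveloping V U c p (csec s).
Proof.
move=> ac cp Op [oO ss fs]; have [_ isof fV] := nlf.
split=> //; first exact: mxgerm_csec oO Op ss ac.
apply: filterS (near_open oO Op) => q Oq; have [sf s0] := fs q Oq.
split.
- exact: cjmx_cmx.
- by rewrite /csec /cvec -/(cmx _) cvec_cplx; apply: (subvP (fV q)).
- by rewrite /csec /cvec -/(cmx _) cmx_ip (isof q _ _ sf sf).
- exact: fU.
- by have [u uU us] := Uf sf s0; exists u => //; split=> //; rewrite cmx_eq0.
Qed.

Lemma envelope_envelops : envelops V f.
Proof.
move=> c p O s ac cp Op ls; have es := section_enveloping ac cp Op ls.
rewrite -!cvec_cplx rder1E rder2E.
have zV := env_zV V31 hU ac es; have bV := env_bV V31 hU ac es.
by split; [exact: memvD|apply: memvZ; exact: memvB].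
Qed.

Lemma envelope_imm c p O s : atlas c -> cdom c p -> O p -> local_section f O s -> immersed_at f p ->
  free [:: csec s p; dmx c kz (csec s) p; dmx c kb (csec s) p].
Proof. by move=> ac cp Op ls imm; apply: free_dz; exact: imm ls. Qed.

Lemma envelope_conformal : conformal_immersion (immersed_locus f) f.
Proof.
split=> // c p O s ac imm cp Op ls; have es := section_enveloping ac cp Op ls.
have F3 := envelope_imm ac cp Op ls imm.
rewrite /f10 dzE; split.
  have : free [:: csec s p; dmx c kz (csec s) p].
    apply/free2P => x y E; have /free3P/(_ x y 0) := F3.
    by rewrite scale0r addr0 => /(_ E)[].
  by rewrite /free => /eqP ->.
have [_ _ sn _ _] : env_at V U (csec s) p by case: es => _ _ /nbhs_singleton.
move=> v w /span2P[x [y ->]] /span2P[x' [y' ->]].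
have zs := env_ds es kz; have zz := env_z_null V31 hU ac es.
by rewrite !ipDl !ipDr !ipZl !ipZr sn zz zs [ip (csec s p) _]ipC zs !mulr0 !addr0.
Qed.

Lemma envelope_gauss : conformal_gauss_map (immersed_locus f) f V.
Proof.
move=> c p O s ac imm cp Op ls; have es := section_enveloping ac cp Op ls.
have F3 := envelope_imm ac cp Op ls imm.
rewrite /gauss_span dzE dzbarE dzE.
have -> : dzbar c (csec s) = dmx c kb (csec s) by apply/funext => q; exact: dzbarE.
exact: (env_gauss V31 hU ac es F3).
Qed.

Lemma envelope_willmore : willmore (immersed_locus f) f V.
Proof.
split; [exact: envelope_conformal|exact: envelope_gauss|].
by move=> c p ac _ cp; exact: Vh.
Qed.

Lemma kappa_csec c p O s : atlas c -> cdom c p -> O p -> local_section f O s ->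
  kappa V c s p = dmx c kz (csec s) p *m Nmx V c kz p /\
  cD V (dzbar c) (kappa V c s) p = dmx c kz (dmx c kb (csec s)) p *m Nmx V c kz p.
Proof.
move=> ac cp Op ls; have es := section_enveloping ac cp Op ls.
have E : kappa V c s = fun q => nrml V q (dmx c kz (dmx c kz (csec s)) q).
  have E2 : dz c (csec s) = dmx c kz (csec s) by apply/funext => q'; exact: dzE.
  by apply/funext => q; rewrite /kappa dzE E2.
by rewrite E; split; [exact: (env_kappa V31 hU ac es)|exact: (env_Dkappa V31 Vh hU ac es)].
Qed.

End Envelope.

(** If s_z stays in V then N_z kills s. *)
Lemma contact_orthU f p c O s : null_line_subbundle V f -> atlas c -> cdom c p -> O p ->
  local_section f O s ->
  (\forall q \near p, dz c (csec s) q \in cplx (V q)) -> orthU U p (cmx (s p)).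
Proof.
move=> [_ _ fV] ac cp Op [oO ss fs] H.
have sV' : \forall q \near p, csec s q \in cplx (V q).
  apply: filterS (near_open oO Op) => q Oq.
  by rewrite /csec /cvec -/(cmx _) cvec_cplx; apply: (subvP (fV q)); case: (fs q Oq).
have nsV : \forall q \near p, \forall q' \near q, csec s q' \in cplx (V q') by exact: nbhs_interior.
apply: (Nmx_orthU V31 hU ac cp (mxgerm_csec oO Op ss ac)).
apply: filterS (filterI (filterI nsV H) (filterI (near_dom cp) (near_open oO Op))) =>
  q [[nV dV] [cq Oq]]; split; first exact: nbhs_singleton nV.
apply/eqP; rewrite -(deriv_in_V V31 kz ac cq (mxgerm_csec oO Oq ss ac) nV).
by rewrite -dzE.
Qed.

Lemma line_orthU f p v : rsubbundle 1 f ->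
  (forall c O s, atlas c -> cdom c p -> O p -> local_section f O s -> orthU U p (cmx (s p))) ->
  v \in f p -> orthU U p (cmx v).
Proof.
move=> lf H vf; have [W [s [Wp ls]]] := line_section p lf.
have [c [ac cp]] := atlas_coverE p; have [_ _ fW] := ls; have [sf s0] := fW p Wp.
have [a ->] := line_multiple lf sf s0 vf.
by move=> u uU; rewrite /cmx map_mxZ ipZl -/(cmx _) (H c W s) // mulr0.
Qed.

Lemma immersed_orthU f p v : null_line_subbundle V f ->
  conformal_gauss_map (immersed_locus f) f V -> immersed_at f p -> v \in f p -> orthU U p (cmx v).
Proof.
move=> nlf gf imm; have [lf _ _] := nlf.
apply: line_orthU => // c W s ac cp Wp ls; have [oW _ _] := ls.
apply: (contact_orthU nlf ac cp Wp ls).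
apply: filterS3 (immersed_near lf imm) (near_dom cp) (near_open oW Wp) => q iq cq Wq.
rewrite -(gf c q W s ac iq cq Wq ls); apply: memv_span.
by rewrite !inE; apply/or4P; apply: Or42; exact: eqxx.
Qed.

Lemma envelops_orthU f p v : null_line_subbundle V f -> envelops V f -> v \in f p ->
  orthU U p (cmx v).
Proof.
move=> nlf ef; have [lf _ _] := nlf.
apply: line_orthU => // c W s ac cp Wp ls; have [oW _ _] := ls.
apply: (contact_orthU nlf ac cp Wp ls).
apply: filterS2 (near_dom cp) (near_open oW Wp) => q cq Wq.
have [h1 h2] := ef c q W s ac cq Wq ls.
rewrite dzE dmxz_csec; apply: memvZ; apply: memvB; last apply: memvZ.
  by rewrite cvec_cplx; exact: h1.
by rewrite cvec_cplx; exact: h2.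
Qed.

End Lines.

(** * Line bundles given by equations of corank one *)

Section KernelLine.
Context {R : realType} {S : riemann_surface R} {n : nat}.

Definition corank1 (K : fieldType) d (M : 'M[K]_d) := (exists2 x : 'rV_d, x != 0 & x *m M = 0) /\
  forall x y : 'rV_d, x != 0 -> x *m M = 0 -> y *m M = 0 -> exists a, y = a *: x.

Lemma corank1_rank (K : fieldType) d (M : 'M[K]_d.+1) : corank1 M -> \rank M = d.
Proof.
move=> [[x x0 xM] H].
have : \rank (kermx M) = 1%N.
  apply/eqP; rewrite eqn_leq; apply/andP; split.
    apply: leq_trans (rank_leq_row x); apply: mxrankS; apply/row_subP => i.
    have [|a ->] := H x (row i (kermx M)) x0 xM; last exact: scalemx_sub.
    by apply/sub_kermxP; exact: row_sub.
  by rewrite lt0n mxrank_eq0; apply: contra x0 => /eqP K0; move/sub_kermxP: xM; rewrite K0 submx0.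
rewrite mxrank_ker => E; have := rank_leq_row M; lia.
Qed.

(** Gaussian elimination brings the matrix to diag (1, ..., 1, 0); the update
    fills in the last diagonal entry. *)
Lemma corank1_update (K : fieldType) d (M : 'M[K]_d.+1) : corank1 M ->
  exists k : 'cV_d.+1, exists z : 'rV_d.+1, M + k *m z \in unitmx.
Proof.
move=> /corank1_rank rM.
exists (col_ebase M *m delta_mx ord_max 0), (delta_mx 0 ord_max *m row_ebase M).
rewrite -{1}[M]mulmx_ebase rM !mulmxA -[_ *m delta_mx _ _ *m delta_mx _ _]mulmxA mul_delta_mx.
rewrite -mulmxDl -mulmxDr (_ : pid_mx d + delta_mx ord_max ord_max = 1%:M).
  by rewrite mulmx1 unitmx_mul col_ebase_unit row_ebase_unit.
apply/matrixP => i j; rewrite !mxE.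
have := ltn_ord i; rewrite ltnS leq_eqVlt => /orP[/eqP id|id].
  have -> : i = ord_max by exact: val_inj.
  by rewrite /= ltnn andbF add0r eqxx /= eq_sym.
by rewrite id andbT -val_eqE /= (ltn_eqF id) /= addr0.
Qed.

(** Choose k and z constant with M + k z invertible at p, hence near p.  If
    x M = 0 then x (M + k z) = (x k) z, so the kernel is spanned by the smooth
    vector z (M + k z)^-1. *)
Lemma rsubbundle_kernel d (f : S -> {vspace 'rV[R]_n.+2}) :
  (forall p, exists W, exists F : S -> 'M[R]_(d.+1, n.+2), exists M : S -> 'M[R]_d.+1,
    [/\ open W, W p & forall q, W q ->
      [/\ mxgerm (@atlas _ S) q (fun q => cmx (F q)), mxgerm (@atlas _ S) q (fun q => cmx (M q)),
       row_free (F q), corank1 (M q) & forall v, v \in f q <-> exists2 x,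
         v = x *m F q & x *m M q = 0]]) ->
  rsubbundle 1 f.
Proof.
move=> H p; have [W [F [M [oW Wp HW]]]] := H p.
have [sF sM _ kM _] := HW p Wp.
have [k [z Bu]] := corank1_update kM.
pose B q := M q + k *m z.
have sB q : W q -> mxgerm (@atlas _ S) q (fun q => cmx (B q)).
  move=> /HW[_ sMq _ _ _]; apply: mxgerm_ext (mxgermD sMq (mxgerm_cst _ _ (cmx (k *m z)))).
  by apply: nearW => q'; rewrite /B /cmx map_mxD.
have [c [ac cp]] := atlas_coverE p.
have BuC : cmx (B p) \in unitmx by rewrite map_unitmx.
have := filterI (near_unitmx ac cp (sB p Wp) BuC) (near_open oW Wp).
move=> /(_ _)/nbhs_open[W' [oW' W'p W'W]].
exists W', (fun q => z *m invmx (B q) *m F q); split=> //.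
  apply: rsmooth_local => q W'q; have [/= Buq Wq] := W'W q W'q.
  have [c' [ac' cq]] := atlas_coverE q; have [sFq _ _ _ _] := HW q Wq.
  apply: mxgerm_ext (mxgermM (mxgermM (mxgerm_cst _ _ (cmx z)) (mxgerm_inv ac' cq (sB q Wq) Buq))
    sFq).
  by apply: nearW => q'; rewrite cmxM cmxM /cmx map_invmx.
move=> q W'q; have [/= Buq Wq] := W'W q W'q; have [_ _ Ff [[x x0 xM] Hk] Ef] := HW q Wq.
rewrite map_unitmx in Buq.
have kerE y : y *m M q = 0 -> y = (y *m k) 0 0 *: (z *m invmx (B q)).
  move=> yM; rewrite -[LHS](mulmxK Buq) /B mulmxDr yM add0r mulmxA.
  have -> : y *m k *m z = (y *m k) 0 0 *: z by rewrite {1}[y *m k]mx11_scalar mul_scalar_mx.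
  by rewrite scalemxAl.
set w := z *m invmx (B q) in kerE *.
have wM : w *m M q = 0.
  have := kerE x xM; set a := (x *m k) 0 0 => xE.
  have a0 : a != 0 by apply: contra x0 => /eqP a0; rewrite xE a0 scale0r.
  by apply: (scalerI a0); rewrite scaler0 scalemxAl -xE.
apply/basis_rowsP; split.
  apply: inj_row_free => y /eqP; rewrite mulmxA mulmx_free_eq0 // [y]mx11_scalar mul_scalar_mx.
  rewrite scaler_eq0 => /orP[/eqP ->|/eqP w0]; first by rewrite raddf0.
  by case/eqP: x0; rewrite (kerE x xM) w0 scaler0.
move=> v; apply/idP/idP.
  move=> /Ef[y -> /kerE ->]; rewrite -scalemxAl scalemx_sub //.
move=> /submxP[y ->]; apply/Ef; exists (y *m w); first by rewrite mulmxA.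
by rewrite -mulmxA wM mulmx0.
Qed.

End KernelLine.

(** * The real points of an isotropic plane *)

Section ComplexBlocks.
Context {R : realType}.
Local Notation kb := (0 +i* 1 : R[i]).

(** This is the real form of the multiplication by P + i Q, so its determinant
    is |det (P + i Q)|^2; conjugating by unipotent blocks makes it triangular. *)
Lemma det_complex_block m (P Q : 'M[R]_m) : 0 <= \det (block_mx P Q (- Q) P).
Proof.
pose Z := cmx P + kb *: cmx Q.
have cZ : cjmx Z = cmx P - kb *: cmx Q.
  by apply/matrixP => i j; rewrite !mxE /= ; apply/eqP; rewrite eq_complex /=; apply/andP; split;
    apply/eqP; ring.
pose T (a : R[i]) : 'M[R[i]]_(m + m) := block_mx 1%:M a%:M 0 1%:M.
have dT a : \det (T a) = 1 by rewrite /T det_ublock !det1 mulr1.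
have E : T kb *m cmx (block_mx P Q (- Q) P) *m T (- kb) = block_mx (cjmx Z) 0 (- cmx Q) Z.
  rewrite /T /cmx map_block_mx !mulmx_block !mul1mx !mul0mx !mulmx1 !mulmx0 !addr0 !add0r.
  rewrite -![map_mx _ _]/(cmx _) !mul_scalar_mx !mul_mx_scalar.
  have -> : cmx (- Q) = - cmx Q by rewrite /cmx map_mxN.
  rewrite cZ; congr block_mx; rewrite ?scalerN //.
    apply/matrixP => i j; rewrite [RHS]mxE.
    transitivity ((kb * kb + 1) * cmx Q i j); last by rewrite kb_sq addNr mul0r.
    move: (cmx P) (cmx Q) => P' Q'; by rewrite !mxE; ring.
  by rewrite /Z addrC scaleNr opprK.
have : (\det (block_mx P Q (- Q) P))%:C = conjc (\det Z) * \det Z.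
  have := congr1 determinant E; rewrite !det_mulmx !dT mul1r mulr1 det_lblock.
  by rewrite /cmx det_map_mx /cjmx det_map_mx.
case: (\det Z) => a b H; have := congr1 (@complex.Re R) H; rewrite /= => ->.
have := sqr_ge0 a; have := sqr_ge0 b; rewrite !expr2; lra.
Qed.

Lemma reim_eq0 a b (A B : 'M[R]_(a, b)) : cmx A + kb *: cmx B = 0 -> A = 0 /\ B = 0.
Proof.
move=> /matrixP H; split; apply/matrixP => i j.
  by have := congr1 (@complex.Re R) (H i j); rewrite !mxE /= mul0r mul1r subrr addr0.
by have := congr1 (@complex.Im R) (H i j); rewrite !mxE /= mul0r mul1r !add0r.
Qed.

End ComplexBlocks.

Section PlaneLine.
Context {R : realType} {n : nat}.
Local Notation N := n.+2.
Local Notation JN := (Jmx R n.+1).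
Local Notation JC := (Jmx R[i] n.+1).
Variables (E : {vspace 'rV[R]_n.+2}) (sE : signature31 E).
Variables (F : 'M[R]_(4, N)) (bF : basis_of E (rows F)).
Variables (Fu : 'M[R[i]]_(2, N)) (fFu : row_free Fu) (FuE : (Fu <= cmx F)%MS)
  (iFu : Fu *m JC *m Fu^T = 0).

Definition reim_mx : 'M[R]_(2 + 2, N) := col_mx (remx Fu) (immx Fu).

Lemma orth_reim (v : 'rV[R]_N) : (cmx v *m JC *m Fu^T == 0) = (v *m JN *m reim_mx^T == 0).
Proof.
have -> : cmx v *m JC *m Fu^T = cmx (v *m JN *m (remx Fu)^T) + (0 +i* 1) *:
  cmx (v *m JN *m (immx Fu)^T).
  rewrite {1}[Fu]reim linearD linearZ /= mulmxDr -scalemxAr !cmx_tr.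
  by rewrite ![cmx (_ *m _ *m _)]cmxM ![cmx (v *m _)]cmxM cmxJ.
rewrite /reim_mx tr_col_mx mul_mx_row.
apply/eqP/eqP => [H|].
  by have [-> ->] := reim_eq0 H; rewrite row_mx0.
rewrite -row_mx0 => /eq_row_mx[-> ->].
by rewrite /cmx !map_mx0 scaler0 addr0.
Qed.

Definition plane_mx : 'M[R]_4 := F *m JN *m reim_mx^T.

Lemma plane_mx_ker (x : 'rV[R]_4) : x *m plane_mx = 0 <-> cmx (x *m F) *m JC *m Fu^T = 0.
Proof.
have -> : x *m plane_mx = x *m F *m JN *m reim_mx^T by rewrite /plane_mx !mulmxA.
by split=> /eqP H; apply/eqP; rewrite ?orth_reim // -orth_reim.
Qed.

(** Isotropy of A + i B says that A and B have the same Gram matrix and that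
    their mixed Gram matrix is skew, so [det_complex_block] applies. *)
Lemma plane_gram : 0 <= \det (gram reim_mx).
Proof.
have [re_im im_re] : gram (remx Fu) = gram (immx Fu) /\
    immx Fu *m JN *m (remx Fu)^T = - (remx Fu *m JN *m (immx Fu)^T).
  have E0 : cmx (gram (remx Fu) - gram (immx Fu)) +
      (0 +i* 1) *: cmx (immx Fu *m JN *m (remx Fu)^T + remx Fu *m JN *m (immx Fu)^T) = 0.
    rewrite -iFu [X in _ = X *m _ *m _]reim [X in _ = _ *m X^T]reim linearD linearZ /=.
    rewrite !mulmxDl !mulmxDr -!scalemxAl -!scalemxAr !cmx_tr -!cmxJ -!cmxM scalerA kb_sq scaleN1r.
    rewrite /gram [cmx (_ - _)]map_mxB [cmx (_ + _)]map_mxD -!/(cmx _) scalerDr.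
    move: (cmx _) (cmx _) (_ *: cmx _) (_ *: cmx _) => A B C D.
    by apply/matrixP => i j; rewrite !mxE; ring.
  have [/eqP] := reim_eq0 E0.
  by rewrite subr_eq0 => /eqP -> /eqP; rewrite addr_eq0 => /eqP ->.
rewrite /gram /reim_mx tr_col_mx mul_col_mx mul_col_row -!/(gram _) -re_im im_re.
exact: det_complex_block.
Qed.

(** A basis of a (3,1)-space has negative Gram determinant, so by [plane_gram]
    the real and imaginary parts of the frame are dependent, and some real vector
    is orthogonal to the plane.  Such vectors lie in the isotropic plane, so two
    of them are orthogonal and null, hence proportional. *)
Lemma plane_mx_corank1 : corank1 plane_mx.
Proof.
have [A AF] : exists A, reim_mx = A *m F.
  have [/submxP[A1 E1] /submxP[A2 E2]] := cmx_reim_sub FuE.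
  by exists (col_mx A1 A2); rewrite /reim_mx E1 E2 mul_col_mx.
split.
  apply/det0P.
  have Gm : gram reim_mx = A *m gram F *m A^T by rewrite AF /gram trmx_mul !mulmxA.
  have := plane_gram; rewrite Gm !det_mulmx det_tr mulrAC -expr2.
  have := gram_det_lt0 sE bF => G0 H.
  have : \det A ^+ 2 = 0.
    apply/eqP; rewrite eq_le sqr_ge0 andbT -(ler_nM2r G0) mul0r //.
  move=> /eqP; rewrite sqrf_eq0 => /eqP A0.
  by rewrite /plane_mx AF trmx_mul mulmxA det_mulmx det_tr A0 mulr0.
have inU (x : 'rV_4) : x *m plane_mx = 0 -> exists y, cmx (x *m F) = y *m Fu.
  move=> H0; have /plane_mx_ker H := H0; apply/submxP; apply: (isotropic_plane_max sE) => //.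
    by move=> i; rewrite (cplxP bF); apply: submx_trans FuE; exact: row_sub.
  by rewrite cvec_cplx ((basis_rowsP _ _).1 bF).2 submxMl.
have ip0 (x y : 'rV_4) : x *m plane_mx = 0 -> y *m plane_mx = 0 -> ip (x *m F) (y *m F) = 0.
  move=> /inU[x' Ex] /inU[y' Ey]; have := cmx_ip (x *m F) (y *m F).
  rewrite Ex Ey ipE trmx_mul -!mulmxA [Fu *m _]mulmxA [Fu *m _ *m _]mulmxA iFu mul0mx mulmx0 mxE.
  by move=> /(congr1 (@complex.Re R)).
have [Ff EF] := (basis_rowsP _ _).1 bF.
move=> x y x0 xM yM.
have [| | | | | | a E'] := null_proportional sE (v := x *m F) (w := y *m F);
  rewrite ?EF ?submxMl ?ip0 //.
  by rewrite mulmx_free_eq0.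
exists a; apply/eqP; rewrite -subr_eq0 -(mulmx_free_eq0 _ Ff) mulmxBl E' scalemxAl subrr //.
Qed.

End PlaneLine.

(** * U of rank two *)

Section RankTwo.
Context {R : realType} {S : riemann_surface R} {n : nat}.
Local Notation N := n.+2.
Local Notation JC := (Jmx R[i] n.+1).
Local Notation kz := (0 -i* 1 : R[i]).
Local Notation kb := (0 +i* 1 : R[i]).
Implicit Types (c : chart R S) (p q : S) (W O : set S) (f g : S -> {vspace 'rV[R]_n.+2}).

Lemma mxgerm_re C p a b (F : S -> 'M[R[i]]_(a, b)) : mxgerm C p F ->
  mxgerm C p (fun q => cmx (remx (F q))).
Proof.
by move=> sF i j; have [rF _] := sF i j; apply: cgerm_ext (cgerm_real rF); apply: nearW => q;
  rewrite !mxE.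
Qed.

Lemma mxgerm_im C p a b (F : S -> 'M[R[i]]_(a, b)) : mxgerm C p F ->
  mxgerm C p (fun q => cmx (immx (F q))).
Proof.
by move=> sF i j; have [_ iF] := sF i j; apply: cgerm_ext (cgerm_real iF); apply: nearW => q;
  rewrite !mxE.
Qed.

Lemma mxgerm_col C p a b d (F : S -> 'M[R[i]]_(a, d)) (G : S -> 'M[R[i]]_(b, d)) :
  mxgerm C p F -> mxgerm C p G -> mxgerm C p (fun q => col_mx (F q) (G q)).
Proof.
move=> sF sG i j; rewrite -(splitK i); case: (fintype.split i) => k /=.
  by apply: cgerm_ext (sF k j); apply: nearW => q; rewrite col_mxEu.
by apply: cgerm_ext (sG k j); apply: nearW => q; rewrite col_mxEd.
Qed.

Lemma kernel_space (K : fieldType) d e m (F : 'M[K]_(d, m)) (M : 'M[K]_(d, e)) :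
  exists E : {vspace 'rV[K]_m}, forall v, v \in E <-> exists2 x, v = x *m F & x *m M = 0.
Proof.
exists <<rows (kermx M *m F)>>%VS => v; rewrite span_rowsP; split.
  by move=> /submxP[y ->]; exists (y *m kermx M); [rewrite mulmxA|rewrite -mulmxA mulmx_ker mulmx0].
by move=> [x -> /sub_kermxP xM]; exact: submxMr.
Qed.

Variables (V : S -> {vspace 'rV[R]_n.+2}) (V31 : bundle31 V).
Variables (Vh : harmonic_bundle [set: S] V).
Variables (U : S -> {vspace 'rV[R[i]]_n.+2}) (hU : is_bundle_U V U 2).
Let sV p : signature31 (V p) := V31.2 p.

Lemma U_frame_iso p (Fu : 'M[R[i]]_(2, N)) : basis_of (U p) (rows Fu) ->
  [/\ row_free Fu, forall i, row i Fu \in cplx (V p) & Fu *m JC *m Fu^T = 0].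
Proof.
move=> /basis_rowsP[Ff UF].
have rU i : row i Fu \in U p by rewrite UF row_sub.
split=> //; first by move=> i; exact: (U_sub hU (rU i)).
by apply/matrixP => i j; rewrite ip_mx mxE (U_iso hU (rU i) (rU j)).
Qed.

Lemma orthU_frame r' (U' : S -> {vspace 'rV[R[i]]_n.+2}) p (Fu : 'M[R[i]]_(r', N)) (v : 'rV_N) :
  basis_of (U' p) (rows Fu) -> orthU U' p v <-> v *m JC *m Fu^T = 0.
Proof.
move=> /basis_rowsP[Ff UF]; split=> [vU|H u].
  apply/rowP => j; rewrite ip_mx mxE (_ : row 0 v = v); last by apply/rowP => k; rewrite mxE.
  by apply: vU; rewrite UF row_sub.
by rewrite UF => /submxP[y ->]; rewrite ipE trmx_mul mulmxA H mul0mx mxE.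
Qed.

Lemma orthU_mem p v : v \in cplx (V p) -> orthU U p v -> v \in U p.
Proof.
move=> vV; have [Fu [_ [W [_ Wp _ bFu]]]] := U_frame hU p.
have [Ff FV iF] := U_frame_iso (bFu p Wp).
move=> /(orthU_frame _ (bFu p Wp)) vF.
rewrite ((basis_rowsP _ _).1 (bFu p Wp)).2.
exact: isotropic_plane_max (sV p) Ff FV vV iF vF.
Qed.

(** The real vectors of V orthogonal to U are the real points of U, as U is its
    own orthogonal ([orthU_mem]); orthogonality is the linear form of the
    condition. *)
Lemma realU_ex : exists f, forall p v, (v \in f p) = (v \in V p) && `[< orthU U p (cmx v) >].
Proof.
suff /choice[f H] : forall p, exists E : {vspace 'rV[R]_n.+2}, forall v,
  (v \in E) = (v \in V p) && `[< orthU U p (cmx v) >].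
  by exists f.
move=> p; have [F bF] := frame_ex (sV p).
have [Fu [_ [W [_ Wp _ bFu]]]] := U_frame hU p.
have [E HE] := kernel_space F (plane_mx F (Fu p)).
exists E => v; apply/idP/andP.
  move=> /HE[x -> xM]; split; first by rewrite ((basis_rowsP _ _).1 bF).2 submxMl.
  by apply/asboolP/(orthU_frame _ (bFu p Wp))/plane_mx_ker.
case; rewrite ((basis_rowsP _ _).1 bF).2 => /submxP[x ->] /asboolP/(orthU_frame _ (bFu p Wp)).
by move=> /plane_mx_ker H; apply/HE; exists x.
Qed.

Variables (f : S -> {vspace 'rV[R]_n.+2}).
Hypothesis fE : forall p v, (v \in f p) = (v \in V p) && `[< orthU U p (cmx v) >].

Lemma realU_orth p v : v \in f p -> orthU U p (cmx v).
Proof. by rewrite fE => /andP[_ /asboolP]. Qed.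

Lemma realU_U p v : v \in f p -> cmx v \in U p.
Proof.
by rewrite fE => /andP[vV /asboolP vU]; apply: orthU_mem => //; rewrite cvec_cplx.
Qed.

Lemma realU_bundle : null_line_subbundle V f.
Proof.
split; first last.
- by move=> p; apply/subvP => v; rewrite fE => /andP[].
- move=> p v w vf wf; have := cmx_ip v w; rewrite (U_iso hU (realU_U vf) (realU_U wf)).
  by move=> /(congr1 (@complex.Re R)).
apply: (@rsubbundle_kernel _ _ _ 3) => p.
have [W [F [oW Wp sF bF]]] := V31.1 p.
have [Fu [_ [W' [oW' W'p sFu bFu]]]] := U_frame hU p.
exists (W `&` W'), F, (fun q => plane_mx (F q) (Fu q)); split=> //; first exact: openI.
move=> q [Wq W'q].
have sFq := mxgerm_frame oW Wq sF; have sFuq := mxgerm_csmooth oW' W'q sFu.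
have [Ff FV iF] := U_frame_iso (bFu q W'q).
have [Fvf EV] := (basis_rowsP _ _).1 (bF q Wq).
split=> //.
- have sR := mxgerm_col (mxgerm_re sFuq) (mxgerm_im sFuq).
  apply: mxgerm_ext (mxgermM (mxgermM sFq (mxgerm_cst _ _ (Jmx R[i] n.+1))) (mxgerm_tr sR)).
  apply: nearW => q'; rewrite /plane_mx /reim_mx -cmxJ -cmxM.
  rewrite -[col_mx _ _]map_col_mx -[map_mx _ _]/(cmx _) cmx_tr.
  exact: esym (cmxM _ _).
- have FuV : (Fu q <= cmx (F q))%MS by apply/row_subP => i; rewrite -(cplxP (bF q Wq)).
  exact: (@plane_mx_corank1 _ _ _ (sV q) _ (bF q Wq) _ Ff FuV iF).
move=> v; rewrite fE EV; split.
  move=> /andP[/submxP[x ->] /asboolP/(orthU_frame _ (bFu q W'q)) H]; exists x => //.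
  exact/plane_mx_ker.
move=> [x -> xM]; rewrite submxMl /=; apply/asboolP/(orthU_frame _ (bFu q W'q)).
exact/plane_mx_ker.
Qed.

Lemma realU_transverse p v : v \in f p -> v != 0 -> exists2 u, u \in U p & forall a, u <> a *:
  cmx v.
Proof.
move=> vf v0; apply: contrapT => H.
have [Fu [_ [W [_ Wp _ bFu]]]] := U_frame hU p.
have : (U p <= <[cmx v]>)%VS.
  apply/subvP => u uU; apply/vlineP; apply: contrapT => H'; apply: H; exists u => // a ua.
  by apply: H'; exists a.
by move=> /dimvS; rewrite (basis_dim (bFu p Wp)) dim_vline; case: eqP.
Qed.

Let es := section_enveloping realU_bundle realU_orth realU_transverse.

Lemma realU_willmore : willmore (immersed_locus f) f V.
Proof. exact: (envelope_willmore V31 Vh hU realU_bundle realU_orth realU_transverse). Qed.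

(** At an immersed point off the divisor, a relation between kappa and
    D_zbar kappa says that N_z kills w = x s_z + y s_zzbar, so that w lies in U.
    The vectors s and s_zbar also lie in U; the product of w with s gives y = 0,
    and then its product with s_zbar gives x = 0. *)
Lemma realU_not_swillmore : immersed_locus f !=set0 -> ~ s_willmore (immersed_locus f) f V.
Proof.
move=> [p imm] [_ sw].
have [Delta D0 HD] := ker_NmxP V31 hU.
have [lf _ _] := realU_bundle.
have [q imq nDq] := off_divisor_dense D0 (immersed_near lf imm).
have [W [s [Wq ls]]] := line_section q lf.
have [c [ac cq]] := atlas_coverE q.
have eq := es ac cq Wq ls.
have /negP[] := sw c q W s ac imq cq Wq ls.
have [-> ->] := kappa_csec V31 Vh hU realU_bundle realU_orth realU_transverse ac cq Wq ls.
have imm3 := free_dz (imq c W s ac cq Wq ls).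
have [zV bV zbV] : [/\ dmx c kz (csec s) q \in cplx (V q), dmx c kb (csec s) q \in cplx (V q)
   & dmx c kz (dmx c kb (csec s)) q \in cplx (V q)].
  by split; [exact: (env_zV V31 hU ac eq)|exact: (env_bV V31 hU ac eq)|exact:
    (env_zbV V31 hU ac eq)].
apply/free2P => x y; rewrite !scalemxAl -mulmxDl.
set w := _ + _ => wN.
have wV : w \in cplx (V q) by exact: memvD (memvZ _ zV) (memvZ _ zbV).
have wU := orthU_mem wV ((HD c q w ac cq nDq wV).1 wN).
have ws : ip w (csec s q) = 0.
  by apply: (U_iso hU wU); apply: realU_U; case: ls => _ _ /(_ q Wq)[].
have wb : ip w (dmx c kb (csec s) q) = 0.
  have bU := orthU_mem bV (env_bU V31 hU ac eq).
  exact: (U_iso hU wU bU).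
move: ws; rewrite /w ipDl 2!ipZl (env_ds eq kz) mulr0 add0r => /eqP.
rewrite mulf_eq0 (negbTE (env_zb_s_neq0 V31 hU ac eq imm3)) orbF => /eqP y0.
move: wb; rewrite /w y0 scale0r addr0 ipZl => /eqP.
by rewrite mulf_eq0 (negbTE (env_metric V31 hU ac eq imm3)) orbF => /eqP.
Qed.

Lemma realU_envelops : envelops V f.
Proof. exact: (envelope_envelops V31 hU realU_bundle realU_orth realU_transverse). Qed.

Lemma line_dim g p : rsubbundle 1 g -> \dim (g p) = 1%N.
Proof. by move=> /(_ p)[W [F [_ Wp _ bF]]]; exact: basis_dim (bF p Wp). Qed.

Lemma line_eq g g' p : rsubbundle 1 g -> rsubbundle 1 g' -> (forall v, v \in g p -> v \in g' p) ->
  g p = g' p.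
Proof.
move=> lg lg' H; apply/eqP; rewrite eqEdim; apply/andP; split; first exact/subvP.
by rewrite !line_dim.
Qed.

Lemma realU_unique g p : null_line_subbundle V g -> (forall v, v \in g p -> orthU U p (cmx v)) ->
  g p = f p.
Proof.
move=> [lg _ gV] gU; have [lf _ _] := realU_bundle.
apply: line_eq => // v vg; rewrite fE (subvP (gV p)) //=.
exact/asboolP/gU.
Qed.

End RankTwo.

(** * Oriented volumes in V *)

Section Volume.
Context {R : realType} {n : nat}.
Local Notation N := n.+2.
Local Notation JN := (Jmx R n.+1).
Implicit Types (F : 'M[R]_(4, n.+2)) (a b v w : 'rV[R]_n.+2).

Definition frame4 (a b v w : 'rV[R]_N) : 'M[R]_(2 + 2, N) := col_mx (col_mx a b) (col_mx v w).

Lemma frame4_row a b v w i : row i (frame4 a b v w) = nth 0 [:: a; b; v; w] i.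
Proof.
rewrite /frame4; case: (split_ordP i) => k ->; rewrite ?rowKu ?rowKd;
case: (split_ordP (k : 'I_(1 + 1))) => l ->; rewrite (ord1 l).
- exact: etrans (rowKu _ a b) (row_id _ _).
- exact: etrans (rowKd _ a b) (row_id _ _).
- exact: etrans (rowKu _ v w) (row_id _ _).
- exact: etrans (rowKd _ v w) (row_id _ _).
Qed.

(** An oriented volume: alternating in the four vectors, and multiplied by
    det A when the frame F is replaced by A F. *)
Definition vol (F : 'M[R]_(4, N)) a b v w : R := \det (frame4 a b v w *m JN *m F^T : 'M[R]_4).

Lemma vol_row F a b v w i : row i (frame4 a b v w *m JN *m F^T) = nth 0 [:: a; b; v; w] i *m JN *m
  F^T.
Proof. by rewrite !row_mul frame4_row. Qed.

Lemma vol_antisym F a b v w : vol F a b w v = - vol F a b v w.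
Proof.
rewrite /vol; set A := (frame4 a b v w *m JN *m F^T : 'M[R]_4).
have -> : frame4 a b w v *m JN *m F^T = row_perm (tperm 2%:R 3%:R) A.
  apply/row_matrixP => i; rewrite (_ : row i (row_perm _ A) = row (tperm 2%:R 3%:R i) A);
    last first.
    by apply/rowP => j; rewrite !mxE.
  rewrite !vol_row; congr (_ *m _ *m _).
  by case: i => -[|[|[|[|//]]]] lt; rewrite permE /=.
by rewrite row_permE det_mulmx det_perm odd_tperm /= expr1 mulN1r.
Qed.

(** Cofactors along the last row, which turn [vol] into a linear form in its
    last argument. *)
Definition vol_cov F a b v : 'cV[R]_4 :=
  \col_j cofactor (frame4 a b v 0 *m JN *m F^T : 'M[R]_4) ord_max j.

Lemma vol_linear F a b v w : vol F a b v w = (w *m JN *m F^T *m vol_cov F a b v) 0 0.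
Proof.
rewrite /vol (expand_det_row _ ord_max) mxE; apply: eq_bigr => j _;
  rewrite [vol_cov _ _ _ _ _ _]mxE.
congr (_ * _).
  have /rowP/(_ j) := vol_row F a b v w ord_max; rewrite mxE => ->; by rewrite /=.
rewrite /cofactor; congr (_ * \det _); apply/matrixP => k l; rewrite !mxE.
have lk : (lift ord_max k : nat) = k by rewrite lift_max.
have := vol_row F a b v w (lift ord_max k); have := vol_row F a b v 0 (lift ord_max k).
move=> /rowP/(_ (lift j l)) E1 /rowP/(_ (lift j l)) E2.
move: E1 E2; rewrite !mxE => -> ->; rewrite lk.
by case: k {lk} => -[|[|[|//]]].
Qed.

Lemma volD F a b v w w' : vol F a b v (w + w') = vol F a b v w + vol F a b v w'.
Proof. by rewrite !vol_linear !mulmxDl mxE. Qed.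

Lemma volZ F a b v x w : vol F a b v (x *: w) = x * vol F a b v w.
Proof. by rewrite !vol_linear -!scalemxAl mxE. Qed.

Lemma vol_rep F a b v w : w \in [:: a; b; v] -> vol F a b v w = 0.
Proof.
rewrite !inE => /or3P[] /eqP ->; [have i1 := (0 : 'I_4)|have i1 := (1 : 'I_4)|have i1 :=
  (2%:R : 'I_4)].
- apply: (@determinant_alternate _ _ _ 0 3%:R) => // j.
  have /rowP/(_ j) := vol_row F a b v a 0; have /rowP/(_ j) := vol_row F a b v a 3%:R.
  by rewrite !mxE => -> ->.
- apply: (@determinant_alternate _ _ _ 1 3%:R) => // j.
  have /rowP/(_ j) := vol_row F a b v b 1; have /rowP/(_ j) := vol_row F a b v b 3%:R.
  by rewrite !mxE => -> ->.
- apply: (@determinant_alternate _ _ _ 2%:R 3%:R) => // j.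
  have /rowP/(_ j) := vol_row F a b v v 2%:R; have /rowP/(_ j) := vol_row F a b v v 3%:R.
  by rewrite !mxE => -> ->.
Qed.

Lemma vol_sum (F : 'M[R]_(4, N)) a b v (x : 'rV_4) : vol F a b v (x *m F) = \sum_i x 0 i * vol F a
  b v (row i F).
Proof.
rewrite mulmx_sum_row; elim/big_ind2: _ => [|w r w' r' <- <-|i _]; last by rewrite volZ.
  by rewrite -(scale0r 0) volZ mul0r.
by rewrite volD.
Qed.

Lemma det2 (K : fieldType) (A : 'M[K]_2) : \det A = A 0 0 * A 1 1 - A 0 1 * A 1 0.
Proof.
rewrite (expand_det_row _ 0) !big_ord_recl big_ord0 addr0 /cofactor !det_mx11 !mxE /=.
rewrite expr0 expr1 mul1r mulN1r mulrN.
by congr (A _ _ * A _ _ - A _ _ * A _ _); exact: val_inj.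
Qed.

Lemma vol_frame (F : 'M[R]_(4, N)) (A : 'M[R]_4) a b v w : vol (A *m F) a b v w = \det A * vol F a
  b v w.
Proof. by rewrite /vol trmx_mul mulmxA det_mulmx det_tr mulrC. Qed.

(** The effect on the plane of a and b of multiplying a + i b by l + i m. *)
Lemma vol_rotate (F : 'M[R]_(4, N)) l m a b v w :
  vol F (l *: a - m *: b) (m *: a + l *: b) v w = (l ^+ 2 + m ^+ 2) * vol F a b v w.
Proof.
pose K2 : 'M[R]_(1 + 1) := block_mx l%:M (- m)%:M m%:M l%:M.
have -> : vol F (l *: a - m *: b) (m *: a + l *: b) v w =
   \det ((block_mx K2 0 0 1%:M : 'M[R]_(2 + 2)) *m (frame4 a b v w *m JN *m F^T)).
  rewrite /vol !mulmxA; congr (\det (_ *m _ *m _)).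
  rewrite /frame4 (mul_block_col K2) !mul0mx addr0 add0r mul1mx.
  by rewrite /K2 mul_block_col !mul_scalar_mx scaleNr.
rewrite det_mulmx det_ublock det1 mulr1; congr (_ * _).
have entry : [/\ K2 0 0 = l, K2 0 1 = - m, K2 1 0 = m & K2 1 1 = l].
  have e : (0 = lshift 1 (0 : 'I_1)) * (1 = rshift 1 (0 : 'I_1)) by split; exact: val_inj.
  by rewrite !e /K2 block_mxEul block_mxEur block_mxEdl block_mxEdr !mxE eqxx !mulr1n.
have [k00 k01 k10 k11] := entry.
by rewrite (det2 (K2 : 'M[R]_2)) k00 k01 k10 k11; ring.
Qed.

End Volume.

(** * The two null lines orthogonal to a definite plane *)

Section NullLines.
Context {R : realType} {n : nat}.
Local Notation N := n.+2.
Local Notation JN := (Jmx R n.+1).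
Variables (E : {vspace 'rV[R]_n.+2}) (sE : signature31 E).
Variables (F : 'M[R]_(4, N)) (bF : basis_of E (rows F)).
Variables (a b : 'rV[R]_N) (h : R) (aE : a \in E) (bE : b \in E).
Hypotheses (aa : ip a a = h) (bb : ip b b = h) (ab : ip a b = 0) (h0 : h != 0).

(** The volume, up to sign, of the frame F; dividing [vol F] by it gives a
    volume form depending only on the orientation. *)
Definition dens (F : 'M[R]_(4, N)) := Num.sqrt (- \det (gram F)).
Local Notation dl := (dens F).
Local Notation D := (vol F a b).

Let EF v : (v \in E) = (v <= F)%MS := ((basis_rowsP _ _).1 bF).2 v.

Lemma dens_gt0 : 0 < dl.
Proof. by rewrite sqrtr_gt0 oppr_gt0 (gram_det_lt0 sE bF). Qed.

Lemma dens_sq : dl ^+ 2 = - \det (gram F).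
Proof. by rewrite sqr_sqrtr // oppr_ge0 ltW // (gram_det_lt0 sE bF). Qed.

Lemma frame4_coord v w : v \in E -> w \in E -> exists X : 'M[R]_4, frame4 a b v w = X *m F.
Proof.
move=> vE wE; apply/submxP/row_subP => i; rewrite frame4_row -EF.
by case: i => -[|[|[|[|//]]]].
Qed.

(** The matrix of the products of (a, b, v, w) with (a, b, w, v) is triangular,
    with diagonal h, h, (v, w), (v, w).  Its determinant is also the product of
    the two volumes, up to the Gram determinant of F. *)
Lemma vol_sq v w : v \in E -> w \in E -> ip v v = 0 -> ip v a = 0 -> ip v b = 0 ->
  ip w a = 0 -> ip w b = 0 -> D v w ^+ 2 = (h * dl * ip v w) ^+ 2.
Proof.
move=> vE wE vv va vb wa wb.
have [X XE] := frame4_coord vE wE; have [X' XE'] := frame4_coord wE vE.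
have T : \det (frame4 a b v w *m JN *m (frame4 a b w v)^T : 'M[R]_4) = h ^+ 2 * ip v w ^+ 2.
  have E0 i j : (frame4 a b v w *m JN *m (frame4 a b w v)^T) i j =
     ip (nth 0 [:: a; b; v; w] i) (nth 0 [:: a; b; w; v] j) by rewrite ip_mx !frame4_row.
  rewrite det_trig.
    rewrite !big_ord_recl big_ord0 !E0 /= aa bb (ipC w) mulr1; ring.
  apply/is_trig_mxP => i j; rewrite E0.
  case: i j => -[|[|[|[|//]]]] lt [[|[|[|[|//]]]] lt'] //= _;
  by rewrite ?ab ?vv ?(ipC a v) ?(ipC a w) ?(ipC b v) ?(ipC b w) ?wa ?wb ?va ?vb.
have DX : D v w = \det X * \det (gram F) by rewrite /vol XE -det_mulmx /gram !mulmxA.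
have DX' : D w v = \det X' * \det (gram F) by rewrite /vol XE' -det_mulmx /gram !mulmxA.
have : D v w * D w v = \det (gram F) * (h ^+ 2 * ip v w ^+ 2).
  rewrite -T XE XE' trmx_mul DX DX'.
  rewrite (_ : X *m F *m JN *m (F^T *m X'^T) = X *m gram F *m X'^T); last by rewrite /gram !mulmxA.
  by rewrite !det_mulmx det_tr; ring.
rewrite (vol_antisym F a b v w) mulrN => /(congr1 -%R); rewrite opprK -expr2 => ->.
by rewrite !exprMn dens_sq; ring.
Qed.

(** An equation linear in v which selects one of the two null lines orthogonal
    to a and b.  For v on such a line the two sides agree up to a sign, which
    distinguishes the lines and depends on the orientation. *)
Definition on_line (eps : R) v := v \in E /\ forall w, w \in E -> h * dl * ip v w = eps * D v w.

Let hd0 : h * dl != 0. Proof. by rewrite mulf_neq0 // gt_eqF // dens_gt0. Qed.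

Lemma on_line_orth eps v : on_line eps v -> [/\ ip v v = 0, ip v a = 0 & ip v b = 0].
Proof.
move=> [vE H]; split; apply: (mulfI hd0); rewrite mulr0 H ?vol_rep ?mulr0 //;
by rewrite !inE eqxx ?orbT.
Qed.

Definition proj w := w - (ip w a / h) *: a - (ip w b / h) *: b.

Lemma proj_E w : w \in E -> proj w \in E.
Proof. by move=> wE; rewrite !rpredB // rpredZ. Qed.

Lemma proj_a w : ip (proj w) a = 0.
Proof. by rewrite /proj !ipDl !ipNl !ipZl aa (ipC b a) ab mulr0 oppr0 addr0 divfK // subrr. Qed.

Lemma proj_b w : ip (proj w) b = 0.
Proof. by rewrite /proj !ipDl !ipNl !ipZl bb ab mulr0 oppr0 addr0 divfK // subrr. Qed.

(** By [vol_sq], applied to the components of w orthogonal to a and b, the two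
    linear forms in w agree up to a sign at each w; by linearity the sign is the
    same for all w. *)
Lemma null_on_line v : v \in E -> ip v v = 0 -> ip v a = 0 -> ip v b = 0 ->
  on_line 1 v \/ on_line (-1) v.
Proof.
move=> vE vv va vb.
have sq w : w \in E -> D v w ^+ 2 = (h * dl * ip v w) ^+ 2.
  move=> wE; have wE' := proj_E wE.
  have Da : D v a = 0 by apply: vol_rep; rewrite !inE eqxx.
  have Db : D v b = 0 by apply: vol_rep; rewrite !inE eqxx orbT.
  have <- : D v (proj w) = D v w by rewrite /proj -!scaleNr !volD !volZ Da Db !mulr0 !addr0.
  have <- : ip v (proj w) = ip v w by rewrite /proj -!scaleNr !ipDr !ipZr va vb !mulr0 !addr0.
  by apply: vol_sq => //; rewrite ?proj_a ?proj_b.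
have pm w : w \in E -> h * dl * ip v w = D v w \/ h * dl * ip v w = - D v w.
  by move=> /sq/esym/eqP; rewrite eqf_sqr => /orP[] /eqP; [left|right].
have [H|H] := pselect (forall w, w \in E -> h * dl * ip v w = D v w).
  by left; split=> // w wE; rewrite mul1r H.
right; split=> // w wE; rewrite mulN1r.
have [w1 w1E n1] : exists2 w1, w1 \in E & h * dl * ip v w1 <> D v w1.
  by apply: contrapT => H'; apply: H => w1 w1E; apply: contrapT => n1; apply: H'; exists w1.
have m1 : h * dl * ip v w1 = - D v w1 by case: (pm w1 w1E).
case: (pm w wE) => // p0.
have := pm (w + w1) (rpredD wE w1E); rewrite ipDr volD mulrDr p0 m1 => -[] e.
  by case: n1; rewrite m1; lra.
by lra.
Qed.

(** Complete a, b to an orthogonal basis a, b, v1, v2, where v1 may be assumed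
    not to be null.  Its Gram determinant
    h^2 (v1, v1) (v2, v2) is negative, so (v1, v1) and (v2, v2) have opposite
    signs, and a combination of v1 and v2 is null. *)
Lemma null_vector : exists v, [/\ v \in E, v != 0, ip v v = 0, ip v a = 0 & ip v b = 0].
Proof.
have dE : \dim E = 4%N := basis_dim bF.
have outside (s : seq 'rV[R]_N) : (size s < 4)%N -> exists2 w, w \in E & w \notin << s >>%VS.
  move=> s4; apply/subvPn; apply: contraL s4 => /dimvS; rewrite dE -leqNgt => H.
  exact: leq_trans H (dim_span s).
have [w1 w1E w1n] := outside [:: a; b] isT.
have memab s x y : a \in s -> b \in s -> x *: a + y *: b \in << s >>%VS.
  by move=> as_ bs; rewrite rpredD // rpredZ // memv_span.
have p_out w (s : seq 'rV[R]_N) : a \in s -> b \in s -> w \notin << s >>%VS ->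
  proj w \notin << s >>%VS.
  move=> as_ bs; apply: contra => ps.
  rewrite (_ : w = proj w + ((ip w a / h) *: a + (ip w b / h) *: b)).
    by rewrite rpredD // memab.
  by rewrite /proj -[w - _ - _]addrA -opprD subrK.
have p10 : proj w1 != 0.
  by apply: contraNneq (p_out _ [:: a; b] _ _ w1n) => [->||]; rewrite ?rpred0 // !inE eqxx ?orbT.
have [g1|g1] := eqVneq (ip (proj w1) (proj w1)) 0; first by exists (proj w1); split;
  rewrite ?proj_E ?proj_a ?proj_b.
have [w2 w2E w2n] := outside [:: a; b; proj w1] isT.
pose v2 := proj w2 - (ip (proj w2) (proj w1) / ip (proj w1) (proj w1)) *: proj w1.
have v2E : v2 \in E by rewrite rpredB ?rpredZ ?proj_E.
have v2a : ip v2 a = 0 by rewrite /v2 -scaleNr ipDl ipZl !proj_a mulr0 addr0.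
have v2b : ip v2 b = 0 by rewrite /v2 -scaleNr ipDl ipZl !proj_b mulr0 addr0.
have v21 : ip v2 (proj w1) = 0 by rewrite /v2 -scaleNr ipDl ipZl mulNr divfK // subrr.
have w2n' : proj w2 \notin <<[:: a; b; proj w1]>>%VS by apply: p_out; rewrite ?inE ?eqxx ?orbT.
have v20 : v2 != 0.
  apply: contra w2n'; rewrite subr_eq0 => /eqP ->.
  by rewrite rpredZ // memv_span // !inE eqxx !orbT.
set v1 := proj w1 in g1 v21 p10; set q1 := ip v1 v1 in g1; pose q2 := ip v2 v2.
have v1E : v1 \in E by exact: proj_E.
have v1a : ip v1 a = 0 := proj_a w1.
have v1b : ip v1 b = 0 := proj_b w1.
have [X XE] := frame4_coord v1E v2E.
have Xu : \det X != 0.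
  have : row_free X.
    apply: inj_row_free => x xX.
    have : x *m frame4 a b v1 v2 = 0 by rewrite XE mulmxA xX mul0mx.
    rewrite mulmx_sum_row !big_ord_recl big_ord0 addr0 !frame4_row /=.
    set x0 := x 0 _; set x1 := x 0 _; set x2 := x 0 _; set x3 := x 0 _ => e.
    have z0 : x0 = 0.
      have := congr1 (fun v => ip v a) e; rewrite /= !ipDl !ipZl aa (ipC b) ab (proj_a w1) v2a ip0l
        !mulr0 !addr0.
      by move=> /eqP; rewrite mulf_eq0 (negbTE h0) orbF => /eqP.
    have z1 : x1 = 0.
      have := congr1 (fun v => ip v b) e; rewrite /= !ipDl !ipZl bb ab (proj_b w1) v2b ip0l !mulr0
        !addr0 add0r.
      by move=> /eqP; rewrite mulf_eq0 (negbTE h0) orbF => /eqP.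
    have z2 : x2 = 0.
      have := congr1 (fun v => ip v v1) e; rewrite /= !ipDl !ipZl z0 z1 v21 ip0l !mul0r !mulr0
        !addr0 !add0r.
      by move=> /eqP; rewrite mulf_eq0 (negbTE g1) orbF => /eqP.
    have z3 : x3 = 0.
      move: e; rewrite z0 z1 z2 !scale0r !add0r => /eqP.
      by rewrite scaler_eq0 (negbTE v20) orbF => /eqP.
    apply/row4P; rewrite mxE; [rewrite -[RHS]z0|rewrite -[RHS]z1|rewrite -[RHS]z2|rewrite -[RHS]z3];
      congr (x _ _); exact: val_inj.
  by rewrite row_free_unit unitmxE unitfE.
have T : \det (frame4 a b v1 v2 *m JN *m (frame4 a b v1 v2)^T : 'M[R]_4) = h ^+ 2 * (q1 * q2).
  have E0 i j : (frame4 a b v1 v2 *m JN *m (frame4 a b v1 v2)^T) i j =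
     ip (nth 0 [:: a; b; v1; v2] i) (nth 0 [:: a; b; v1; v2] j) by rewrite ip_mx !frame4_row.
  rewrite det_trig.
    by rewrite !big_ord_recl big_ord0 !E0 /= aa bb mulr1 -/q1 -/q2; ring.
  apply/is_trig_mxP => i j; rewrite E0.
  case: i j => -[|[|[|[|//]]]] lt [[|[|[|[|//]]]] lt'] //= _;
  by rewrite ?ab ?(ipC a v1) ?(ipC a v2) ?(ipC b v1) ?(ipC b v2) ?(ipC v1 v2) ?v1a ?v1b ?v2a ?v2b
    ?v21.
have neg : q1 * q2 < 0.
  have : h ^+ 2 * (q1 * q2) < 0.
    rewrite -T XE trmx_mul (_ : X *m F *m JN *m (F^T *m X^T) = X *m gram F *m X^T);
      last by rewrite /gram !mulmxA.
    rewrite !det_mulmx det_tr mulrAC -expr2 pmulr_rlt0 ?(gram_det_lt0 sE bF) //.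
    by rewrite exprn_even_gt0.
  by rewrite pmulr_rlt0 // exprn_even_gt0.
have nn : `|q1| * `|q2| = - (q1 * q2) by rewrite -normrM ltr0_norm.
exists (Num.sqrt `|q2| *: v1 + Num.sqrt `|q1| *: v2).
have s1 : Num.sqrt `|q1| ^+ 2 = `|q1| by rewrite sqr_sqrtr.
have s2 : Num.sqrt `|q2| ^+ 2 = `|q2| by rewrite sqr_sqrtr.
split.
- by rewrite rpredD ?rpredZ.
- apply/eqP => e; have := congr1 (fun v => ip v v1) e; rewrite /= ipDl !ipZl v21 ip0l mulr0 addr0
  => /eqP.
  rewrite mulf_eq0 (negbTE g1) orbF sqrtr_eq0 normr_le0 => /eqP q20.
  by move: neg; rewrite q20 mulr0 ltxx.
- rewrite ipDl !ipDr !ipZl !ipZr v21 (ipC v1) v21 !mulr0 addr0 add0r !mulrA -!expr2 s1 s2 -/q1 -/q2.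
  have [q1p|q1n|q10] := ltrgt0P q1; last by rewrite q10 eqxx in g1.
    have q2n : q2 < 0 by rewrite pmulr_rlt0 in neg.
    by rewrite ltr0_norm //; ring.
  have q2p : 0 < q2 by rewrite nmulr_rlt0 in neg.
  by rewrite gtr0_norm //; ring.
- by rewrite ipDl !ipZl proj_a v2a !mulr0 addr0.
- by rewrite ipDl !ipZl proj_b v2b !mulr0 addr0.
Qed.

Definition line_mx eps : 'M[R]_4 :=
  \matrix_(i, j) (h * dl * gram F i j - eps * D (row i F) (row j F)).

Lemma line_mx_ker eps (x : 'rV[R]_4) : x *m line_mx eps = 0 <-> on_line eps (x *m F).
Proof.
have ipF (j : 'I_4) : ip (x *m F) (row j F) = (x *m gram F) 0 j.
  by rewrite /gram !mulmxA ip_mx row_id.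
have E0 j : (x *m line_mx eps) 0 j = h * dl * ip (x *m F) (row j F) - eps * D (x *m F) (row j F).
  rewrite ipF (vol_antisym F a b (row j F)) vol_sum mulrN opprK [in RHS]mulr_sumr.
  rewrite !mxE mulr_sumr -big_split; apply: eq_bigr => i _; rewrite !mxE /=.
  rewrite (vol_antisym F a b (row j F)); ring.
split=> [H|[_ H]].
  split; first by rewrite EF submxMl.
  move=> w; rewrite EF => /submxP[y ->].
  rewrite ip_frame mxE vol_sum !mulr_sumr; apply: eq_bigr => j _.
  have := E0 j; rewrite H mxE ipF => /esym/eqP; rewrite subr_eq0 => /eqP E1.
  by rewrite (_ : y^T j 0 = y 0 j) ?mulrA ?E1; [ring|rewrite mxE].
by apply/rowP => j; rewrite E0 mxE H ?subrr // EF; exact: row_sub.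
Qed.

Lemma on_line_unique v w eps : eps != 0 -> on_line eps v -> on_line eps w -> v != 0 -> exists x,
  w = x *: v.
Proof.
move=> e0 Lv Lw v0; have [vv _ _] := on_line_orth Lv; have [ww _ _] := on_line_orth Lw.
case: Lv Lw => vE Hv [wE Hw].
apply: (null_proportional sE vE wE v0 vv _ ww).
have := Hw v vE; rewrite (vol_antisym F a b v w) mulrN ipC Hv // => /eqP.
rewrite -addr_eq0 -mulr2n -mulr_natl !mulf_eq0 pnatr_eq0 (negbTE e0) /= => /eqP D0.
by apply: (mulfI hd0); rewrite Hv // D0 !mulr0.
Qed.

(** The two matrices are transposes of each other. *)
Lemma det_line_mx : \det (line_mx 1) = \det (line_mx (-1)).
Proof.
have lE eps i j : line_mx eps i j = h * dl * gram F i j - eps * D (row i F) (row j F) by rewrite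
  mxE.
rewrite -det_tr; congr (\det _); apply/matrixP => i j; rewrite [LHS]mxE !lE.
rewrite (vol_antisym F a b (row i F)).
have -> : gram F j i = gram F i j by rewrite /gram !ip_mx ipC.
by ring.
Qed.

(** A null vector exists by [null_vector] and lies on one of the two lines; by
    [det_line_mx] the other line is then nonzero as well.  Two vectors of one line
    are orthogonal, because the volume is alternating, hence proportional. *)
Lemma line_mx_corank1 eps : eps = 1 \/ eps = -1 -> corank1 (line_mx eps).
Proof.
move=> he; have e0 : eps != 0 by case: he => ->; rewrite ?oppr_eq0 oner_eq0.
have [Ff _] := (basis_rowsP _ _).1 bF.
split.
  have [v [vE v0 vv va vb]] := null_vector.
  have /submxP[x vx] : (v <= F)%MS by rewrite -EF.
  have x0 : x != 0 by apply: contra v0 => /eqP x0; rewrite vx x0 mul0mx.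
  apply/det0P.
  have [] := null_on_line vE vv va vb; rewrite vx => /line_mx_ker xM.
    have d1 : \det (line_mx 1) == 0 by apply/det0P; exists x.
    by case: he => ->; rewrite -?det_line_mx //; apply/eqP.
  have d1 : \det (line_mx (-1)) == 0 by apply/det0P; exists x.
  by case: he => ->; rewrite ?det_line_mx //; apply/eqP.
move=> x y x0 /line_mx_ker Lx /line_mx_ker Ly.
have [|c E'] := on_line_unique e0 Lx Ly; first by rewrite mulmx_free_eq0.
exists c; apply/eqP; rewrite -subr_eq0 -(mulmx_free_eq0 _ Ff) mulmxBl E' scalemxAl subrr //.
Qed.

Lemma on_line_both v : on_line 1 v -> on_line (-1) v -> v = 0.
Proof.
move=> [vE H] [_ H'].
have H0 w : w \in E -> ip v w = 0.
  move=> wE; have := H w wE; have := H' w wE; rewrite mul1r mulN1r => -> e.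
  by apply: (mulfI hd0); rewrite H // mul1r mulr0; lra.
move: vE; rewrite EF => /submxP[x vx].
have : x *m gram F = 0.
  apply/rowP => j; rewrite /gram !mulmxA ip_mx row_id -vx mxE; apply: H0.
  by rewrite EF row_sub.
move=> /(congr1 (mulmx^~ (invmx (gram F)))); rewrite mulmxK ?(gram_unit sE bF) // mul0mx => x0.
by rewrite vx x0 mul0mx.
Qed.

End NullLines.

(** * U of rank one *)

Section RankOne.
Context {R : realType} {S : riemann_surface R} {n : nat}.
Local Notation N := n.+2.
Local Notation JN := (Jmx R n.+1).
Local Notation JC := (Jmx R[i] n.+1).
Local Notation kz := (0 -i* 1 : R[i]).
Local Notation kb := (0 +i* 1 : R[i]).
Implicit Types (c : chart R S) (C : set (chart R S)) (p q : S) (W O : set S)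
  (f g : S -> {vspace 'rV[R]_n.+2}).
Implicit Types (F : 'M[R]_(4, n.+2)).

Definition sqnorm (a : 'rV[R]_N) : R := ip a a.

Lemma dens_frame F (A : 'M[R]_4) : 0 < \det A -> dens (A *m F) = \det A * dens F.
Proof.
move=> A0; rewrite /dens.
have -> : gram (A *m F) = A *m gram F *m A^T by rewrite /gram trmx_mul !mulmxA.
rewrite !det_mulmx det_tr mulrAC -mulrN sqrtrM ?mulr_ge0 ?ltW // -expr2 sqrtr_sqr.
by rewrite ger0_norm // ltW.
Qed.

(** The line [on_line] for the plane of the real and imaginary parts of u. *)
Definition on_line_gen (E : {vspace 'rV[R]_N}) F (u : 'rV[R[i]]_N) eps v :=
  on_line E F (remx u) (immx u) (sqnorm (remx u)) eps v.

(** Both sides of the equation are multiplied by det A, provided that A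
    preserves the orientation. *)
Lemma on_line_gen_frame E F (A : 'M[R]_4) u eps v : 0 < \det A ->
  on_line_gen E (A *m F) u eps v <-> on_line_gen E F u eps v.
Proof.
move=> A0; have A1 : \det A != 0 by rewrite gt_eqF.
split=> -[vE H]; split=> // w wE.
  apply: (mulfI A1); have := H w wE; rewrite vol_frame dens_frame // => e.
  by rewrite [RHS]mulrCA -e; ring.
by rewrite vol_frame dens_frame // [RHS]mulrCA -H //; ring.
Qed.

Lemma remx_scale (x : R[i]) (u : 'rV[R[i]]_N) :
  remx (x *: u) = complex.Re x *: remx u - complex.Im x *: immx u /\
  immx (x *: u) = complex.Im x *: remx u + complex.Re x *: immx u.
Proof.
by split; apply/rowP => j; rewrite !mxE; case: x (u 0 j) => [x1 x2] [u1 u2] /=; ring.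
Qed.

Definition null_gen (a b : 'rV[R]_N) (h : R) := [/\ ip a a = h, ip b b = h, ip a b = 0 & h != 0].

(** Both sides of the equation are multiplied by the squared modulus of x. *)
Lemma on_line_gen_scale E F (x : R[i]) u eps v : x != 0 ->
  null_gen (remx u) (immx u) (sqnorm (remx u)) ->
  on_line_gen E F (x *: u) eps v <-> on_line_gen E F u eps v.
Proof.
move=> x0 [aa bb ab h0]; rewrite /on_line_gen; have [-> ->] := remx_scale x u.
set l := complex.Re x; set m := complex.Im x.
have lm0 : l ^+ 2 + m ^+ 2 != 0 by rewrite -complex_neq0.
have -> : sqnorm (l *: remx u - m *: immx u) = (l ^+ 2 + m ^+ 2) * sqnorm (remx u).
  rewrite /sqnorm -scaleNr !ipDl !ipDr !ipZl !ipZr (ipC (immx u) (remx u)) ab bb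
    -/(sqnorm (remx u)); ring.
split=> -[vE H]; split=> // w wE.
  apply: (mulfI lm0); have := H w wE; rewrite vol_rotate => e.
  by rewrite [RHS]mulrCA -e; ring.
by rewrite vol_rotate [RHS]mulrCA -H //; ring.
Qed.

Lemma germ_cmx C p a b (F : S -> 'M[R]_(a, b)) i j : mxgerm C p (fun q => cmx (F q)) ->
  germ C p (fun q => F q i j).
Proof. by move=> /(_ i j)[sr _]; apply: germ_ext sr; apply: nearW => q; rewrite mxE. Qed.

Lemma germ_det C p m (F : S -> 'M[R]_m) : mxgerm C p (fun q => cmx (F q)) ->
  germ C p (fun q => \det (F q)).
Proof.
move=> /cgerm_det[sr _]; apply: germ_ext sr; apply: nearW => q.
by rewrite /cmx det_map_mx.
Qed.

Lemma mxgerm_cmxM C p a b d (F : S -> 'M[R]_(a, b)) (G : S -> 'M[R]_(b, d)) :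
  mxgerm C p (fun q => cmx (F q)) -> mxgerm C p (fun q => cmx (G q)) ->
    mxgerm C p (fun q => cmx (F q *m G q)).
Proof. by move=> sF sG; apply: mxgerm_ext (mxgermM sF sG); apply: nearW => q; rewrite cmxM. Qed.

Lemma mxgerm_cmx_tr C p a b (F : S -> 'M[R]_(a, b)) :
  mxgerm C p (fun q => cmx (F q)) -> mxgerm C p (fun q => cmx (F q)^T).
Proof. by move=> sF; apply: mxgerm_ext (mxgerm_tr sF); apply: nearW => q; rewrite cmx_tr. Qed.

Lemma mxgerm_cmx_cst C p a b (A : 'M[R]_(a, b)) : mxgerm C p (fun=> cmx A).
Proof. exact: mxgerm_cst. Qed.

Lemma mxgerm_gram C p a (F : S -> 'M[R]_(a, N)) : mxgerm C p (fun q => cmx (F q)) ->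
  mxgerm C p (fun q => cmx (gram (F q))).
Proof.
by move=> sF; exact: mxgerm_cmxM (mxgerm_cmxM sF (mxgerm_cmx_cst _ _ _)) (mxgerm_cmx_tr sF).
Qed.

Lemma mxgerm_cmx_col C p a b d (F : S -> 'M[R]_(a, d)) (G : S -> 'M[R]_(b, d)) :
  mxgerm C p (fun q => cmx (F q)) -> mxgerm C p (fun q => cmx (G q)) ->
    mxgerm C p (fun q => cmx (col_mx (F q) (G q))).
Proof. by move=> sF sG; apply: mxgerm_ext (mxgerm_col sF sG); apply: nearW => q;
  rewrite /cmx map_col_mx. Qed.

Lemma mxgerm_cmx_row C p a d (F : S -> 'M[R]_(a, d)) i :
  mxgerm C p (fun q => cmx (F q)) -> mxgerm C p (fun q => cmx (row i (F q))).
Proof. by move=> sF k j; apply: cgerm_ext (sF i j); apply: nearW => q; rewrite !mxE. Qed.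

Lemma germ_vol C p (F : S -> 'M[R]_(4, N)) (a b v w : S -> 'rV[R]_N) :
  mxgerm C p (fun q => cmx (F q)) -> mxgerm C p (fun q => cmx (a q)) ->
    mxgerm C p (fun q => cmx (b q)) ->
  mxgerm C p (fun q => cmx (v q)) -> mxgerm C p (fun q => cmx (w q)) ->
  germ C p (fun q => vol (F q) (a q) (b q) (v q) (w q)).
Proof.
move=> sF sa sb sv sw; apply: germ_det.
apply: mxgerm_cmxM (mxgerm_cmx_tr sF); apply: mxgerm_cmxM (mxgerm_cmx_cst _ _ _).
exact: mxgerm_cmx_col (mxgerm_cmx_col sa sb) (mxgerm_cmx_col sv sw).
Qed.

Lemma mxgerm_line_mx C c p (F : S -> 'M[R]_(4, N)) (a b : S -> 'rV[R]_N) eps : C c -> cdom c p ->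
  \det (gram (F p)) < 0 ->
  mxgerm C p (fun q => cmx (F q)) -> mxgerm C p (fun q => cmx (a q)) ->
    mxgerm C p (fun q => cmx (b q)) ->
  mxgerm C p (fun q => cmx (line_mx (F q) (a q) (b q) (sqnorm (a q)) eps)).
Proof.
move=> Cc cp G0 sF sa sb i j.
have sG := mxgerm_gram sF.
have sh : germ C p (fun q => sqnorm (a q)).
  apply: germ_ext (germ_cmx 0 0 (mxgerm_gram sa)); apply: nearW => q.
  by rewrite /sqnorm /gram ip_mx !row_id.
have sd : germ C p (fun q => dens (F q)).
  apply: (germ_sqrt Cc cp (germN (germ_det sG))); by rewrite oppr_gt0.
have sv := germ_vol sF sa sb (mxgerm_cmx_row i sF) (mxgerm_cmx_row j sF).
have := cgerm_real (germB (germM (germM sh sd) (germ_cmx i j sG)) (germM (germ_cst _ _ eps) sv)).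
by apply: cgerm_ext; apply: nearW => q; rewrite [in RHS]mxE /line_mx [in RHS]mxE.
Qed.

Variables (V : S -> {vspace 'rV[R]_n.+2}) (V31 : bundle31 V).
Variables (Vh : harmonic_bundle [set: S] V).
Variables (U : S -> {vspace 'rV[R[i]]_n.+2}) (hU : is_bundle_U V U 1).
Hypothesis (Udisj : forall p, (U p :&: conjv (U p))%VS = 0%VS).
Let sV p : signature31 (V p) := V31.2 p.

Lemma U_not_real p u x : u \in U p -> cjmx u = x *: u -> u = 0.
Proof.
move=> uU ux; apply/eqP; rewrite -memv0 -(Udisj p); apply/memv_capP; split=> //.
by rewrite conjvP ux memvZ.
Qed.

Lemma U_reim p u : u \in U p -> remx u \in V p /\ immx u \in V p.
Proof.
have [F bF] := frame_ex (sV p).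
move=> /(U_sub hU); rewrite (cplxP bF) => /cmx_reim_sub.
by rewrite !((basis_rowsP _ _).1 bF).2.
Qed.

(** Isotropy of u = a + i b gives (a, a) = (b, b) and (a, b) = 0.  If (a, a)
    vanished, a and b would be proportional by [null_proportional], and u a
    multiple of a real vector. *)
Lemma U_null_gen p u : u \in U p -> u != 0 -> null_gen (remx u) (immx u) (sqnorm (remx u)).
Proof.
move=> uU u0; have [aV bV] := U_reim uU.
set a := remx u; set b := immx u.
have E : u = cmx a + kb *: cmx b := reim u.
have : ip u u = 0 := U_iso hU uU uU.
rewrite E ipDl !ipDr !ipZl !ipZr !cmx_ip mulrA kb_sq => e.
have e1 : ip a a = ip b b.
  have := congr1 (@complex.Re R) e; rewrite /= => e'; lra.
have e2 : ip a b = 0.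
  have := congr1 (@complex.Im R) e; rewrite /= (ipC b a) => e'; lra.
split=> //; apply/eqP => h0.
have bb : ip b b = 0 by rewrite -e1.
have [a0|a0] := eqVneq a 0.
  case/eqP: u0; apply: (U_not_real uU (x := -1)).
  rewrite E a0 /cmx map_mx0 add0r -/(cmx b) scaleN1r /cjmx map_mxZ -/(cjmx (cmx b)) cjmx_cmx.
  by rewrite -scaleNr; congr (_ *: _); apply/eqP; rewrite eq_complex /= oppr0 !eqxx.
have [x bx] := null_proportional (sV p) aV bV a0 h0 e2 bb; rewrite -/a -/b in bx.
case/eqP: u0; apply: (U_not_real uU (x := (1 -i* x) / (1 +i* x))).
have x1 : (1 +i* x : R[i]) != 0 by rewrite eq_complex /= oner_eq0.
have Ex : u = (1 +i* x) *: cmx a.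
  rewrite E bx /cmx map_mxZ scalerA -{1}[map_mx _ a]scale1r -scalerDl; congr (_ *: _).
  by apply/eqP; rewrite eq_complex /=; apply/andP; split; apply/eqP; ring.
rewrite Ex scalerA divfK // /cjmx map_mxZ -/(cjmx (cmx a)) cjmx_cmx.
by congr (_ *: _); apply/eqP; rewrite eq_complex /= !eqxx.
Qed.

Lemma U_multiple p u w : u \in U p -> u != 0 -> w \in U p -> exists x, w = x *: u.
Proof.
have [Fu [_ [W [_ Wp _ bFu]]]] := U_frame hU p.
have [Ff UF] := (basis_rowsP _ _).1 (bFu p Wp).
rewrite !UF => /submxP[x ->] u0 /submxP[y ->].
have x0 : x 0 0 != 0.
  apply: contra u0 => /eqP x0; rewrite (_ : x = 0) ?mul0mx //.
  by apply/rowP => i; rewrite ord1 x0 mxE.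
exists (y 0 0 / x 0 0); rewrite scalemxAl; congr (_ *m _).
by apply/rowP => i; rewrite ord1 mxE divfK.
Qed.

Lemma orthU_gen p u v : u \in U p -> u != 0 ->
  orthU U p (cmx v) <-> ip v (remx u) = 0 /\ ip v (immx u) = 0.
Proof.
move=> uU u0.
have e : ip (cmx v) u = (ip v (remx u))%:C + kb * (ip v (immx u))%:C.
  by rewrite {1}[u]reim ipDr ipZr !cmx_ip.
split=> [/(_ u uU)|[r0 i0] w wU].
  rewrite e => e'; split.
    by have := congr1 (@complex.Re R) e'; rewrite /= mul0r mul1r subrr addr0.
  by have := congr1 (@complex.Im R) e'; rewrite /= mul0r mul1r !add0r.
have [x ->] := U_multiple uU u0 wU.
by rewrite ipZr e r0 i0 mulr0 addr0 mulr0.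
Qed.

Variable (Eo : S -> 'M[R]_(4, N)).
Hypothesis Eor : forall p, exists O, exists F : S -> 'M[R]_(4, N),
  [/\ open O, O p, rsmooth O F, frame O F V
    & forall q, O q -> exists2 A : 'M[R]_4, 0 < \det A & Eo q = A *m F q].
Variable (u0 : S -> 'rV[R[i]]_N).
Hypothesis u0U : forall p, u0 p \in U p /\ u0 p != 0.

Lemma Eo_frame p : basis_of (V p) (rows (Eo p)).
Proof.
have [W [F [_ Op _ bF EA]]] := Eor p; have [A A0 ->] := EA p Op.
have [Ff EF] := (basis_rowsP _ _).1 (bF p Op).
have Au : A \in unitmx by rewrite unitmxE unitfE gt_eqF.
apply/basis_rowsP; split.
  apply: inj_row_free => x /eqP; rewrite mulmxA mulmx_free_eq0 // => /eqP xA.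
  by rewrite -(mulmxK Au x) xA mul0mx.
move=> v; rewrite EF; apply/idP/idP => /submxP[x ->].
  by rewrite -{1}[F p](mulKmx Au) [x *m (_ *m _)]mulmxA submxMl.
by rewrite mulmxA submxMl.
Qed.

(** The frames Eo and the generators u0 are chosen point by point, without
    continuity; only the orientation defined by Eo varies continuously, and the
    line depends on nothing else. *)
Lemma nullU_ex eps : exists f, forall p v, v \in f p <-> on_line_gen (V p) (Eo p) (u0 p) eps v.
Proof.
have H p : exists E : {vspace 'rV[R]_n.+2}, forall v, v \in E <->
  on_line_gen (V p) (Eo p) (u0 p) eps v.
  have [uU un] := u0U p; have [aV bV] := U_reim uU; have [aa bb ab h0] := U_null_gen uU un.
  have [E HE] := kernel_space (Eo p)
    (line_mx (Eo p) (remx (u0 p)) (immx (u0 p)) (sqnorm (remx (u0 p))) eps).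
  have K := line_mx_ker (Eo_frame p) (remx (u0 p)) (immx (u0 p)) (sqnorm (remx (u0 p))) eps.
  exists E => v; split; first by move=> /HE[x -> /K].
  move=> Lv; case: (Lv) => vV _.
  move: vV Lv; rewrite ((basis_rowsP _ _).1 (Eo_frame p)).2 => /submxP[x ->] Lv.
  by apply/HE; exists x => //; apply/K.
by have [f fP] := choice H; exists f.
Qed.

Section OneLine.
Variables (eps : R) (heps : eps = 1 \/ eps = -1) (f : S -> {vspace 'rV[R]_n.+2}).
Hypothesis fE : forall p v, v \in f p <-> on_line_gen (V p) (Eo p) (u0 p) eps v.

Lemma nullU_props p v : v \in f p -> [/\ v \in V p, ip v v = 0 & orthU U p (cmx v)].
Proof.
have [uU un] := u0U p; have [aV bV] := U_reim uU; have [aa bb ab h0] := U_null_gen uU un.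
move=> /fE Lv; have [vv va vb] := on_line_orth (sV p) (Eo_frame p) aV bV h0 Lv.
by split=> //; [case: Lv|apply/(orthU_gen _ uU un)].
Qed.

Lemma nullU_unique p v w : v \in f p -> w \in f p -> v != 0 -> exists x, w = x *: v.
Proof.
have [uU un] := u0U p; have [aV bV] := U_reim uU; have [aa bb ab h0] := U_null_gen uU un.
move=> /fE Lv /fE Lw v0.
have e0 : eps != 0 by case: heps => ->; rewrite ?oppr_eq0 oner_eq0.
exact: (on_line_unique (sV p) (Eo_frame p) aV bV h0 e0 Lv Lw v0).
Qed.

Lemma nullU_bundle : null_line_subbundle V f.
Proof.
split; first last.
- by move=> p; apply/subvP => v /nullU_props[].
- move=> p v w vf wf; have [_ vv _] := nullU_props vf.
  have [->|v0] := eqVneq v 0; first by rewrite ip0l.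
  by have [x ->] := nullU_unique vf wf v0; rewrite ipZr vv mulr0.
apply: (@rsubbundle_kernel _ _ _ 3) => p.
have [W [F [oO Op sF bF EA]]] := Eor p.
have [Fu [_ [W' [oW' W'p sFu bFu]]]] := U_frame hU p.
exists (W `&` W'), F, (fun q => line_mx (F q) (remx (Fu q)) (immx (Fu q)) (sqnorm (remx (Fu q)))
  eps).
split=> //; first exact: openI.
move=> q [Oq W'q].
have sFq := mxgerm_frame oO Oq sF; have sFuq := mxgerm_csmooth oW' W'q sFu.
have [Ff UF] := (basis_rowsP _ _).1 (bFu q W'q).
have [Fvf EV] := (basis_rowsP _ _).1 (bF q Oq).
have FuU : Fu q \in U q by rewrite UF submx_refl.
have Fu0 : Fu q != 0 by apply: contraTneq Ff => ->; rewrite /row_free mxrank0.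
have [aV bV] := U_reim FuU; have [aa bb ab h0] := U_null_gen FuU Fu0.
have [c [ac cq]] := atlas_coverE q.
have K := line_mx_ker (bF q Oq) (remx (Fu q)) (immx (Fu q)) (sqnorm (remx (Fu q))) eps.
have change v : v \in f q <-> on_line_gen (V q) (F q) (Fu q) eps v.
  have [uU un] := u0U q; have [A A0 EqA] := EA q Oq.
  have [x ux] := U_multiple FuU Fu0 uU.
  have x0 : x != 0 by apply: contra un => /eqP x0; rewrite ux x0 scale0r.
  have h1 := on_line_gen_scale (V q) (F q) eps v x0 (U_null_gen FuU Fu0).
  have h2 := on_line_gen_frame (V q) (F q) (u0 q) eps v A0.
  split=> [/fE|H]; first by rewrite EqA => /h2; rewrite ux => /h1.
  by apply/fE; rewrite EqA; apply/h2; rewrite ux; apply/h1.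
split=> //.
- apply: (mxgerm_line_mx eps ac cq (gram_det_lt0 (sV q) (bF q Oq)) sFq);
  [exact: mxgerm_re|exact: mxgerm_im].
- exact: (line_mx_corank1 (sV q) (bF q Oq) aV bV aa bb ab h0 heps).
move=> v; split.
  move=> /change Lv; have : v \in V q by case: Lv.
  by rewrite EV => /submxP[x vx]; exists x => //; apply/K; rewrite -vx.
by move=> [x -> /K Lx]; apply/change.
Qed.

Lemma nullU_orth p v : v \in f p -> orthU U p (cmx v).
Proof. by case/nullU_props. Qed.

Lemma nullU_transverse p v : v \in f p -> v != 0 -> exists2 u, u \in U p & forall a, u <> a *:
  cmx v.
Proof.
move=> vf v0; have [uU un] := u0U p; exists (u0 p) => // a ua.
have a0 : a != 0 by apply: contra un => /eqP a0; rewrite ua a0 scale0r.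
case/eqP: un; apply: (U_not_real uU (x := conjc a / a)).
by rewrite ua scalerA divfK // /cjmx map_mxZ -/(cjmx (cmx v)) cjmx_cmx.
Qed.

Lemma nullU_envelops : envelops V f.
Proof. exact: (envelope_envelops V31 hU nullU_bundle nullU_orth nullU_transverse). Qed.

Lemma nullU_willmore : willmore (immersed_locus f) f V.
Proof. exact: (envelope_willmore V31 Vh hU nullU_bundle nullU_orth nullU_transverse). Qed.

(** With A = (s_z, u) and B = (s_zzbar, u), the section B s_z - A s_zzbar of V
    is orthogonal to U, hence killed by N_z: this is a relation between kappa and
    D_zbar kappa.  It is not trivial: if A vanished, s_z and s_zbar would both
    lie in the plane of s and u. *)
Lemma nullU_swillmore : s_willmore (immersed_locus f) f V.
Proof.
split; first exact: nullU_willmore.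
move=> c p W s ac imm cp Wp ls.
have eq := section_enveloping nullU_bundle nullU_orth nullU_transverse ac cp Wp ls.
have [-> ->] := kappa_csec V31 Vh hU nullU_bundle nullU_orth nullU_transverse ac cp Wp ls.
have imm3 := free_dz (imm c W s ac cp Wp ls).
have ss : mxgerm [set c] p (csec s) by case: eq.
have [Fu [sFu [W' [oW' W'p _ bFu]]]] := U_frame hU p.
have sFu1 : mxgerm [set c] p Fu by apply: mxgerm_sub sFu => _ ->.
pose A q := ip (dmx c kz (csec s) q) (Fu q).
pose B q := ip (dmx c kz (dmx c kb (csec s)) q) (Fu q).
have s_z := mxgerm_dmx kz cp ss; have s_zb := mxgerm_dmx kz cp (mxgerm_dmx kb cp ss).
have sip (t : S -> 'rV[R[i]]_N) : mxgerm [set c] p t -> cgerm [set c] p (fun q => ip (t q) (Fu q)).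
  move=> st; apply: cgerm_ext (mxgermM (mxgermM st (mxgerm_cst _ _ JC)) (mxgerm_tr sFu1) 0 0).
  by apply: nearW => q; rewrite ipE.
have cancel (v1 v2 w : 'rV[R[i]]_N) : ip (ip v2 w *: v1 - ip v1 w *: v2) w = 0.
  by rewrite ipDl ipNl !ipZl mulrC subrr.
pose x q := B q *: dmx c kz (csec s) q - A q *: dmx c kz (dmx c kb (csec s)) q.
have sx : mxgerm [set c] p x by apply: mxgermB; apply: mxgermZ => //; exact: sip.
have xN : x p *m Nmx V c kz p = 0.
  apply: (orthU_Nmx V31 hU ac cp sx).
  apply: filterS2 (enveloping_near eq) (near_open oW' W'p) => q eq' W'q; split.
    by apply: memvB; apply: memvZ; [exact: (env_zV V31 hU ac eq')|exact: (env_zbV V31 hU ac eq')].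
  have [Ff UF] := (basis_rowsP _ _).1 (bFu q W'q).
  move=> u; rewrite UF => /submxP[y ->]; rewrite [y]mx11_scalar mul_scalar_mx ipZr.
  have -> : ip (x q) (Fu q) = 0 by exact: cancel.
  exact: mulr0.
have [Ff UF] := (basis_rowsP _ _).1 (bFu p W'p).
have FuU : Fu p \in U p by rewrite UF submx_refl.
have A0 : A p != 0.
  apply/eqP => A0.
  have [_ sVp sn sU [u uU [s0 us]]] : env_at V U (csec s) p by case: eq => _ _ /nbhs_singleton.
  have Fu0 : Fu p != 0 by apply: contraTneq Ff => ->; rewrite /row_free mxrank0.
  have [y uy] := U_multiple FuU Fu0 uU.
  have zu : ip (dmx c kz (csec s) p) u = 0 by rewrite uy ipZr -/(A p) A0 mulr0.
  have uV := U_sub hU uU; have uu := U_iso hU uU uU.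
  have [a1 [b1 E1]] := iso_plane V31 sVp uV (env_zV V31 hU ac eq) s0 us sn (sU u uU) uu
    (env_ds eq kz) zu.
  have [a2 [b2 E2]] := iso_plane V31 sVp uV (env_bV V31 hU ac eq) s0 us sn (sU u uU) uu
    (env_ds eq kb)
    (env_bU V31 hU ac eq uU).
  have /free3P/(_ (a1 * b2 - a2 * b1) (- b2) b1) := imm3.
  have -> : (a1 * b2 - a2 * b1) *: csec s p + (- b2) *: dmx c kz (csec s) p + b1 *:
    dmx c kb (csec s) p = 0.
    by rewrite E1 E2; apply/rowP => j; rewrite !mxE; ring.
  move=> /(_ erefl)[_ /eqP]; rewrite oppr_eq0 => /eqP b20 b10.
  have /free3P/(_ (- a1) 1 0) := imm3.
  by rewrite E1 b10 !scale0r !addr0 scale1r scaleNr addNr => /(_ erefl)[_ /eqP]; rewrite oner_eq0.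
apply/negP => /free2P/(_ (B p) (- A p)).
rewrite !scalemxAl -mulmxDl scaleNr -/(x p) xN => /(_ erefl)[_ /eqP].
by rewrite oppr_eq0 (negbTE A0).
Qed.

End OneLine.

Section TwoLines.
Variables (f fhat : S -> {vspace 'rV[R]_n.+2}).
Hypothesis fE : forall p v, v \in f p <-> on_line_gen (V p) (Eo p) (u0 p) 1 v.
Hypothesis fhatE : forall p v, v \in fhat p <-> on_line_gen (V p) (Eo p) (u0 p) (-1) v.
Let h1 : (1 : R) = 1 \/ (1 : R) = -1. Proof. by left. Qed.
Let h2 : (-1 : R) = 1 \/ (-1 : R) = -1. Proof. by right. Qed.
Let lf := nullU_bundle h1 fE.
Let lfhat := nullU_bundle h2 fhatE.

Lemma two_lines_disjoint p v : v \in f p -> v \in fhat p -> v = 0.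
Proof.
have [uU un] := u0U p; have [aa bb ab h0] := U_null_gen uU un.
move=> /fE L1 /fhatE L2; exact: (on_line_both (sV p) (Eo_frame p) h0 L1 L2).
Qed.

Lemma line_vector g p : rsubbundle 1 g -> exists v, v \in g p /\ v != 0.
Proof.
by move=> lg; have [W [s [Wp [_ _ ls]]]] := line_section p lg; exists (s p); exact: ls.
Qed.

Lemma two_lines_neq p : f p <> fhat p.
Proof.
move=> e; case: lf => l _ _; have [v [vf v0]] := line_vector p l.
by case/eqP: v0; apply: (two_lines_disjoint (p := p)); rewrite -?e.
Qed.

(** A line orthogonal to u is a null line orthogonal to a and b, and
    [null_on_line] gives its sign. *)
Lemma two_lines_exhaust g p : null_line_subbundle V g -> (forall v, v \in g p -> orthU U p (cmx v))
  ->
  g p = f p \/ g p = fhat p.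
Proof.
move=> [lg isog gV] gU; have [v [vg v0]] := line_vector p lg.
have [uU un] := u0U p; have [aV bV] := U_reim uU; have [aa bb ab h0] := U_null_gen uU un.
have [va vb] := (orthU_gen v uU un).1 (gU v vg).
have [l1 _ _] := lf; have [l2 _ _] := lfhat.
have [L|L] := null_on_line (sV p) (Eo_frame p) aV bV aa bb ab h0 (subvP (gV p) _ vg)
  (isog p v v vg vg) va vb.
  by left; apply: line_eq => // w wg; have [x ->] := line_multiple lg vg v0 wg; rewrite memvZ //;
    apply/fE.
by right; apply: line_eq => // w wg; have [x ->] := line_multiple lg vg v0 wg; rewrite memvZ //;
  apply/fhatE.
Qed.

Lemma near_neq g g' p : rsubbundle 1 g -> rsubbundle 1 g' -> g p <> g' p -> \forall q \near p,
  g q <> g' q.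
Proof.
move=> lg lg' ne.
have [W [s [Wp ls]]] := line_section p lg; have [W' [s' [W'p ls']]] := line_section p lg'.
case: (ls) (ls') => oW sW sg [oW' sW' sg'].
have [c [ac cp]] := atlas_coverE p.
have sM : mxgerm [set c] p (fun q => cmx (col_mx (s q) (s' q))).
  by apply: mxgerm_cmx_col; [apply: (mxgerm_sub _ (mxgerm_frame oW Wp sW))|apply:
    (mxgerm_sub _ (mxgerm_frame oW' W'p sW'))] => _ ->.
have [sp sp0] := sg p Wp; have [s'p s'p0] := sg' p W'p.
have Mp : row_free (col_mx (s p) (s' p)).
  apply: inj_row_free => x; rewrite -[x]hsubmxK mul_row_col.
  rewrite [lsubmx x]mx11_scalar [rsubmx x]mx11_scalar !mul_scalar_mx.
  move: (lsubmx x 0 0) (rsubmx x 0 0) => y z e.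
  have y0 : y = 0.
    apply: contrapT => /eqP y0; apply: ne; apply: line_eq => // w wg.
    have [t ->] := line_multiple lg sp sp0 wg; apply: memvZ.
    have -> : s p = (- (y^-1 * z)) *: s' p.
      apply: (scalerI y0); rewrite scalerA mulrN mulrA divff // mul1r scaleNr.
      by apply/eqP; rewrite -addr_eq0 e.
    exact: memvZ.
  move: e; rewrite y0 scale0r add0r => /eqP; rewrite scaler_eq0 (negbTE s'p0) orbF => /eqP ->.
  by rewrite !raddf0 row_mx0.
apply: filterS3 (row_free_near cp sM Mp) (near_open oW Wp) (near_open oW' W'p) => q Mq Wq W'q e.
have [sq sq0] := sg q Wq; have [s'q _] := sg' q W'q.
have [x xE] : exists x, s' q = x *: s q by apply: (line_multiple lg sq sq0); rewrite e.
have : row_mx x%:M (-1)%:M *m col_mx (s q) (s' q) = 0.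
  by rewrite mul_row_col !mul_scalar_mx scaleN1r xE subrr.
move=> /eqP; rewrite mulmx_free_eq0 // -row_mx0 => /eqP/eq_row_mx[_ /matrixP/(_ 0 0)].
by rewrite !mxE eqxx mulr1n => /eqP; rewrite oppr_eq0 oner_eq0.
Qed.

(** The set where g is f and the set where g is fhat are open and cover the
    connected surface. *)
Lemma two_lines_global g : rsubbundle 1 g -> (forall p, g p = f p \/ g p = fhat p) ->
  g = f \/ g = fhat.
Proof.
move=> lg H; have [l1 _ _] := lf; have [l2 _ _] := lfhat.
pose A := [set p | g p = f p].
have AC : ~` A = [set p | g p = fhat p].
  apply/seteqP; split=> p /=; first by case: (H p).
  by move=> e e'; apply: (@two_lines_neq p); rewrite -e.
have oA : open A.
  rewrite openE => p /= gf; have ne : g p <> fhat p by rewrite gf; exact: two_lines_neq.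
  by apply: filterS (near_neq lg l2 ne) => q; case: (H q).
have oC : open (~` A).
  rewrite AC openE => p /= gf.
  have ne : g p <> f p by rewrite gf => e; apply: (@two_lines_neq p).
  by apply: filterS (near_neq lg l1 ne) => q; case: (H q).
have [A0|nA] := pselect (A !=set0).
  left; apply/funext => p.
  have AT : A = [set: S].
    apply: (@rs_connected _ S A A0); first by exists A => //; rewrite setTI.
    by exists A; [rewrite -openC|rewrite setTI].
  by have : A p by rewrite AT.
right; apply/funext => p; case: (H p) => // gf; case: nA; by exists p.
Qed.

End TwoLines.
End RankOne.

(** * Surfaces with conformal Gauss map V *)

Theorem corollary2p4 (R : realType) (n : nat) (Sigma : riemann_surface R)
    (V : Sigma -> {vspace 'rV[R]_n.+2}) (r : nat)
    (U : Sigma -> {vspace 'rV[R[i]]_n.+2})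
    (V31 : bundle31 V) (Vconf : strongly_conformal V)
    (Vharm : harmonic_bundle [set: Sigma] V) (hU : is_bundle_U V U r) :
  (r = 2%N ->
    let good (f : Sigma -> {vspace 'rV[R]_n.+2}) :=
      null_line_subbundle V f /\
      where_immerses f (fun W => willmore W f V /\ ~ s_willmore W f V) in
    exists f, [/\ good f, envelops V f &
      forall g, good g ->
        (forall p, immersed_at g p -> g p = f p) /\
        (envelops V g -> g = f)])
  /\
  (r = 1%N -> (forall p, (U p :&: conjv (U p))%VS = 0%VS) -> orientable 4 V ->
    let good (f : Sigma -> {vspace 'rV[R]_n.+2}) :=
      null_line_subbundle V f /\
      where_immerses f (fun W => s_willmore W f V) in
    exists f fhat, [/\ good f /\ good fhat, envelops V f /\ envelops V fhat,
      f <> fhat,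
      (let W := immersed_locus f `&` immersed_locus fhat in
       W !=set0 -> dual_pair W f fhat V) &
      forall g, good g ->
        (forall p, immersed_at g p -> g p = f p \/ g p = fhat p) /\
        (envelops V g -> g = f \/ g = fhat)]).
Proof.
have gauss_orth g p : null_line_subbundle V g -> willmore (immersed_locus g) g V ->
    immersed_at g p -> forall v, v \in g p -> orthU U p (cmx v).
  by move=> nlg [_ gg _] imm v vg; exact: (immersed_orthU V31 hU nlg gg imm vg).
have env_orth g p : null_line_subbundle V g -> envelops V g ->
    forall v, v \in g p -> orthU U p (cmx v).
  by move=> nlg eg v vg; exact: (envelops_orthU V31 hU nlg eg vg).
split=> r_eq; subst r.
  move=> good; have [f fE] := realU_ex V31 hU.
  exists f; split.
  - split; first exact: (realU_bundle V31 hU fE).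
    move=> imm; split; first exact: (realU_willmore V31 Vharm hU fE).
    exact: (realU_not_swillmore V31 Vharm hU fE).
  - exact: (realU_envelops V31 hU fE).
  move=> g [nlg wg]; split.
    move=> p imm; apply: (realU_unique V31 hU fE nlg).
    by have [//|wm _] := wg; [exists p|exact: gauss_orth].
  move=> eg; apply/funext => p; apply: (realU_unique V31 hU fE nlg).
  exact: env_orth.
move=> Udisj [Eo Eor] good.
have /choice[u0 u0U] : forall p, exists u, u \in U p /\ u != 0.
  move=> p; have [Fu [_ [W [_ Wp _ bFu]]]] := U_frame hU p.
  have [Ff UF] := (basis_rowsP _ _).1 (bFu p Wp).
  exists (Fu p); rewrite UF submx_refl; split=> //.
  by apply: contraTneq Ff => ->; rewrite /row_free mxrank0.
have [f fE] := nullU_ex V31 hU Udisj Eor u0U 1.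
have [fhat fhatE] := nullU_ex V31 hU Udisj Eor u0U (-1).
have h1 : (1 : R) = 1 \/ (1 : R) = -1 by left.
have h2 : (-1 : R) = 1 \/ (-1 : R) = -1 by right.
have nlf := nullU_bundle V31 hU Udisj Eor u0U h1 fE.
have nlfhat := nullU_bundle V31 hU Udisj Eor u0U h2 fhatE.
have swf := nullU_swillmore V31 Vharm hU Udisj Eor u0U h1 fE.
have swfhat := nullU_swillmore V31 Vharm hU Udisj Eor u0U h2 fhatE.
have neq := two_lines_neq V31 hU Udisj Eor u0U fE fhatE.
exists f, fhat; split.
- by split; split.
- split; [exact: (nullU_envelops V31 hU Udisj Eor u0U h1 fE)|].
  exact: (nullU_envelops V31 hU Udisj Eor u0U h2 fhatE).
- by have [p _] := @rs_nonempty _ Sigma; move=> e; apply: (neq p); rewrite e.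
- move=> W W0.
  have restrict (g : Sigma -> {vspace 'rV[R]_n.+2}) (W' : set Sigma) : W' `<=` immersed_locus g ->
      willmore (immersed_locus g) g V -> willmore W' g V.
    move=> sW [[_ cg] gg hg]; split.
    + split=> // c p O s ac W'p; exact: cg ac (sW p W'p).
    + move=> c p O s ac W'p; exact: gg ac (sW p W'p).
    + move=> c p ac W'p; exact: hg ac (sW p W'p).
  split.
  + by apply: restrict (proj1 swf) => p [].
  + by apply: restrict (proj1 swfhat) => p [].
  + by have [p Wp] := W0; exists p.
move=> g [nlg wg]; have exh := two_lines_exhaust V31 hU Udisj Eor u0U fE fhatE nlg.
split=> [p imm|eg].
  apply: exh; have [//|wm _] := wg; [by exists p|exact: gauss_orth].
apply: (two_lines_global V31 hU Udisj Eor u0U fE fhatE); first by case: nlg.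
move=> p; apply: exh; exact: env_orth.
Qed.
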